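(* For every $\Delta \in \mathbb{N}$ and every $\gamma > 0$ there exist constants $\beta > 0$ and $n_0 \in \mathbb{N}$ such that the following holds. Let $H$ be a bipartite graph on $n \geq n_0$ vertices with maximum degree $\Delta(H) \leq \Delta$ and bandwidth at most $\beta n$. Let $G$ be a graph on $n$ vertices such that $d(x) + d(y) \geq (1+\gamma) n$ for all pairs of distinct non-adjacent vertices $x, y \in V(G)$. Then $G$ contains a copy of $H$.
   Context: A graph $H$ on $n$ vertices has bandwidth at most $b$ if there is a labelling of its vertices by $1,\dots,n$ such that $|i-j| \leq b$ for every edge $ij$. $d(x)$ denotes the degree of $x$ in $G$. *)

(* Defs.v *)
From mathcomp Require Import all_boot all_order all_algebra all_fingroup.
Set Implicit Arguments. Unset Strict Implicit. Unset Printing Implicit Defensive.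
Import Order.TTheory GRing.Theory Num.Theory.

Definition simple_graph (n : nat) (e : rel 'I_n) : Prop :=
  irreflexive e /\ symmetric e.

Definition deg (n : nat) (e : rel 'I_n) (x : 'I_n) : nat := #|[set y | e x y]|.

Definition maxdeg_le (n : nat) (e : rel 'I_n) (D : nat) : Prop :=
  forall x, deg e x <= D.

Definition bipartite (n : nat) (e : rel 'I_n) : Prop :=
  exists c : 'I_n -> bool, forall x y, e x y -> c x != c y.

(* bandwidth at most b (b real): a labelling of the vertices by 1..n
   (here a permutation of 'I_n, i.e. 0..n-1) with |s i - s j| <= b on edges *)
Definition bandwidth_le (R : numDomainType) (n : nat) (e : rel 'I_n) (b : R) : Prop :=
  exists s : {perm 'I_n}, forall i j, e i j ->
    ((`|(s i)%:Z - (s j)%:Z|)%:~R <= b)%R.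

Definition contains_copy (n m : nat) (eG : rel 'I_n) (eH : rel 'I_m) : Prop :=
  exists f : 'I_m -> 'I_n, injective f /\ forall x y, eH x y -> eG (f x) (f y).

(* Main.v *)
(** Apply Szemeredi's regularity lemma to G.  Up to irregular pairs, the reduced graph on the
    clusters inherits Ore's condition.  Hence, after cutting the clusters into equal units, the
    units have an almost perfect matching, and any two arcs of the reduced graph are joined by a
    short walk of arcs.  Cut H along its bandwidth order into superblocks and send them round-robin
    to the matched pairs of units; the two colour classes of a superblock go to the two units of
    the pair, oriented so that the loads balance, and the first few blocks of each superblock walk
    from the arc of the previous pair to the new one.  As a superblock is much smaller than a
    cluster, a plain greedy embedding suffices where one would expect the blow-up lemma.

    An independent set of "buffers" of H is left out of the greedy phase, and is placed at the end
    on the unused vertices of G, together with "swappers": vertices u of H which may be moved to any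
    vertex v of G adjacent to the image of N(u). The greedy choices are derandomised with a
    potential function so that for every buffer b, and every vertex v of G with many neighbours in
    the unit matched to the unit of b, many swappers u on the unit of b may move to v and have a
    place good for b. If a set X violated Hall's condition, the units on which enough swappers lie
    outside X would be closed under steps of the reduced graph, hence comprise almost all units by
    Ore's condition, and these swappers would give X too many neighbours. *)

From Stdlib Require Import Classical_Prop.
Require Import Defs.
From mathcomp Require Import all_boot all_order all_algebra all_fingroup.
From mathcomp Require Import ring lra zify.
Set Implicit Arguments. Unset Strict Implicit. Unset Printing Implicit Defensive.

(** Ore's condition forces only a minimum degree of order gamma n, so many leftover vertices may see
    the same few clusters and compete for the same buffers. Swappers relieve this by chains of
    exchanges.

    A non-edge of the reduced graph says something about degrees only if the pair is regular. The
    walk, matching and absorption arguments therefore all carry a relation of irregular pairs, in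
    which every cluster has few partners.

    The constants are fixed in this order: the density [d] from gamma, the survival probability [z],
    the number [S] of superblocks filling a unit, then [theta], [eps], the bound [K] on the number
    of clusters, the least relative size [lam] of a useful cluster, the number of blocks in a
    superblock, and finally [1 / M] for beta. As a superblock has length linear in n, the potential
    starts exponentially small, while there are only polynomially many tests. *)

Definition nbh (T : finType) (e : rel T) (x : T) : {set T} := [set y | e x y].

(** * Hall's theorem *)

Section Hall.
Variables S T : finType.

Definition nbhs (g : S -> T -> bool) (X : {set S}) : {set T} :=
  [set b | [exists x in X, g x b]].

Lemma nbhsU g X Y : nbhs g (X :|: Y) = nbhs g X :|: nbhs g Y.
Proof.
apply/setP => b; rewrite !inE; apply/exists_inP/orP.
  by case=> x /setUP[] xX gx; [left | right]; apply/exists_inP; exists x.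
by case=> /exists_inP[x xX gx]; exists x; rewrite // inE xX ?orbT.
Qed.

(** Induction on the size of [A]. A nonempty proper subset with no neighbour to spare splits the
    problem in two; if there is none, any edge may be used, as every smaller set can afford to lose
    one neighbour. [m0] makes the matching total on [S]. *)
Theorem hall (m0 : S -> T) (g : S -> T -> bool) (A : {set S}) :
  (forall X : {set S}, X \subset A -> #|X| <= #|nbhs g X|) ->
  exists m : S -> T, {in A &, injective m} /\ {in A, forall x, g x (m x)}.
Proof.
move: {2}(#|A|.+1) (ltnSn #|A|) => k.
elim: k g A => // k IH g A; rewrite ltnS => Ak HA.
have [->|[a aA]] := set_0Vmem A.
  by exists m0; split=> x; rewrite inE.
case: (pickP (fun X : {set S} => [&& X != set0, X \proper A & #|nbhs g X| <= #|X|])).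
  move=> X /and3P[X0 XA tight].
  have [|m1 [inj1 g1]] := IH g X (leq_trans (proper_card XA) Ak).
    by move=> Y YX; apply: HA; apply: subset_trans YX (proper_sub XA).
  pose g' x b := g x b && (b \notin nbhs g X).
  have ltD : #|A :\: X| < k.
    apply: leq_trans Ak; rewrite -(cardsID X A) -[ltnLHS]add0n ltn_add2r.
    rewrite (setIidPr (proper_sub XA)); by rewrite card_gt0.
  have [|m2 [inj2 g2]] := IH g' (A :\: X) ltD.
    move=> Y YAX.
    have YX : [disjoint X & Y].
      rewrite disjoint_sym disjoints_subset; apply: subset_trans YAX _.
      by apply/subsetP => z; rewrite !inE => /andP[].
    have sub : X :|: Y \subset A.
      rewrite subUset (proper_sub XA) /=; apply: subset_trans YAX _; exact: subsetDl.
    have := HA _ sub.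
    have -> : nbhs g (X :|: Y) = nbhs g X :|: nbhs g' Y.
      rewrite nbhsU; apply/setP => b; rewrite !in_setU; case: (boolP (b \in nbhs g X)) => //= bX.
      rewrite !inE; apply: eq_existsb => y; by rewrite /g' bX andbT.
    rewrite cardsU (disjoint_setI0 YX) cards0 subn0.
    have := leq_card_setU (nbhs g X) (nbhs g' Y); case=> le _.
    move=> h; have := leq_trans h le.
    move: tight; set u := #|nbhs g X|; set v := #|X|; lia.
  exists (fun x => if x \in X then m1 x else m2 x); split.
    have m1X x : x \in X -> m1 x \in nbhs g X.
      by move=> xX; rewrite inE; apply/exists_inP; exists x => //; exact: g1.
    have m2X x : x \in A -> x \notin X -> m2 x \notin nbhs g X.
      by move=> xA xX; have := g2 x; rewrite inE xX xA => /(_ isT) /andP[].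
    move=> x y xA yA; case: ifPn => xX; case: ifPn => yX.
    - exact: inj1.
    - by move=> E; have := m2X _ yA yX; rewrite -E m1X.
    - by move=> E; have := m2X _ xA xX; rewrite E m1X.
    - by apply: inj2; rewrite inE ?xX ?yX.
  move=> x xA; case: ifPn => xX; first exact: g1.
  by have := g2 x; rewrite inE xX xA => /(_ isT) /andP[].
move=> loose.
have : 0 < #|nbhs g [set a]|.
  by apply: leq_trans (HA _ _); rewrite ?cards1 // sub1set.
case/card_gt0P => b; rewrite inE => /exists_inP[a']; rewrite inE => /eqP -> gab.
pose g' x c := g x c && (c != b).
have ltD : #|A :\ a| < k by rewrite (cardsD1 a) aA in Ak.
have [|m [injm gm]] := IH g' (A :\ a) ltD.
  move=> Y YA.
  have [->|Y0] := eqVneq Y set0; first by rewrite cards0.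
  have YpA : Y \proper A.
    apply: sub_proper_trans YA _; exact: properD1.
  have := loose Y; rewrite Y0 YpA /= => /negbT; rewrite -ltnNge => lt.
  have : #|nbhs g Y| <= #|b |: nbhs g' Y|.
    apply/subset_leq_card/subsetP => c; rewrite !inE; case: eqP => //= cb.
    case/exists_inP => y yY gy; apply/exists_inP; exists y => //.
    by rewrite /g' gy; apply/eqP.
  rewrite cardsU1; case: (b \notin _) => /=; lia.
exists (fun x => if x == a then b else m x); split.
  have mb x : x \in A -> x != a -> m x != b.
    by move=> xA xa; have := gm x; rewrite !inE xA xa => /(_ isT) /andP[].
  move=> x y xA yA; case: eqP => [->|/eqP xa]; case: eqP => [->|/eqP ya] //.
  - by move=> E; have := mb _ yA ya; rewrite -E eqxx.
  - by move=> E; have := mb _ xA xa; rewrite E eqxx.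
  - by apply: injm; rewrite !inE ?xa ?ya.
move=> x xA; case: eqP => [->|/eqP xa] //.
by have := gm x; rewrite !inE xA xa => /(_ isT) /andP[].
Qed.

End Hall.

(** * Cutting a graph of small bandwidth into blocks *)

Lemma card_le_code (T : finType) (A : {set T}) (m : nat) (g : T -> nat) :
  (forall x, x \in A -> g x < m) -> {in A &, injective g} -> #|A| <= m.
Proof.
move=> gm ginj; rewrite -(size_iota 0 m) cardE -(size_map g); apply: uniq_leq_size.
  by rewrite map_inj_in_uniq ?enum_uniq // => x y; rewrite !mem_enum; exact: ginj.
by move=> _ /mapP[x + ->]; rewrite mem_enum mem_iota => /gm.
Qed.

Lemma card_bigcup_le (T I : finType) (A : {set I}) (F : I -> {set T}) (m : nat) :
  (forall i, i \in A -> #|F i| <= m) -> #|\bigcup_(i in A) F i| <= #|A| * m.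
Proof.
move=> Fm; rewrite -sum_nat_const.
apply: (@leq_trans (\sum_(i in A) #|F i|)); last exact: leq_sum.
elim/big_rec2: _ => [|i k B _ le]; first by rewrite cards0.
by apply: leq_trans (leq_card_setU _ _).1 _; rewrite leq_add2l.
Qed.

(** Greedy: the larger number of each pair goes to the currently smaller sum, so the sums never
    differ by more than [ell]. *)
Lemma balanced_orientation (x y : nat -> nat) (ell m : nat) :
  (forall k, x k <= ell) -> (forall k, y k <= ell) ->
  exists o : nat -> bool,
    (\sum_(k < m) (if o k then x k else y k) <= \sum_(k < m) (if o k then y k else x k) + ell) /\
    (\sum_(k < m) (if o k then y k else x k) <= \sum_(k < m) (if o k then x k else y k) + ell).
Proof.
move=> xl yl; elim: m => [|m [o [h1 h2]]]; first by exists xpredT; rewrite !big_ord0.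
set s1 := \sum_(k < m) _ in h1 h2; set s2 := \sum_(k < m) _ in h1 h2.
pose b := if s1 <= s2 then y m <= x m else x m < y m.
pose o' k := if k == m then b else o k.
exists o'; rewrite !big_ord_recr /=.
have eqo (u v : nat -> nat) :
    \sum_(k < m) (if o' k then u k else v k) = \sum_(k < m) (if o k then u k else v k).
  by apply: eq_bigr => k _; rewrite /o' ltn_eqF.
rewrite !eqo -/s1 -/s2 /o' eqxx /b.
have := xl m; have := yl m; clearbody s1 s2; clear -h1 h2.
move: (x m) (y m) => u v; case: (leqP s1 s2) => c; [case: (leqP v u) | case: (ltnP u v)] => ?; lia.
Qed.

Lemma card_ge_fibers (T : finType) (S : {set T}) (g : T -> nat) (a q : nat) :
  (forall k, k < a -> q <= #|[set x in S | g x == k]|) -> a * q <= #|S|.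
Proof.
move=> fib; suff : a * q <= #|[set x in S | g x < a]|.
  move/leq_trans; apply; apply/subset_leq_card/subsetP => x; by rewrite inE => /andP[].
elim: a fib => // a IH fib; rewrite mulSn addnC.
have -> : [set x in S | g x < a.+1] = [set x in S | g x < a] :|: [set x in S | g x == a].
  by apply/setP => x; rewrite !inE ltnS leq_eqVlt orbC andb_orr.
rewrite cardsU (_ : _ :&: _ = set0); last first.
  by apply/setP => x; rewrite !inE; case: ltngtP; rewrite ?andbF.
rewrite cards0 subn0 leq_add ?fib //; apply: IH => k ka; apply: fib.
exact: ltnW.
Qed.

(* An isolated vertex takes the parity of its label, so that both colours are frequent in every
   interval of labels, even where H has no edges. *)
Lemma bipartite_recolor (n : nat) (H : rel 'I_n) (c : 'I_n -> bool) : symmetric H ->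
  (forall x y, H x y -> c x != c y) ->
  exists c' : 'I_n -> bool, (forall x y, H x y -> c' x != c' y) /\
    (forall x, (forall y, ~~ H x y) -> c' x = odd x).
Proof.
move=> Hs Hc; exists (fun x => if [exists y, H x y] then c x else odd x); split.
  move=> x y xy; have -> : [exists y, H x y] by apply/existsP; exists y.
  have -> : [exists z, H y z] by apply/existsP; exists x; rewrite Hs.
  exact: Hc.
by move=> x nx; case: existsP => // -[y]; rewrite (negPf (nx y)).
Qed.

Definition flip (I : Type) (x : I * bool) := (x.1, ~~ x.2).

(* Labels are cut into superblocks of [ell = Lb * w] labels, where [w] bounds the bandwidth:
   superblock [t] belongs to the pair of units number [pr t] in round [rd t], and its first [D0]
   blocks of [w] labels are in transit.  Rounds before [A1] supply the buffers, the next [2 * A2]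
   the swappers, first for one unit of each pair and then for the other. *)
Section Plan.
Variables (n : nat) (H : rel 'I_n) (L : finType) (r : rel L) (Np' : nat).
Let Np := Np'.+1.
Variables (cl : 'I_Np * bool -> L) (chi : 'I_n -> bool).
Variables (w Lb D0 A1 A2 A q Delta : nat).
Let ell := Lb * w.

(* All four edges are needed: an edge of H may join blocks which lie on consecutive arcs, in
   either direction of the colouring. *)
Definition arc_step (a b : L * L) := [&& r a.1 a.2, r b.1 b.2, r a.1 b.2 & r b.1 a.2].

Hypotheses (H_sym : symmetric H) (degH : forall x, #|nbh H x| <= Delta).
Hypotheses (chi_col : forall x y, H x y -> chi x != chi y)
  (chi_iso : forall x, (forall y, ~~ H x y) -> chi x = odd x).
Hypothesis width : forall x y, H x y -> x <= y + w.
Hypotheses (r_sym : symmetric r) (cl_r : forall x, r (cl x) (cl (flip x))).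
Hypothesis arc_path : forall a b : L * L, r a.1 a.2 -> r b.1 b.2 ->
  exists s : nat -> L * L, [/\ s 0 = a, s D0 = b & forall k, k < D0 -> arc_step (s k) (s k.+1)].
Hypotheses (w_gt0 : 0 < w) (D0_Lb : D0 < Lb).
Hypothesis q_room : 2 * ((Delta * Delta).+1 * Delta.+1 * q) + (D0 + 6) * w <= ell.
Hypotheses (n_le : n <= A * Np * ell) (n_ge : (A1 + 2 * A2) * Np * ell <= n).

Lemma ell_gt0 : 0 < ell.
Proof. by rewrite muln_gt0 w_gt0 (leq_ltn_trans _ D0_Lb). Qed.

Definition sb (x : 'I_n) := x %/ ell.
Definition pr (t : nat) : 'I_Np := inord (t %% Np).
Definition rd (t : nat) := t %/ Np.
Definition pos (x : 'I_n) := x %% ell.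
Definition transit x := pos x < D0 * w.

Lemma posE x : nat_of_ord x = sb x * ell + pos x.
Proof. exact: divn_eq. Qed.

Lemma pos_lt x : pos x < ell. Proof. by rewrite ltn_mod ell_gt0. Qed.

Lemma sb_pos_inj x y : sb x = sb y -> pos x = pos y -> x = y.
Proof. by move=> e1 e2; apply: val_inj; rewrite /= posE [RHS]posE e1 e2. Qed.

Lemma pr_rd_inj s t : pr s = pr t -> rd s = rd t -> s = t.
Proof.
move=> /(congr1 val); rewrite /= !inordK ?ltn_mod // => e1 e2.
by rewrite (divn_eq s Np) (divn_eq t Np) -/(rd s) -/(rd t) e2 e1.
Qed.

Lemma sb_lt x : sb x < A * Np.
Proof. by rewrite ltn_divLR ?ell_gt0 //; apply: leq_trans n_le. Qed.

Lemma rd_lt m t : (rd t < m) = (t < m * Np).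
Proof. by rewrite ltn_divLR. Qed.

Lemma pos_near (x y : 'I_n) : y <= x + w -> x <= y + w -> w <= pos x -> pos x + w < ell ->
  [/\ sb y = sb x, pos x <= pos y + w & pos y <= pos x + w].
Proof.
move=> h1 h2 h3 h4; have := posE x; move: (sb x) (pos x) h3 h4 => t p h3 h4 E.
have yE : nat_of_ord y = t * ell + (y - t * ell) by rewrite subnKC //; lia.
have lt : y - t * ell < ell by lia.
have e1 : sb y = t by rewrite /sb yE divnMDl ?ell_gt0 // divn_small // addn0.
have e2 : pos y = y - t * ell by rewrite /pos [in LHS]yE modnMDl modn_small.
by rewrite e1 e2; split=> //; lia.
Qed.

(** The margins pay for two edges: neighbours of a deep vertex are out of transit, and its second
    neighbours are still in the same superblock. *)
Definition deep x := ((D0 + 2) * w <= pos x) && (pos x + 2 * w < ell).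

Lemma deep_nbh x y : deep x -> H x y ->
  [/\ sb y = sb x, (D0 + 1) * w <= pos y & pos y + w < ell].
Proof.
case/andP => h1 h2 xy; have wx := width xy; rewrite H_sym in xy; have wy := width xy.
have [||e1 e2 e3] := @pos_near x y wy wx; [lia | lia | split=> //; lia].
Qed.

Lemma sb_nbh2 x y z : deep x -> H x y -> H y z -> sb z = sb x.
Proof.
move=> dx xy yz; have [e1 e2 e3] := deep_nbh dx xy; rewrite -e1.
have wx := width yz; rewrite H_sym in yz; have wy := width yz.
by have [||e _ _] := @pos_near y z wy wx; [lia | lia | rewrite e].
Qed.

Definition deepset t c := [set x | [&& sb x == t, deep x & chi x == c]].

Definition scattered t c (Y : {set 'I_n}) := (Y \subset deepset t c) &&
  [forall u in Y, forall v in Y, (u != v) ==> [disjoint nbh H u & nbh H v]].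

Definition chosen t c : {set 'I_n} := odflt set0 [pick Y | maxset (scattered t c) Y].

Lemma chosen_max t c : maxset (scattered t c) (chosen t c).
Proof.
rewrite /chosen; case: pickP => //= none.
have [Y YP] : {Y : {set 'I_n} | maxset (scattered t c) Y}.
  apply: ex_maxset; exists set0; rewrite /scattered sub0set /=.
  by apply/forall_inP => u; rewrite inE.
by rewrite none in YP.
Qed.

Lemma chosen_deep t c x : x \in chosen t c -> [/\ sb x = t, deep x & chi x = c].
Proof.
move=> xc; have /maxsetP[/andP[/subsetP sub _] _] := chosen_max t c.
by have := sub x xc; rewrite inE => /and3P[/eqP -> -> /eqP ->].
Qed.

Lemma chosen_disj t c u v z : u \in chosen t c -> v \in chosen t c -> H u z -> H v z -> u = v.
Proof.
move=> uc vc uz vz; have /maxsetP[/andP[_ /forall_inP h] _] := chosen_max t c.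
have /forall_inP/(_ v vc)/implyP h2 := h u uc.
apply/eqP; apply: contraT => /h2; rewrite -setI_eq0 => /eqP/setP/(_ z).
by rewrite !inE uz vz.
Qed.

Lemma card_nbh2 u : #|u |: \bigcup_(z in nbh H u) nbh H z| <= (Delta * Delta).+1.
Proof.
apply: leq_trans (leq_card_setU _ _).1 _; rewrite cards1 add1n ltnS.
apply: leq_trans (card_bigcup_le (m := Delta) _) _; first by move=> z _; exact: degH.
by rewrite leq_mul2r degH orbT.
Qed.

(** By maximality every vertex of [deepset t c] is chosen or shares a neighbour with a chosen
    vertex, so the chosen vertices and their second neighbours cover it. *)
Lemma deepset_chosen t c : #|deepset t c| <= #|chosen t c| * (Delta * Delta).+1.
Proof.
apply: leq_trans (card_bigcup_le (F := fun u => u |: \bigcup_(z in nbh H u) nbh H z) _);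
  last by move=> u _; exact: card_nbh2.
apply/subset_leq_card/subsetP => x xd; apply/bigcupP.
have [xc|xc] := boolP (x \in chosen t c); first by exists x => //; exact: setU11.
have /maxsetP[/andP[sub /forall_inP dis] mx] := chosen_max t c.
case: (pickP (fun u => (u \in chosen t c) && ~~ [disjoint nbh H u & nbh H x])) => [u /andP[uc]|none].
  rewrite -setI_eq0 => /set0Pn[z]; rewrite !inE => /andP[uz xz].
  exists u => //; rewrite inE; apply/orP; right; apply/bigcupP; exists z; rewrite inE //.
  by rewrite H_sym.
case/negP: xc; rewrite -(mx (x |: chosen t c)) ?setU11 ?subsetUr //.
have disx u : u \in chosen t c -> [disjoint nbh H u & nbh H x].
  by move=> uc; have := none u; rewrite uc => /negbFE.
rewrite /scattered subUset sub1set xd sub /=.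
apply/forall_inP => u /setU1P[->|uc]; apply/forall_inP => v /setU1P[->|vc].
- by rewrite eqxx.
- by rewrite disjoint_sym disx // implybT.
- by rewrite disx // implybT.
- by have /forall_inP := dis u uc; apply.
Qed.

(** Take labels of parity [c] well inside the superblock. A vertex there of the wrong colour is not
    isolated, by [chi_iso], hence has a neighbour of colour [c], which is deep. So the closed
    neighbourhoods of the deep vertices of colour [c] cover all these labels. *)
Lemma deepset_card t c : t.+1 * ell <= n ->
  (Delta * Delta).+1 * Delta.+1 * q <= #|deepset t c| * Delta.+1.
Proof.
move=> tn; set k := _ * q.
have kroom : 2 * k + (D0 + 6) * w <= ell by exact: q_room.
pose base := t * ell + (D0 + 3) * w.
pose start := base + (odd base (+) c).
have st1 : start <= base + 1 by rewrite /start; case: (_ (+) _); lia.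
have st0 : base <= start by rewrite /start leq_addr.
have bnd (i : 'I_k) : start + 2 * i < n by have := ltn_ord i; rewrite /base in st1 st0; lia.
pose g (i : 'I_k) : 'I_n := Ordinal (bnd i).
have ginj : injective g by move=> i j /(congr1 val) /= h; apply: val_inj => /=; lia.
have par i : odd (g i) = c.
  by rewrite /= oddD oddM /= addbF /start oddD; rewrite oddb; case: (odd base); case: (c).
have gpos i : [/\ sb (g i) = t, (D0 + 3) * w <= pos (g i) & pos (g i) + 3 * w < ell].
  have E : nat_of_ord (g i) = t * ell + (start + 2 * i - t * ell).
    by rewrite /= subnKC //; rewrite /base in st0; lia.
  have lt : start + 2 * i - t * ell < ell.
    by have := ltn_ord i; rewrite /base in st1 st0; lia.
  have e1 : sb (g i) = t by rewrite /sb E divnMDl ?ell_gt0 // divn_small // addn0.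
  have e2 : pos (g i) = start + 2 * i - t * ell by rewrite /pos E modnMDl modn_small.
  by rewrite e1 e2; have := ltn_ord i; rewrite /base in st1 st0; split=> //; lia.
rewrite -[k]card_ord -(card_imset _ ginj).
apply: leq_trans (card_bigcup_le (F := fun u => u |: nbh H u) _); last first.
  by move=> u _; rewrite cardsU1 -add1n leq_add //; case: (_ \notin _).
apply/subset_leq_card/subsetP => _ /imsetP[i _ ->].
have [e1 e2 e3] := gpos i; apply/bigcupP.
have [col|col] := eqVneq (chi (g i)) c.
  by exists (g i); rewrite ?setU11 // inE e1 eqxx col eqxx andbT /deep; lia.
case: (pickP (H (g i))) => [y iy|none]; last first.
  by case/negP: col; rewrite chi_iso ?par // => y; rewrite none.
exists y; last by rewrite !inE H_sym iy orbT.
have wx := width iy; have := chi_col iy; rewrite H_sym in iy; have wy := width iy.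
have [|| f1 f2 f3] := @pos_near (g i) y wy wx; [lia | lia | move=> ne].
rewrite inE f1 e1 eqxx /= /deep; apply/andP; split; first by lia.
by move: ne col; case: (chi (g i)); case: (chi y); case: (c).
Qed.

Lemma chosen_card t c : t.+1 * ell <= n -> q <= #|chosen t c|.
Proof.
move=> /(deepset_card c) le; have := leq_trans le (leq_mul (deepset_chosen t c) (leqnn Delta.+1)).
by rewrite -[leqRHS]mulnA [leqRHS]mulnC leq_pmul2l ?muln_gt0.
Qed.

(** The colour is fixed in advance, because the orientation balances [load], from which the buffers
    are excluded. Swappers are chosen after the orientation, so that their side can be
    prescribed. *)
Definition buffers := [set x | (rd (sb x) < A1) && (x \in chosen (sb x) false)].

Definition load t b := #|[set x | [&& x \notin buffers, ~~ transit x, sb x == t & chi x == b]]|.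

Lemma sb_size t : #|[set x | sb x == t]| <= ell.
Proof.
apply: card_le_code (pos) _ _ => [x _|x y]; first exact: pos_lt.
by rewrite !inE => /eqP e1 /eqP e2; apply: sb_pos_inj; rewrite e1.
Qed.

Lemma load_le t b : load t b <= ell.
Proof.
apply: leq_trans (sb_size t); apply/subset_leq_card/subsetP => x.
by rewrite !inE => /and4P[].
Qed.

Lemma orientation : exists o : nat -> bool, forall (p : 'I_Np) (b : bool),
  \sum_(k < A.+1) load (k * Np + p) (o (k * Np + p) (+) b)
    <= \sum_(k < A.+1) load (k * Np + p) (o (k * Np + p) (+) ~~ b) + ell.
Proof.
have /fin_all_exists[o oP] (p : 'I_Np) : exists o : nat -> bool, forall b,
  \sum_(k < A.+1) load (k * Np + p) (o k (+) b)
    <= \sum_(k < A.+1) load (k * Np + p) (o k (+) ~~ b) + ell.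
  have [o [o1 o2]] := @balanced_orientation (fun k => load (k * Np + p) true)
    (fun k => load (k * Np + p) false) ell A.+1 (fun k => load_le _ _) (fun k => load_le _ _).
  have Et : \sum_(k < A.+1) load (k * Np + p) (o k (+) true)
      = \sum_(k < A.+1) (if o k then load (k * Np + p) false else load (k * Np + p) true).
    by apply: eq_bigr => k _; case: (o k).
  have Ef : \sum_(k < A.+1) load (k * Np + p) (o k (+) false)
      = \sum_(k < A.+1) (if o k then load (k * Np + p) true else load (k * Np + p) false).
    by apply: eq_bigr => k _; case: (o k).
  by exists o => -[]; rewrite Et Ef.
exists (fun t => o (pr t) (rd t)) => p b; have := oP p b.
have prE k : pr (k * Np + p) = p.
  by apply: val_inj; rewrite /= inordK ?ltn_mod // modnMDl modn_small.
have rdE k : rd (k * Np + p) = k by rewrite /rd divnMDl // divn_small // addn0.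
by congr (_ <= _ + _); apply: eq_bigr => k _; rewrite prE rdE.
Qed.

Section Oriented.
Variable o : nat -> bool.
Hypothesis o_bal : forall (p : 'I_Np) (b : bool),
  \sum_(k < A.+1) load (k * Np + p) (o (k * Np + p) (+) b)
    <= \sum_(k < A.+1) load (k * Np + p) (o (k * Np + p) (+) ~~ b) + ell.

Definition side x := (pr (sb x), o (sb x) (+) chi x).

Definition swappers := [set x | (A1 <= rd (sb x) < A1 + 2 * A2) &&
  (x \in chosen (sb x) (o (sb x) (+) (A1 + A2 <= rd (sb x))))].

Definition target t := (cl (pr t, o t), cl (pr t, ~~ o t)).

Lemma target_r t : r (target t).1 (target t).2. Proof. exact: cl_r. Qed.

Lemma arc_step_refl a : r a.1 a.2 -> arc_step a a.
Proof. by move=> ra; rewrite /arc_step ra. Qed.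

Lemma transits : exists route : nat -> nat -> L * L, forall t, t <= n ->
  [/\ route t 0 = target t.-1, route t D0 = target t &
      forall k, k < D0 -> arc_step (route t k) (route t k.+1)].
Proof.
(* For [t = 0] the predecessor is [0] itself: the first superblock walks from its own arc to its own
   arc. *)
have /fin_all_exists[s sP] (t : 'I_n.+1) := arc_path (target_r t.-1) (target_r t).
exists (fun t => s (inord t)) => t tn; have := sP (inord t).
by rewrite inordK.
Qed.

Section Routed.
Variable route : nat -> nat -> L * L.
Hypothesis routeP : forall t, t <= n ->
  [/\ route t 0 = target t.-1, route t D0 = target t &
      forall k, k < D0 -> arc_step (route t k) (route t k.+1)].

Definition arc x := route (sb x) (minn (pos x %/ w) D0).
Definition phi x := if chi x then (arc x).2 else (arc x).1.

Lemma sb_le x : sb x <= n.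
Proof. by apply: leq_trans (leq_div _ _) _; exact: ltnW. Qed.

Lemma arc_settled x : ~~ transit x -> arc x = target (sb x).
Proof.
rewrite /transit -leqNgt -leq_divRL // /arc => /minn_idPr ->.
by case: (routeP (sb_le x)).
Qed.

Lemma route_r t j : t <= n -> j <= D0 -> r (route t j).1 (route t j).2.
Proof.
move=> tn; have [_ e st] := routeP tn.
rewrite leq_eqVlt => /orP[/eqP ->|/st]; first by rewrite e; exact: target_r.
by case/and4P.
Qed.

(** Labels at distance at most [w] lie in the same or in consecutive blocks. Across the border of
    two superblocks both arcs are the target of the earlier one: its last block is settled because
    [D0 < Lb], and the next route starts there. *)
Lemma arc_near (x y : 'I_n) : x <= y -> y <= x + w -> arc_step (arc x) (arc y).
Proof.
move=> xy yx; have Ex := posE x; have Ey := posE y.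
have px := pos_lt x; have py := pos_lt y.
have wl : w <= ell by rewrite leq_pmull // (leq_ltn_trans _ D0_Lb).
have le1 : sb x <= sb y by apply: leq_div2r.
have le2 : sb y <= (sb x).+1.
  rewrite leqNgt; apply/negP => lt; have := leq_mul lt (leqnn ell).
  rewrite !mulSn => h; lia.
have [e|ne] := eqVneq (sb y) (sb x).
  rewrite /arc e; have p1 : pos x <= pos y by rewrite e in Ey; lia.
  have p2 : pos y <= pos x + w by rewrite e in Ey; lia.
  have d1 := leq_div2r w p1; have := leq_div2r w p2; rewrite divnDr // divnn w_gt0 addn1 => d2.
  have [_ _ st] := routeP (sb_le x).
  move: (pos x %/ w) (pos y %/ w) d1 d2 => j j' d1 d2.
  have [lt|ge] := ltnP j D0; last first.
    rewrite (minn_idPr (leq_trans ge d1)).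
    by apply: arc_step_refl; apply: route_r => //; exact: sb_le.
  have [->|jj] := eqVneq j' j.
    rewrite (minn_idPl (ltnW lt)).
    by apply: arc_step_refl; apply: route_r; [exact: sb_le | exact: ltnW].
  have -> : j' = j.+1 by apply/eqP; rewrite eqn_leq d2 ltn_neqAle eq_sym jj d1.
  by rewrite (minn_idPl lt); exact: st.
have e : sb y = (sb x).+1 by apply/eqP; rewrite eqn_leq le2 ltn_neqAle eq_sym ne le1.
rewrite e mulSn in Ey.
have -> : arc y = target (sb x).
  rewrite /arc divn_small; last by lia.
  by rewrite min0n; case: (routeP (sb_le y)) => + _ _; rewrite e.
rewrite arc_settled; first by apply: arc_step_refl; exact: target_r.
rewrite /transit -leqNgt.
have : D0.+1 * w <= ell by rewrite leq_mul.
rewrite mulSn; lia.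
Qed.

Lemma arc_step_sym a b : arc_step a b -> arc_step b a.
Proof. by rewrite /arc_step => /and4P[-> -> e1 e2] /=; rewrite r_sym [X in _ && X]r_sym; rewrite r_sym in e1; rewrite ?e1 ?e2 // r_sym ?e1 ?e2. Qed.

Lemma phi_hom x y : H x y -> r (phi x) (phi y).
Proof.
move=> xy; have st : arc_step (arc x) (arc y).
  have w1 := width xy; have ne := chi_col xy; rewrite H_sym in xy; have w2 := width xy.
  by case: (leqP x y) => h; [|apply: arc_step_sym]; apply: arc_near => //; exact: ltnW.
case/and4P: st => _ _ s1 s2; have := chi_col xy; rewrite /phi.
by case: (chi x); case: (chi y) => // _; rewrite r_sym.
Qed.

Lemma phi_settled x : ~~ transit x -> phi x = cl (side x).
Proof.
by move=> nt; rewrite /phi arc_settled // /side /target; case: (chi x); rewrite ?addbT ?addbF.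
Qed.

Lemma deep_settled x : deep x -> ~~ transit x.
Proof. by case/andP => h _; rewrite /transit -leqNgt; lia. Qed.

Lemma deep_phi x z : deep x -> H x z -> phi z = cl (flip (side x)).
Proof.
move=> dx xz; have [e h _] := deep_nbh dx xz.
rewrite phi_settled; last by rewrite /transit -leqNgt; lia.
rewrite /side /flip /= e.
have -> : chi z = ~~ chi x by move: (chi_col xz); case: (chi x); case: (chi z).
by rewrite addbN.
Qed.

(** Buffers and swappers of a superblock all have this one colour, and their neighbours stay in the
    superblock; hence they form an independent set. *)
Definition bs_colour t := if rd t < A1 then false else o t (+) (A1 + A2 <= rd t).

Lemma bs_chosen x : x \in buffers :|: swappers ->
  x \in chosen (sb x) (bs_colour (sb x)) /\ rd (sb x) < A1 + 2 * A2.
Proof.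
rewrite !inE /bs_colour => /orP[/andP[h xc]|/andP[/andP[h1 h2] xc]].
  by rewrite h; split=> //; apply: leq_trans h (leq_addr _ _).
by rewrite ltnNge h1 /= xc.
Qed.

Lemma bs_deep x : x \in buffers :|: swappers -> deep x.
Proof. by case/bs_chosen => /chosen_deep[]. Qed.

Lemma bs_disjoint : [disjoint buffers & swappers].
Proof.
rewrite -setI_eq0; apply/eqP/setP => x; rewrite !inE; apply/negP.
by case/andP => /andP[h _] /andP[/andP[h2 _] _]; rewrite ltnNge h2 in h.
Qed.

Lemma bs_colourE x : x \in buffers :|: swappers -> chi x = bs_colour (sb x).
Proof. by case/bs_chosen => /chosen_deep[]. Qed.

Lemma bs_ind x y : x \in buffers :|: swappers -> y \in buffers :|: swappers -> ~~ H x y.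
Proof.
move=> xb yb; apply/negP => xy; have := chi_col xy.
have [e _ _] := deep_nbh (bs_deep xb) xy.
by rewrite (bs_colourE xb) (bs_colourE yb) e eqxx.
Qed.

Lemma sw_bs x : x \in swappers -> x \in buffers :|: swappers.
Proof. by move=> xs; rewrite inE xs orbT. Qed.

Lemma sw_disj u u' z : u \in swappers -> u' \in swappers -> H u z -> H u' z -> u = u'.
Proof.
move=> us us' uz uz'; have [e1 _ _] := deep_nbh (bs_deep (sw_bs us)) uz.
have [e2 _ _] := deep_nbh (bs_deep (sw_bs us')) uz'.
have [c1 _] := bs_chosen (sw_bs us); have [c2 _] := bs_chosen (sw_bs us').
by apply: chosen_disj c1 _ uz uz'; rewrite -e1 e2.
Qed.

(* The greedy phase runs through a superblock in the order: swappers, their neighbours, the rest.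
   Hence a neighbour of a swapper sees, when it is embedded, no image but that of
   its swapper. *)
Definition key x := 3 * sb x +
  (if x \in swappers then 0 else if [exists u in swappers, H u x] then 1 else 2).

Lemma key_sb x y : sb x < sb y -> key x < key y.
Proof. by rewrite /key; case: ifP => _; [|case: ifP => _]; lia. Qed.

Lemma sw_key u z : u \in swappers -> H u z -> key u < key z.
Proof.
move=> us uz; have [e _ _] := deep_nbh (bs_deep (sw_bs us)) uz.
rewrite /key us e; case: ifPn => [zs|_].
  by have := bs_ind (sw_bs us) (sw_bs zs); rewrite uz.
by case: ifP => _; rewrite addn0 -addn1 leq_add2l.
Qed.

(** A neighbour [z'] of [z] that comes no later is a swapper or a neighbour of one. A swapper must
    be [u], as neighbourhoods of swappers are disjoint. A neighbour of a swapper [v] is impossible: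
    [v] has the colour of [u], which is also that of [z']. *)
Lemma sw_alone u z z' : u \in swappers -> H u z -> H z z' -> key z' <= key z -> z' = u.
Proof.
move=> us uz zz; have [e _ _] := deep_nbh (bs_deep (sw_bs us)) uz.
have e' := sb_nbh2 (bs_deep (sw_bs us)) uz zz.
rewrite /key e e' leq_add2l; case: (boolP (z' \in swappers)) => [zs' _|_].
  by apply: sw_disj zs' us _ uz; rewrite H_sym.
case: (boolP (z \in swappers)) => [zs|_].
  by have := bs_ind (sw_bs us) (sw_bs zs); rewrite uz.
have -> : [exists u in swappers, H u z] by apply/exists_inP; exists u.
case: exists_inP => // -[v vs vz'] _; exfalso.
have [f _ _] := deep_nbh (bs_deep (sw_bs vs)) vz'.
have := bs_colourE (sw_bs us); have := bs_colourE (sw_bs vs).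
rewrite -f e' => <-; move: (chi_col uz) (chi_col zz) (chi_col vz').
by case: (chi u); case: (chi z); case: (chi z'); case: (chi v).
Qed.

Lemma pair_card (p : 'I_Np) a :
  #|[set x | (pr (sb x) == p) && (rd (sb x) < a)]| <= a * ell.
Proof.
apply: (card_le_code (g := fun x => rd (sb x) * ell + pos x)) => [x|x y].
  rewrite inE => /andP[_ h]; have := leq_mul h (leqnn ell); rewrite mulSn.
  by apply: leq_trans; rewrite addnC ltn_add2r pos_lt.
rewrite !inE => /andP[/eqP px _] /andP[/eqP py _] E.
have e1 : rd (sb x) = rd (sb y).
  have := congr1 (fun m => m %/ ell) E.
  by rewrite !divnMDl ?ell_gt0 // !(divn_small (pos_lt _)) !addn0.
have e2 : pos x = pos y by move: E; rewrite e1 => /addnI.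
by apply: sb_pos_inj e2; apply: pr_rd_inj e1; rewrite px.
Qed.

Lemma side_early_card z a : #|[set x | (side x == z) && (rd (sb x) < a)]| <= a * ell.
Proof.
apply: leq_trans (pair_card z.1 a); apply/subset_leq_card/subsetP => x.
by rewrite !inE => /andP[/eqP <- ->]; rewrite eqxx.
Qed.

Lemma transit_card : #|[set x | transit x]| <= A * Np * (D0 * w).
Proof.
have lte : D0 * w <= ell by rewrite leq_mul2r ltnW ?orbT.
apply: (card_le_code (g := fun x => sb x * (D0 * w) + pos x)) => [x|x y].
  rewrite inE => h; have := leq_mul (sb_lt x) (leqnn (D0 * w)); rewrite mulSn.
  by apply: leq_trans; rewrite addnC ltn_add2r.
rewrite !inE => tx ty E.
have g0 : 0 < D0 * w by apply: leq_ltn_trans tx.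
have e1 : sb x = sb y.
  have := congr1 (fun m => m %/ (D0 * w)) E.
  by rewrite !divnMDl // (divn_small tx) (divn_small ty) !addn0.
by apply: (sb_pos_inj e1); move: E; rewrite e1 => /addnI.
Qed.

Lemma round_full k (p : 'I_Np) : k < A1 + 2 * A2 -> (k * Np + p).+1 * ell <= n.
Proof.
move=> h; apply: leq_trans n_ge; rewrite leq_mul2r; apply/orP; right.
by apply: leq_trans (leq_mul h (leqnn Np)); rewrite mulSn addnC -addSn leq_add2r.
Qed.

Lemma pr_round k (p : 'I_Np) : pr (k * Np + p) = p.
Proof. by apply: val_inj; rewrite /= inordK ?ltn_mod // modnMDl modn_small. Qed.

Lemma rd_round k (p : 'I_Np) : rd (k * Np + p) = k.
Proof. by rewrite /rd divnMDl // divn_small // addn0. Qed.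

Lemma buffers_pair (p : 'I_Np) : A1 * q <= #|[set x in buffers | pr (sb x) == p]|.
Proof.
apply: (card_ge_fibers (g := fun x => rd (sb x))) => k kA.
have kf : k < A1 + 2 * A2 by apply: leq_trans kA (leq_addr _ _).
apply: leq_trans (chosen_card false (round_full p kf)) _.
apply/subset_leq_card/subsetP => x xc; have [e _ _] := chosen_deep xc.
by rewrite !inE e pr_round rd_round kA xc !eqxx.
Qed.

Lemma swappers_side z : A2 * q <= #|[set u in swappers | side u == z]|.
Proof.
case: z => p b; apply: leq_trans (_ : #|[set u in swappers |
   (side u == (p, b)) && (A1 + b * A2 <= rd (sb u))]| <= _); last first.
  by apply/subset_leq_card/subsetP => u; rewrite !inE => /and3P[-> ->].
apply: (card_ge_fibers (g := fun x => rd (sb x) - (A1 + b * A2))) => k kA.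
set t := (A1 + b * A2 + k) * Np + p.
have kf : A1 + b * A2 + k < A1 + 2 * A2 by case: (b); lia.
apply: leq_trans (chosen_card (o t (+) b) (round_full p kf)) _.
apply/subset_leq_card/subsetP => x xc; have [e _ col] := chosen_deep xc.
have E : (A1 + A2 <= A1 + b * A2 + k) = b by case: (b); lia.
rewrite !inE /side e pr_round rd_round E col xc addKb !eqxx /= addKn eqxx leq_addr !andbT.
by rewrite kf -addnA leq_addr.
Qed.

Definition settled z := [set x | [&& x \notin buffers, ~~ transit x & side x == z]].

Lemma settledE p b :
  #|settled (p, b)| = \sum_(k < A.+1) load (k * Np + p) (o (k * Np + p) (+) b).
Proof.
rewrite -sum1_card (partition_big (fun x => inord (rd (sb x)) : 'I_A.+1) predT) //=.
apply: eq_bigr => k _; rewrite sum1dep_card /load; apply: eq_card => x.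
rewrite !in_set -!andbA; congr (_ && _); case: (transit x) => //=.
have rA : rd (sb x) < A.+1 by rewrite ltnS ltnW // rd_lt sb_lt.
apply/and3P/andP.
  case=> /eqP pp /eqP cb /eqP kk.
  have st : sb x = k * Np + p.
    by apply: pr_rd_inj; rewrite ?pr_round ?rd_round // -kk inordK.
  by rewrite st eqxx -cb -st addKb.
case=> /eqP -> /eqP ->; rewrite pr_round rd_round addKb !eqxx; split=> //.
by apply/eqP/val_inj; rewrite /= inordK.
Qed.

(** The two sides of a pair share its non-buffer vertices and differ by at most [ell]. The saving
    [A1 * q], made by postponing the buffers, is what leaves free space in every unit. *)
Lemma settled_card z : 2 * #|settled z| <= A * ell + ell - A1 * q.
Proof.
case: z => p b.
have bal : #|settled (p, b)| <= #|settled (p, ~~ b)| + ell by rewrite !settledE o_bal.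
have c1 := buffers_pair p; have c2 := pair_card p A.
have tot : #|settled (p, b)| + #|settled (p, ~~ b)| + #|[set x in buffers | pr (sb x) == p]|
    <= #|[set x | (pr (sb x) == p) && (rd (sb x) < A)]|.
  have h1 : [disjoint settled (p, b) & settled (p, ~~ b)].
    rewrite -setI_eq0; apply/eqP/setP => x; rewrite !inE; apply/negP.
    case/andP => /and3P[_ _ /eqP ->] /and3P[_ _]; rewrite xpair_eqE; by case: (b); rewrite andbF.
  have h2 : [disjoint settled (p, b) :|: settled (p, ~~ b) & [set x in buffers | pr (sb x) == p]].
    rewrite -setI_eq0; apply/eqP/setP => x; rewrite inE [x \in set0]inE; apply/negP.
    by rewrite in_setU !in_set => /andP[/orP[] /and3P[h _ _] /andP[xb _]]; rewrite xb in h.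
  have := leq_card_setU (settled (p, b)) (settled (p, ~~ b)); rewrite h1 => -[_ /eqP <-].
  have := leq_card_setU (settled (p, b) :|: settled (p, ~~ b)) [set x in buffers | pr (sb x) == p].
  rewrite h2 => -[_ /eqP <-]; apply/subset_leq_card/subsetP => x xx.
  rewrite inE rd_lt sb_lt andbT; move: xx; rewrite !in_setU !in_set => /orP[/orP[]|].
  - by case/and3P => _ _ /eqP [->].
  - by case/and3P => _ _ /eqP [->].
  - by case/andP.
lia.
Qed.

Lemma phi_load l :
  2 * #|[set x | (x \notin buffers) && (phi x == l)]|
    <= 2 * (A * Np * (D0 * w)) + #|[set z | cl z == l]| * (A * ell + ell - A1 * q).
Proof.
have sub : [set x | (x \notin buffers) && (phi x == l)] \subset
    [set x | transit x] :|: \bigcup_(z in [set z | cl z == l]) settled z.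
  apply/subsetP => x; rewrite in_set => /andP[xb xl]; rewrite in_setU in_set.
  case: (boolP (transit x)) => //= nt; apply/bigcupP; exists (side x).
    by rewrite inE -phi_settled.
  by rewrite in_set xb nt eqxx.
have h1 := leq_trans (subset_leq_card sub) (leq_card_setU _ _).1.
have h2 := transit_card.
have h3 : 2 * #|\bigcup_(z in [set z | cl z == l]) settled z|
   <= #|[set z | cl z == l]| * (A * ell + ell - A1 * q).
  apply: (@leq_trans (2 * \sum_(z in [set z | cl z == l]) #|settled z|)).
    rewrite leq_mul2l; elim/big_rec2: _ => [|i k B _ le]; first by rewrite cards0.
    by apply: leq_trans (leq_card_setU _ _).1 _; rewrite leq_add2l.
  by rewrite big_distrr -sum_nat_const; apply: leq_sum => z _; exact: settled_card.
apply: leq_trans (leq_mul (leqnn 2) h1) _; rewrite mulnDr leq_add //.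
by rewrite leq_mul2l.
Qed.

Lemma phi_early l :
  #|[set x | [&& x \notin buffers, sb x < (A1 + 2 * A2) * Np & phi x == l]]|
    <= A * Np * (D0 * w) + #|[set z | cl z == l]| * ((A1 + 2 * A2) * ell).
Proof.
have sub : [set x | [&& x \notin buffers, sb x < (A1 + 2 * A2) * Np & phi x == l]] \subset
    [set x | transit x] :|: \bigcup_(z in [set z | cl z == l])
      [set x | (side x == z) && (rd (sb x) < A1 + 2 * A2)].
  apply/subsetP => x; rewrite in_set => /and3P[xb xs xl]; rewrite in_setU in_set.
  case: (boolP (transit x)) => //= nt; apply/bigcupP; exists (side x).
    by rewrite inE -phi_settled.
  by rewrite in_set eqxx rd_lt.
apply: leq_trans (subset_leq_card sub) _; apply: leq_trans (leq_card_setU _ _).1 _.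
by rewrite leq_add ?transit_card // card_bigcup_le // => z _; exact: side_early_card.
Qed.

Lemma buffers_side z : #|[set b in buffers | side b == z]| <= A1 * ell.
Proof.
apply: leq_trans (side_early_card z A1); apply/subset_leq_card/subsetP => x.
by rewrite !in_set => /andP[/andP[-> _] ->].
Qed.

End Routed.
End Oriented.

Lemma buffers_card : #|buffers| <= A1 * Np * ell.
Proof.
apply: (card_le_code (g := @nat_of_ord n)) => [x|x y _ _]; last exact: val_inj.
by rewrite inE rd_lt => /andP[h _]; rewrite -ltn_divLR ?ell_gt0.
Qed.

Lemma sb_near x y : H x y -> sb y <= (sb x).+1.
Proof.
rewrite H_sym => /width yx; rewrite /sb -[leqRHS]addn1.
have -> : x %/ ell + 1 = (x + ell) %/ ell by rewrite divnDr // divnn ell_gt0.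
apply: leq_div2r; apply: leq_trans yx _; rewrite leq_add2l.
by rewrite leq_pmull // (leq_ltn_trans _ D0_Lb).
Qed.

(** The interface to the embedding, with routes and orientation hidden. [pl_active] ensures that
    every cluster in use has a neighbour in the reduced graph, so that bounds stated for edges of
    [r] apply to it. *)
Record embedding_plan (phi : 'I_n -> L) (side : 'I_n -> 'I_Np * bool)
    (Bf Sw : {set 'I_n}) (key : 'I_n -> nat) : Prop := EmbeddingPlan {
  pl_hom : forall x y, H x y -> r (phi x) (phi y);
  pl_active : forall x, exists l, r (phi x) l;
  pl_near : forall x y, H x y -> sb y <= (sb x).+1;
  pl_size : forall t, #|[set x | sb x == t]| <= ell;
  pl_load : forall l, 2 * #|[set x | (x \notin Bf) && (phi x == l)]|
    <= 2 * (A * Np * (D0 * w)) + #|[set z | cl z == l]| * (A * ell + ell - A1 * q);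
  pl_early : forall l, #|[set x | [&& x \notin Bf, sb x < (A1 + 2 * A2) * Np & phi x == l]]|
    <= A * Np * (D0 * w) + #|[set z | cl z == l]| * ((A1 + 2 * A2) * ell);
  pl_phi : forall x, x \in Bf :|: Sw -> phi x = cl (side x);
  pl_nphi : forall x z, x \in Bf :|: Sw -> H x z -> phi z = cl (flip (side x));
  pl_nsb : forall x z, x \in Bf :|: Sw -> H x z -> sb z = sb x;
  pl_bf_sb : forall x, x \in Bf -> sb x < A1 * Np;
  pl_sw_sb : forall x, x \in Sw -> A1 * Np <= sb x < (A1 + 2 * A2) * Np;
  pl_disj : [disjoint Bf & Sw];
  pl_ind : forall x y, x \in Bf :|: Sw -> y \in Bf :|: Sw -> ~~ H x y;
  pl_sw_disj : forall u u' z, u \in Sw -> u' \in Sw -> H u z -> H u' z -> u = u';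
  pl_key_sb : forall x y, sb x < sb y -> key x < key y;
  pl_sw_key : forall u z, u \in Sw -> H u z -> key u < key z;
  pl_sw_alone : forall u z z', u \in Sw -> H u z -> H z z' -> key z' <= key z -> z' = u;
  pl_sw_side : forall z, A2 * q <= #|[set u in Sw | side u == z]|;
  pl_bf_side : forall z, #|[set b in Bf | side b == z]| <= A1 * ell;
  pl_bf_card : #|Bf| <= A1 * Np * ell }.

Theorem embedding_plan_exists : exists phi side Bf Sw key, embedding_plan phi side Bf Sw key.
Proof.
have [o o_bal] := orientation; have [route routeP] := transits o.
exists (phi route), (side o), buffers, (swappers o), (key o); split.
- exact: (phi_hom routeP).
- move=> x; have rx : r (arc route x).1 (arc route x).2.
    by apply: (route_r routeP); [exact: sb_le | exact: geq_minr].
  by rewrite /phi; case: (chi x); [exists (arc route x).1; rewrite r_sym | exists (arc route x).2].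
- exact: sb_near.
- exact: sb_size.
- exact: (phi_load o_bal routeP).
- exact: (phi_early routeP).
- by move=> x /bs_deep/deep_settled; exact: (phi_settled routeP).
- by move=> x z /bs_deep; exact: (deep_phi routeP).
- by move=> x z /bs_deep dx /(deep_nbh dx)[].
- by move=> x; rewrite inE -rd_lt => /andP[].
- move=> x; rewrite inE => /andP[/andP[h1 h2] _].
  by rewrite -rd_lt h2 andbT leqNgt -rd_lt -leqNgt.
- exact: bs_disjoint.
- exact: bs_ind.
- exact: sw_disj.
- exact: key_sb.
- exact: sw_key.
- exact: sw_alone.
- exact: swappers_side.
- exact: buffers_side.
- exact: buffers_card.
Qed.

End Plan.

(** * Arcs, matchings and units of the reduced graph *)

Section ArcPaths.
Variables (T L : finType) (c : T -> L) (r irr : rel L) (D0 : nat).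
Let wd i := #|[set y | r i (c y)]|.
Hypotheses (r_sym : symmetric r)
  (ore : forall i j i' j', r i i' -> r j j' -> ~~ r i j -> ~~ irr i j -> #|T| < wd i + wd j)
  (irr_few : forall i i' j j', r i i' -> r j j' -> #|[set y | irr i (c y)]| < wd j)
  (len : #|{: L * L}| <= D0).

Section Reach.
Variables a b : L * L.
Hypotheses (ra : r a.1 a.2) (rb : r b.1 b.2).

Let reach x := connect (@arc_step L r) a x.
Let E := [set i | [exists j, reach (i, j)]].
Let O := [set j | [exists i, reach (i, j)]].

Lemma reach_r x : reach x -> r x.1 x.2.
Proof.
case/connectP => p + ->; elim/last_ind: p => [|p y _] //=.
by rewrite rcons_path last_rcons => /andP[_ /and4P[]].
Qed.

Lemma reach_first i k : i \in E -> r i k -> reach (i, k).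
Proof.
rewrite inE => /existsP[j rij] rik; apply: (connect_trans rij); apply: connect1.
by have /= := reach_r rij; rewrite /arc_step /= rik => ->.
Qed.

Lemma reach_second j k : j \in O -> r k j -> reach (k, j).
Proof.
rewrite inE => /existsP[i rij] rkj; apply: (connect_trans rij); apply: connect1.
by have /= := reach_r rij; rewrite /arc_step /= rkj => ->.
Qed.

(* If [b] were not reached, then neither of its ends would be: summing two instances of Ore's
   condition, [b.1] against a reached second end and [b.2] against a reached first end, gives
   a degree sum above [2 * #|T|], while the neighbourhoods fit into [WE], [WO] and complements. *)
Lemma reach_all : reach b.
Proof.
have [bE|bE] := boolP (b.1 \in E); first by rewrite (surjective_pairing b) reach_first.
have bO : b.2 \notin O.
  apply: contra bE => bO; rewrite inE; apply/existsP; exists b.2; exact: reach_second.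
have aE : a.1 \in E.
  by rewrite inE; apply/existsP; exists a.2; rewrite -surjective_pairing /reach connect0.
have aO : a.2 \in O.
  by rewrite inE; apply/existsP; exists a.1; rewrite -surjective_pairing /reach connect0.
pose WE := [set y | c y \in E]; pose WO := [set y | c y \in O].
have EO i j : i \in E -> r i j -> j \in O.
  by move=> iE /(reach_first iE) rij; rewrite inE; apply/existsP; exists i.
have OE i j : j \in O -> r i j -> i \in E.
  by move=> jO /(reach_second jO) rij; rewrite inE; apply/existsP; exists j.
have sub1 i : i \in E -> wd i <= #|WO|.
  by move=> iE; apply/subset_leq_card/subsetP => y; rewrite in_set => ry; rewrite in_set; exact: EO ry.
have sub2 j : j \in O -> wd j <= #|WE|.
  by move=> jO; apply/subset_leq_card/subsetP => y; rewrite in_set r_sym => ry; rewrite in_set; exact: OE ry.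
have d1 : wd b.1 <= #|~: WO|.
  apply/subset_leq_card/subsetP => y; rewrite in_set => rby; rewrite in_setC in_set.
  by apply: contra bE => yO; exact: OE rby.
have d2 : wd b.2 <= #|~: WE|.
  apply/subset_leq_card/subsetP => y; rewrite in_set r_sym => ryb; rewrite in_setC in_set.
  by apply: contra bO => yE; exact: EO ryb.
have [j jO nj] : exists2 j, j \in O & ~~ irr b.1 j.
  case: (boolP (WO \subset [set y | irr b.1 (c y)])) => [/subset_leq_card h|/subsetPn[y]].
    have := leq_ltn_trans h (irr_few rb ra); by rewrite ltnNge sub1.
  by move=> yO ny; exists (c y); [rewrite in_set in yO | rewrite in_set in ny].
have rb' : r b.2 b.1 by rewrite r_sym.
have ra' : r a.2 a.1 by rewrite r_sym.
have [i iE ni] : exists2 i, i \in E & ~~ irr b.2 i.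
  case: (boolP (WE \subset [set y | irr b.2 (c y)])) => [/subset_leq_card h|/subsetPn[y]].
    have := leq_ltn_trans h (irr_few rb' ra'); by rewrite ltnNge sub2.
  by move=> yE ny; exists (c y); [rewrite in_set in yE | rewrite in_set in ny].
have [i' ri] : exists i', r i i'.
  by move: iE; rewrite inE => /existsP[k /reach_r]; exists k.
have [j' rj] : exists j', r j j'.
  by move: jO; rewrite inE => /existsP[k /reach_r]; exists k; rewrite r_sym.
have o1 : #|T| < wd b.1 + wd j.
  by apply: ore rb rj _ nj; apply: contra bE; exact: OE.
have o2 : #|T| < wd b.2 + wd i.
  by apply: ore rb' ri _ ni; rewrite r_sym; apply: contra bO; exact: EO.
have := sub2 j jO; have := sub1 i iE; have := cardsC WE; have := cardsC WO.
by move: d1 d2 o1 o2; clear; lia.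
Qed.

(** A path without repetition has fewer than [D0] steps, since there are at most [D0] pairs; it is
    padded at its end, as an arc steps to itself. *)
Lemma arc_path : exists s : nat -> L * L,
  [/\ s 0 = a, s D0 = b & forall k, k < D0 -> arc_step r (s k) (s k.+1)].
Proof.
have /connectP[p0 p0P bE] := reach_all; move: bE.
case: (shortenP p0P) => p pP up _ bE.
have sz : size p < D0.
  apply: leq_trans len; have := max_card (mem (a :: p)).
  by rewrite (card_uniqP up).
have nthb m : size p <= m -> nth b (a :: p) m = b.
  rewrite leq_eqVlt => /orP[/eqP <-|lt]; last by rewrite nth_default.
  by rewrite -[size p]/(size (a :: p)).-1 nth_last.
exists (nth b (a :: p)); split=> //; first by apply: nthb; exact: ltnW.
move=> k kD; have [lt|ge] := ltnP k (size p).
  by have /(pathP b) := pP; apply.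
by rewrite !nthb // ?(leqW ge) // /arc_step rb.
Qed.

End Reach.
End ArcPaths.

(** * Almost perfect matchings under Ore's condition *)

Section Matching.
Variables (U : finType) (rr ir : rel U) (iota : nat).
Let deg x := #|[set y | rr x y]|.
Hypotheses (rr_sym : symmetric rr)
  (ore : forall x y, ~~ rr x y -> ~~ ir x y -> #|U| < deg x + deg y)
  (ir_few : forall x, #|[set y | ir x y]| <= iota).

(** A matching is encoded as an involution, whose fixed points are the uncovered vertices. *)
Definition is_matching (M : {ffun U -> U}) :=
  [forall x, (M (M x) == x) && ((M x == x) || rr x (M x))].

Lemma matchingP (M : {ffun U -> U}) :
  reflect (forall x, M (M x) = x /\ (M x <> x -> rr x (M x))) (is_matching M).
Proof.
apply: (iffP forallP) => h x; have := h x.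
  by case/andP => /eqP e k; split=> // ne; case/orP: k => // /eqP.
by case=> -> k; rewrite eqxx /=; case: eqP => // /k.
Qed.

Definition covered (M : {ffun U -> U}) := [set x | M x != x].

Lemma match_fixed (M : {ffun U -> U}) x y : is_matching M -> x != y -> M x = x -> M y = y -> rr x y ->
  exists2 M', is_matching M' & #|covered M| < #|covered M'|.
Proof.
move=> /matchingP mM xy fx fy rxy.
pose M' := [ffun t => if t == x then y else if t == y then x else M t].
have yx : y == x = false by rewrite eq_sym; apply: negPf.
exists M'.
  apply/matchingP => t; rewrite !ffunE.
  have [->|tx] := eqVneq t x; first by rewrite yx eqxx.
  have [->|ty] := eqVneq t y; first by rewrite eqxx rr_sym.
  have [mt et] := mM t.
  case: (eqVneq (M t) x) => [h|_]; first by rewrite -mt h fx eqxx in tx.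
  case: (eqVneq (M t) y) => [h|_]; first by rewrite -mt h fy eqxx in ty.
  by rewrite mt.
apply: proper_card; rewrite properE; apply/andP; split.
  apply/subsetP => t; rewrite !inE ffunE => mt.
  have [tx|_] := eqVneq t x; first by rewrite tx fx eqxx in mt.
  by have [ty|//] := eqVneq t y; rewrite ty fy eqxx in mt.
by apply/subsetPn; exists x; rewrite !inE ?ffunE ?eqxx ?fx ?eqxx // yx.
Qed.

(** Augmentation along the path [x], [z], [M z], [y]. *)
Lemma match_augment (M : {ffun U -> U}) x y z : is_matching M -> x != y -> M x = x -> M y = y ->
  M z != z -> rr x z -> rr y (M z) ->
  exists2 M', is_matching M' & #|covered M| < #|covered M'|.
Proof.
move=> /matchingP mM xy fx fy mz rxz ryz; set z' := M z in mz ryz.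
have fz' : M z' = z by case: (mM z).
have zx : z == x = false by apply/eqP => h; rewrite /z' h fx eqxx in mz.
have zy : z == y = false by apply/eqP => h; rewrite /z' h fy eqxx in mz.
have z'x : z' == x = false by apply/eqP => h; rewrite -fz' h fx eqxx in zx.
have z'y : z' == y = false by apply/eqP => h; rewrite -fz' h fy eqxx in zy.
have yx : y == x = false by rewrite eq_sym; apply: negPf.
have yz : y == z = false by rewrite eq_sym.
have yz' : y == z' = false by rewrite eq_sym.
pose M' := [ffun t => if t == x then z else if t == z then x else
  if t == y then z' else if t == z' then y else M t].
exists M'.
  apply/matchingP => t; rewrite !ffunE.
  have [->|tx] := eqVneq t x; first by rewrite zx eqxx.
  have [->|tz] := eqVneq t z; first by rewrite eqxx rr_sym.
  have [->|ty] := eqVneq t y; first by rewrite z'x (negPf mz) z'y eqxx.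
  have [->|tz'] := eqVneq t z'; first by rewrite yx yz eqxx rr_sym.
  have [mt et] := mM t.
  case: (eqVneq (M t) x) => [h|_]; first by rewrite -mt h fx eqxx in tx.
  case: (eqVneq (M t) z) => [h|_]; first by rewrite -mt h -/z' eqxx in tz'.
  case: (eqVneq (M t) y) => [h|_]; first by rewrite -mt h fy eqxx in ty.
  case: (eqVneq (M t) z') => [h|_]; first by rewrite -mt h fz' eqxx in tz.
  by rewrite mt.
apply: proper_card; rewrite properE; apply/andP; split.
  apply/subsetP => t; rewrite !inE ffunE => mt.
  have [tx|_] := eqVneq t x; first by rewrite tx fx eqxx in mt.
  have [->|_] := eqVneq t z; first by rewrite eq_sym zx.
  have [->|_] := eqVneq t y; first by rewrite z'y.
  by have [->|//] := eqVneq t z'; rewrite yz'.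
by apply/subsetPn; exists x; rewrite !inE ?ffunE ?eqxx ?fx ?eqxx // zx.
Qed.

(** With more uncovered vertices, two of them, [x] and [y], form a pair outside [ir]. In a maximum
    matching they are non-adjacent, and the neighbours of [x] are disjoint from the partners of the
    neighbours of [y], while both sets miss [x] and [y]; this contradicts Ore's condition. Loops are
    possible, because a cluster may be adjacent to itself, so [X] and [Y] leave out [x] and [y]. *)
Theorem large_matching : exists M : {ffun U -> U}, is_matching M /\ #|~: covered M| <= iota.+1.
Proof.
have id_ok : is_matching [ffun x => x] by apply/matchingP => x; rewrite !ffunE.
case: (@arg_maxnP _ [ffun x => x] is_matching (fun M => #|covered M|) id_ok) => M mM Mmax.
have noaug : ~ (exists2 M', is_matching M' & #|covered M| < #|covered M'|).
  by case=> M' /Mmax h1 h2; have := leq_trans h2 h1; rewrite ltnn.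
exists M; split=> //; rewrite leqNgt; apply/negP => many.
have [x xF] : exists x, x \in ~: covered M by apply/card_gt0P; apply: leq_trans many.
have fx : M x = x by move: xF; rewrite !inE negbK => /eqP.
have [y [fy xy nxy]] : exists y, [/\ M y = y, x != y & ~~ ir x y].
  case: (boolP ((~: covered M) :\ x \subset [set y | ir x y])) => [/subset_leq_card h|/subsetPn[y]].
    have := leq_trans h (ir_few x); move: many; rewrite (cardsD1 x) xF; clear; lia.
  rewrite !inE negbK => /andP[yx /eqP fy] nxy.
  by exists y; split=> //; rewrite eq_sym.
apply: noaug; have [rxy|nr] := boolP (rr x y); first exact: match_fixed mM xy fx fy rxy.
case: (pickP (fun z => [&& z != x, rr x z & M z == z])) => [z /and3P[zx rxz /eqP fz]|nx].
  by apply: match_fixed mM _ fx fz rxz; rewrite eq_sym.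
case: (pickP (fun z => [&& z != y, rr y z & M z == z])) => [z /and3P[zy ryz /eqP fz]|ny].
  by apply: match_fixed mM _ fy fz ryz; rewrite eq_sym.
have /matchingP mM' := mM.
have Minj : injective M by apply: can_inj (M) _ => t; case: (mM' t).
case: (pickP (fun z => [&& M z != z, rr x z & rr y (M z)])) => [z /and3P[mz rxz ryz]|none].
  exact: match_augment mM xy fx fy mz rxz ryz.
exfalso; pose X := [set z | rr x z] :\ x; pose Y := [set z | rr y z] :\ y.
have cX : deg x <= #|X|.+1 by rewrite /deg (cardsD1 x) -add1n leq_add2r; case: (_ \in _).
have cY : deg y <= #|Y|.+1 by rewrite /deg (cardsD1 y) -add1n leq_add2r; case: (_ \in _).
have dXY : [disjoint X & M @: Y].
  rewrite -setI_eq0; apply/eqP/setP => z; rewrite !inE; apply/negP => /andP[/andP[zx rxz]].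
  case/imsetP => t; rewrite !inE => /andP[ty ryt] zE.
  have mzt : M z = t by rewrite zE; case: (mM' t).
  have := none z; rewrite rxz mzt ryt !andbT => /negbFE/eqP tz.
  by have := nx z; rewrite zx rxz mzt tz eqxx.
have sub : X :|: M @: Y \subset ~: [set x; y].
  apply/subsetP => z; rewrite in_setU in_setC in_set2 negb_or => /orP[].
    rewrite !inE => /andP[zx rxz]; rewrite zx; apply: contraNneq nr => <-; exact: rxz.
  case/imsetP => t; rewrite !inE => /andP[ty ryt] ->; apply/andP; split.
    apply: contraNneq nr => mt; rewrite rr_sym -fx -mt; by case: (mM' t) => ->.
  by apply: contraNneq ty => mt; apply/eqP/Minj; rewrite mt fy.
have := subset_leq_card sub; rewrite cardsU (disjoint_setI0 dXY) cards0 subn0 card_imset //.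
have := cardsC [set x; y]; rewrite cards2 xy /=; have := ore nr nxy.
move=> o u le; move: o; rewrite ltnNge => /negP; apply; apply: leq_trans (leq_add cX cY) _.
by rewrite -u addSn addnS add2n !ltnS.
Qed.

End Matching.

(** * Equal units inside the clusters *)

Section Units.
Variables (T L : finType) (c : T -> L) (r irr : rel L) (good : pred L) (s I : nat).
Let wd i := #|[set y | r i (c y)]|.
Hypotheses (r_sym : symmetric r) (r_good : forall i j, r i j -> good j) (s_gt0 : 0 < s)
  (ore : forall i j, good i -> good j -> ~~ r i j -> ~~ irr i j ->
     #|T| + 2 * (#|L| * s) < wd i + wd j)
  (irr_few : forall i, good i -> #|[set y | irr i (c y)]| <= I).

Let N i := if good i then #|[set x | c x == i]| %/ s else 0.
Let U := {i : L & 'I_(N i)}.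
Let cl0 (x : U) : L := tag x.

Lemma card_cl0 (p : pred L) : #|[set x | p (cl0 x)]| = \sum_(i | p i) N i.
Proof.
rewrite -sum1_card (partition_big cl0 p) /=; last by move=> x; rewrite inE.
apply: eq_bigr => i pi; rewrite sum1dep_card -[RHS]card_ord.
rewrite -(card_imset (mem 'I_(N i)) (f := fun k => Tagged (fun i => 'I_(N i)) k : U)); last first.
  by move=> k k' /eqP; rewrite -tag_eqE /tag_eq /= eqxx tagged_asE => /eqP.
apply: eq_card => -[j k]; rewrite !inE /cl0 /=; apply/andP/imsetP.
  by case=> _ /eqP ij; subst j; exists k.
by case=> k' _ [ij _]; rewrite ij pi eqxx.
Qed.

Lemma card_c (p : pred L) : #|[set y | p (c y)]| = \sum_(i | p i) #|[set x | c x == i]|.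
Proof.
rewrite -sum1_card (partition_big c p) /=; last by move=> x; rewrite inE.
apply: eq_bigr => i pi; rewrite sum1dep_card; apply: eq_card => x; rewrite !inE.
by case: eqP => [->|]; rewrite ?pi ?andbF.
Qed.

Lemma units_le (p : pred L) : s * #|[set x | p (cl0 x)]| <= #|[set y | p (c y)]|.
Proof.
rewrite card_cl0 card_c big_distrr /=; apply: leq_sum => i _; rewrite /N.
by case: ifP; rewrite ?muln0 // mulnC leq_trunc_div.
Qed.

Lemma units_ge (p : pred L) : (forall i, p i -> good i) ->
  #|[set y | p (c y)]| <= s * #|[set x | p (cl0 x)]| + #|L| * s.
Proof.
move=> pg; rewrite card_cl0 card_c big_distrr /=.
apply: (@leq_trans (\sum_(i | p i) (s * N i + s))).
  apply: leq_sum => i /pg gi; rewrite /N gi mulnC -mulSnr ltnW // ltn_ceil //.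
rewrite big_split leq_add2l /= sum_nat_const leq_mul2r max_card orbT //.
Qed.

Lemma cl0_good x : good (cl0 x).
Proof.
by case: x => i k; rewrite /cl0 /=; have := leq_ltn_trans (leq0n k) (ltn_ord k); rewrite {1}/N; case: ifP.
Qed.

(** The error has two sources: rounding loses fewer than [s] vertices in each cluster, together at
    most [#|L| * s], and the at most [I %/ s + 1] unmatched units account for [I + s]. *)
Theorem units_exist : exists (Np : nat) (cl : 'I_Np * bool -> L),
  [/\ forall z, r (cl z) (cl (flip z)),
      forall z, good (cl z),
      forall p : pred L, s * #|[set z | p (cl z)]| <= #|[set y | p (c y)]| &
      forall p : pred L, (forall i, p i -> good i) ->
        #|[set y | p (c y)]| <= s * #|[set z | p (cl z)]| + (#|L| * s + I + s)].
Proof.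
pose rr (x y : U) := r (cl0 x) (cl0 y); pose ir (x y : U) := irr (cl0 x) (cl0 y).
have card_U : s * #|{: U}| <= #|T|.
  have := units_le predT; rewrite (eq_card (B := predT)); last by move=> x; rewrite inE.
  by move/leq_trans; apply; exact: max_card.
have [|||M [mM fixM]] := @large_matching U rr ir (I %/ s).
- by move=> x y; rewrite /rr r_sym.
(* Each of the two degrees loses at most [#|L| * s] when units are counted instead of vertices; this
   is the surplus in the hypothesis [ore]. *)
- move=> x y nr ni; have o := ore (cl0_good x) (cl0_good y) nr ni.
  have h z := @units_ge (r (cl0 z)) (fun i => @r_good _ i).
  rewrite ltnNge; apply/negP => le; have := leq_mul (leqnn s) le; rewrite mulnDr.
  have arith (t k v w A B u : nat) : t + 2 * k < v + w -> v <= A + k -> w <= B + k ->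
    u <= t -> A + B <= u -> False by lia.
  exact: arith o (h x) (h y) card_U.
- move=> x; rewrite leq_divRL // mulnC.
  by apply: leq_trans (irr_few (cl0_good x)); exact: (units_le (irr (cl0 x))).
have /matchingP mP := mM.
(* Each matched pair is indexed by its end of smaller rank. *)
pose half := [set x | enum_rank x < enum_rank (M x)].
pose g (z : 'I_#|half| * bool) := if z.2 then M (enum_val z.1) else enum_val z.1.
have MK x : M (M x) = x by case: (mP x).
have half_lt (k : 'I_#|half|) : enum_rank (enum_val k) < enum_rank (M (enum_val k)).
  by have := enum_valP k; rewrite inE.
have ginj : injective g.
  move=> [k b] [k' b']; rewrite /g /=; have h := half_lt k; have h' := half_lt k'.
  case: b; case: b' => E.
  - by rewrite (enum_val_inj (can_inj MK E)).
  - by move: h h'; rewrite -E MK => lt1 lt2; have := ltn_trans lt1 lt2; rewrite ltnn.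
  - by move: h h'; rewrite E MK => lt1 lt2; have := ltn_trans lt1 lt2; rewrite ltnn.
  - by rewrite (enum_val_inj E).
have gcov x : M x != x -> exists z, g z = x.
  move=> mx; have : enum_rank x != enum_rank (M x).
    by apply: contra mx => /eqP/enum_rank_inj/esym/eqP.
  rewrite neq_ltn => /orP[lt|lt].
    have xh : x \in half by rewrite inE.
    by exists (enum_rank_in xh x, false); rewrite /g /= enum_rankK_in.
  have xh : M x \in half by rewrite inE MK.
  by exists (enum_rank_in xh (M x), true); rewrite /g /= enum_rankK_in.
have gflip z : g (flip z) = M (g z).
  by case: z => k [] //=; rewrite /g /= MK.
have gne z : M (g z) <> g z.
  move=> E; have := half_lt z.1; move: E; rewrite /g; case: z.2 => E.
    by rewrite MK in E; rewrite -E ltnn.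
  by rewrite E ltnn.
have cnt (p : pred L) : #|[set z | p (cl0 (g z))]| = #|[set x | p (cl0 x)] :&: covered M|.
  rewrite -(card_imset _ ginj); apply: eq_card => x; rewrite inE.
  apply/imsetP/andP => [[z]|[]]; rewrite !inE.
    by move=> pz ->; split=> //; apply/eqP/gne.
  by move=> px /gcov[z zx]; exists z; rewrite ?inE zx.
exists #|half|, (fun z => cl0 (g z)); split.
- by move=> z; rewrite gflip; case: (mP (g z)) => _; apply; exact: gne.
- by move=> z; exact: cl0_good.
- move=> p; rewrite cnt; apply: leq_trans (units_le p); rewrite leq_mul2l.
  by apply/orP; right; rewrite subset_leq_card // subsetIl.
move=> p pg; apply: leq_trans (units_ge pg) _; rewrite cnt.
have h := cardsID (covered M) [set x | p (cl0 x)].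
have h2 : #|[set x | p (cl0 x)] :\: covered M| <= I %/ s + 1.
  rewrite addn1; apply: leq_trans fixM; apply/subset_leq_card/subsetP => x.
  by rewrite in_setD in_setC => /andP[].
have h3 := leq_trunc_div I s.
have h4 : s * #|[set x | p (cl0 x)] :\: covered M| <= I + s.
  by apply: leq_trans (leq_mul (leqnn s) h2) _; rewrite mulnDr muln1 leq_add2r mulnC.
by rewrite -h mulnDr -addnA leq_add2l addnC -addnA leq_add2l.
Qed.

End Units.

Import Order.TTheory GRing.Theory Num.Theory.
Local Open Scope ring_scope.

(** * Szemerédi's regularity lemma *)

Section CondAvg.
Variables (R : realFieldType) (Q : finType) (w : Q -> R).

Definition fib (M : finType) (k : Q -> M) (p : Q) := [set q | k q == k p].

Definition cavg (M : finType) (k : Q -> M) (p : Q) : R :=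
  (\sum_(q in fib k p) w q) / #|fib k p|%:R.

Lemma fib_self (M : finType) (k : Q -> M) p : p \in fib k p.
Proof. by rewrite inE. Qed.

Lemma card_fib_gt0 (M : finType) (k : Q -> M) p : 0 < #|fib k p|%:R :> R.
Proof. by rewrite ltr0n; apply/card_gt0P; exists p; exact: fib_self. Qed.

Lemma cavg_fib (M : finType) (k : Q -> M) p q : k p = k q -> cavg k p = cavg k q.
Proof. by rewrite /cavg /fib => ->. Qed.

Lemma sum_cavg (M : finType) (k : Q -> M) (h : M -> R) :
  \sum_p h (k p) * cavg k p = \sum_p h (k p) * w p.
Proof.
rewrite (partition_big k predT) //= [RHS](partition_big k predT) //=.
apply: eq_bigr => m _.
have [p0 /eqP kp0|none] := pickP (fun p => k p == m); last first.
  by rewrite !big_pred0.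
have -> : \sum_(p | k p == m) h (k p) * cavg k p
        = \sum_(p in fib k p0) h m * cavg k p0.
  apply: eq_big => [p|p /eqP kp]; first by rewrite inE kp0.
  by rewrite kp; congr (_ * _); apply: cavg_fib; rewrite kp kp0.
rewrite sumr_const -mulrnAr /cavg -mulr_natr divfK ?gt_eqF ?card_fib_gt0 //.
rewrite mulr_sumr; apply: eq_big => [p|p]; first by rewrite inE kp0.
by rewrite inE => /eqP ->; rewrite kp0.
Qed.

Definition energy (M : finType) (k : Q -> M) : R := \sum_p cavg k p ^+ 2.

(** Pythagoras: the coarse average is the projection of the fine one, so their inner product is the
    coarse energy. *)
Lemma energy_refine (M M' : finType) (k : Q -> M) (k' : Q -> M') (pr : M' -> M) :
  (forall p, k p = pr (k' p)) ->
  energy k' = energy k + \sum_p (cavg k' p - cavg k p) ^+ 2.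
Proof.
move=> kE.
have cross : \sum_p cavg k p * cavg k' p = energy k.
  (* The coarse average written as a function of the coarse cell, so that [sum_cavg] applies to both
     partitions; the value on empty cells is irrelevant. *)
  pose rep m : R := if [pick p | k p == m] is Some p then cavg k p else 0.
  have repE p : rep (k p) = cavg k p.
    rewrite /rep; case: pickP => [q /eqP kq|/(_ p)]; last by rewrite eqxx.
    exact: cavg_fib.
  have := sum_cavg k' (fun m' => rep (pr m')).
  have := sum_cavg k rep.
  under eq_bigr do rewrite repE.
  under [in RHS]eq_bigr do rewrite repE.
  move=> E1.
  under eq_bigr do rewrite -kE repE.
  under [in RHS]eq_bigr do rewrite -kE repE.
  by rewrite -E1 => ->; apply: eq_bigr => p _; rewrite expr2.
have -> : \sum_p (cavg k' p - cavg k p) ^+ 2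
  = \sum_p cavg k' p ^+ 2 - 2 * (\sum_p cavg k p * cavg k' p) + \sum_p cavg k p ^+ 2.
  rewrite mulr_sumr -sumrB -big_split /=; apply: eq_bigr => p _; ring.
rewrite cross /energy; ring.
Qed.

Hypothesis w01 : forall q, 0 <= w q <= 1.

Lemma cavg01 (M : finType) (k : Q -> M) p : 0 <= cavg k p <= 1.
Proof.
have gt := card_fib_gt0 k p.
rewrite /cavg divr_ge0 ?(ltW gt) ?sumr_ge0 //=; last by move=> q _; case/andP: (w01 q).
rewrite ler_pdivrMr // mul1r -sum1_card natr_sum.
by apply: ler_sum => q _; case/andP: (w01 q).
Qed.

Lemma energy_le (M : finType) (k : Q -> M) : energy k <= #|Q|%:R.
Proof.
rewrite -sum1_card natr_sum; apply: ler_sum => p _.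
by case/andP: (cavg01 k p) => h0 h1; rewrite expr_le1.
Qed.

End CondAvg.

(** * Energy increment *)

Section Regularity.
Variables (R : realFieldType) (T : finType) (e : rel T).

Definition edges (X Y : {set T}) : R := \sum_(p in setX X Y) (e p.1 p.2)%:R.

Definition cls (L : finType) (c : T -> L) (i : L) := [set x | c x == i].

Definition dens (X Y : {set T}) : R := edges X Y / (#|X|%:R * #|Y|%:R).

(* Multiplied out, so that no hypothesis excludes empty clusters. *)
Definition irr_witness (eps : R) (A B : {set T}) (XY : {set T} * {set T}) : bool :=
  [&& XY.1 \subset A, XY.2 \subset B,
    eps * #|A|%:R <= #|XY.1|%:R, eps * #|B|%:R <= #|XY.2|%:R &
    eps * (#|XY.1|%:R * #|XY.2|%:R)
      < `|edges XY.1 XY.2 - dens A B * (#|XY.1|%:R * #|XY.2|%:R)|].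

Definition regular (eps : R) (A B : {set T}) : bool :=
  ~~ [exists XY, irr_witness eps A B XY].

Definition kpair (L : finType) (c : T -> L) (p : T * T) := (c p.1, c p.2).
Definition wedge (p : T * T) : R := (e p.1 p.2)%:R.

Lemma wedge01 p : 0 <= wedge p <= 1.
Proof. by rewrite /wedge ler0n lern1 leq_b1. Qed.

Lemma fib_kpair (L : finType) (c : T -> L) p :
  fib (kpair c) p = setX (cls c (c p.1)) (cls c (c p.2)).
Proof. by apply/setP => -[x y]; rewrite !inE /kpair /= xpair_eqE. Qed.

Lemma cavg_dens (L : finType) (c : T -> L) p :
  cavg wedge (kpair c) p = dens (cls c (c p.1)) (cls c (c p.2)).
Proof. by rewrite /cavg fib_kpair cardsX natrM. Qed.

Lemma sum_cavg_rect (M : finType) (k : T * T -> M) (A : {set T * T}) :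
  (forall p q, k p = k q -> p \in A -> q \in A) ->
  \sum_(p in A) cavg wedge k p = \sum_(p in A) wedge p.
Proof.
move=> sat; pose h m : R := [exists p, (p \in A) && (k p == m)]%:R.
have hE p : h (k p) = (p \in A)%:R.
  rewrite /h; case: existsP => [[q /andP[qA /eqP kq]]|no]; first by rewrite (sat _ _ kq).
  by case: (boolP (p \in A)) => // pA; case: no; exists p; rewrite pA eqxx.
have := sum_cavg wedge k h.
under eq_bigr do rewrite hE; under [in RHS]eq_bigr do rewrite hE.
rewrite !(big_mkcond (fun p => p \in A)) => E.
transitivity (\sum_p (p \in A)%:R * cavg wedge k p).
  by apply: eq_bigr => p _; case: ifP => _; rewrite ?mul1r ?mul0r.
by rewrite E; apply: eq_bigr => p _; case: ifP => _; rewrite ?mul1r ?mul0r.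
Qed.

Definition irr_weight (eps : R) (L : finType) (c : T -> L) :=
  #|[set p : T * T | ~~ regular eps (cls c (c p.1)) (cls c (c p.2))]|.

(** Refine by the witnesses of all irregular pairs. On the rectangle of a witness the averages
    change enough to gain [eps ^+ 4] times the product of the sizes of the two clusters, and these
    products sum to the irregular weight, which exceeds [eps] times the number of vertex pairs. *)
Lemma energy_increment (eps : R) (L : finType) (c : T -> L) :
  0 < eps -> eps * #|{: T * T}|%:R < (irr_weight eps c)%:R ->
  exists c' : T -> L * {ffun L * L -> bool * bool},
    energy wedge (kpair c) + eps ^+ 5 * #|{: T * T}|%:R <= energy wedge (kpair c').
Proof.
move=> e0 irr.
pose wit (ij : L * L) : {set T} * {set T} :=
  odflt (set0, set0) [pick XY | irr_witness eps (cls c ij.1) (cls c ij.2) XY].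
(* Membership in both witness sets is recorded for every pair of clusters, so each witness rectangle
   is a union of new cells. *)
pose c' x := (c x, [ffun ij => (x \in (wit ij).1, x \in (wit ij).2)]).
exists c'.
rewrite (@energy_refine _ _ wedge _ _ (kpair c) (kpair c') (fun m => (m.1.1, m.2.1))) //.
rewrite lerD2l.
pose D p := (cavg wedge (kpair c') p - cavg wedge (kpair c) p) ^+ 2.
have pos p : 0 <= D p by exact: sqr_ge0.
rewrite -[X in _ <= X]/(\sum_p D p).
have local ij : ~~ regular eps (cls c ij.1) (cls c ij.2) ->
   eps ^+ 4 * (#|cls c ij.1|%:R * #|cls c ij.2|%:R) <= \sum_(p | kpair c p == ij) D p.
  move=> nreg.
  have : irr_witness eps (cls c ij.1) (cls c ij.2) (wit ij).
    rewrite /wit; case: pickP => //= no; move: nreg.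
    by rewrite negbK => /existsP[XY]; rewrite no.
  rewrite /irr_witness.
  set X := (wit ij).1; set Y := (wit ij).2 => /and5P[XA YB cX cY dev].
  have sat p q : kpair c' p = kpair c' q -> p \in setX X Y -> q \in setX X Y.
    move=> [_ /ffunP/(_ ij) + _ /ffunP/(_ ij)]; rewrite !ffunE => -[E1 _] [_ E2].
    by rewrite !inE -/X -/Y -E1 -E2.
  have kc p : p \in setX X Y -> kpair c p = ij.
    rewrite inE => /andP[/(subsetP XA) + /(subsetP YB)]; rewrite !inE /kpair.
    by move=> /eqP -> /eqP ->; case: (ij).
  apply: (@le_trans _ _ (\sum_(p in setX X Y) D p)); last first.
    rewrite [leRHS](bigID (mem (setX X Y))) /= -[leLHS]addr0 lerD ?sumr_ge0 //.
    rewrite le_eqVlt; apply/orP; left; apply/eqP; apply: eq_bigl => p.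
    by case: (boolP (p \in setX X Y)) => [/kc ->|]; rewrite ?eqxx // andbF.
  (* In place of the Cauchy-Schwarz inequality, the squares of (change of average - [t]) are summed
     over the rectangle, with [t] of the sign of the deviation. *)
  pose t : R := if 0 <= edges X Y - dens (cls c ij.1) (cls c ij.2) * (#|X|%:R * #|Y|%:R) then eps else - eps.
  have cst p : p \in setX X Y -> cavg wedge (kpair c) p = dens (cls c ij.1) (cls c ij.2).
    by move=> /kc <-; rewrite cavg_dens.
  have sumD : \sum_(p in setX X Y) (cavg wedge (kpair c') p - cavg wedge (kpair c) p)
     = edges X Y - dens (cls c ij.1) (cls c ij.2) * (#|X|%:R * #|Y|%:R).
    rewrite sumrB (sum_cavg_rect sat); congr (_ - _).
    rewrite (eq_bigr _ cst) sumr_const cardsX. by rewrite -natrM mulr_natr.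
  have low : 2 * t * (\sum_(p in setX X Y) (cavg wedge (kpair c') p - cavg wedge (kpair c) p))
     - t ^+ 2 * (#|X|%:R * #|Y|%:R) <= \sum_(p in setX X Y) D p.
    have -> : t ^+ 2 * (#|X|%:R * #|Y|%:R) = \sum_(p in setX X Y) t ^+ 2.
      by rewrite sumr_const cardsX -natrM mulr_natr.
    rewrite mulr_sumr -sumrB; apply: ler_sum => p _; rewrite /D.
    have := sqr_ge0 (cavg wedge (kpair c') p - cavg wedge (kpair c) p - t); nra.
  apply: le_trans low; rewrite sumD.
  have -> : t ^+ 2 = eps ^+ 2 by rewrite /t; case: ifP => _ //; rewrite sqrrN.
  have big : 2 * eps * (eps * (#|X|%:R * #|Y|%:R)) <=
    2 * t * (edges X Y - dens (cls c ij.1) (cls c ij.2) * (#|X|%:R * #|Y|%:R)).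
    move: dev; rewrite /t; case: (lerP 0) => [h|h]; [rewrite ger0_norm // | rewrite ltr0_norm //] => dv;
      have := ler_wpM2l (ltW e0) (ltW dv); lra.
  have xy : (eps * #|cls c ij.1|%:R) * (eps * #|cls c ij.2|%:R) <= #|X|%:R * #|Y|%:R.
    by apply: ler_pM; rewrite // ?mulr_ge0 ?(ltW e0).
  have e2 : 0 <= eps ^+ 2 by exact: sqr_ge0.
  have := ler_wpM2l e2 xy.
  move: big; set xx := #|X|%:R * #|Y|%:R; set aa := #|cls c ij.1|%:R; set bb := #|cls c ij.2|%:R.
  nra.
rewrite (partition_big (kpair c) predT) //=.
apply: (@le_trans _ _ (\sum_(ij | ~~ regular eps (cls c ij.1) (cls c ij.2)) \sum_(p | kpair c p == ij) D p)); last first.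
  rewrite [leRHS](bigID (fun ij => ~~ regular eps (cls c ij.1) (cls c ij.2))) /=.
  by rewrite -[leLHS]addr0 lerD //; apply: sumr_ge0 => ij _; exact: sumr_ge0.
apply: (@le_trans _ _ (\sum_(ij | ~~ regular eps (cls c ij.1) (cls c ij.2))
    eps ^+ 4 * (#|cls c ij.1|%:R * #|cls c ij.2|%:R))); last by apply: ler_sum => ij; exact: local.
have cnt : (irr_weight eps c)%:R =
  \sum_(ij | ~~ regular eps (cls c ij.1) (cls c ij.2)) (#|cls c ij.1|%:R * #|cls c ij.2|%:R) :> R.
  rewrite /irr_weight -sum1_card natr_sum.
  rewrite (partition_big (kpair c) (fun ij => ~~ regular eps (cls c ij.1) (cls c ij.2))) /=; last first.
    by move=> p; rewrite inE.
  apply: eq_bigr => -[i j] nreg.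
  rewrite -natrM -cardsX -sum1_card natr_sum; apply: eq_bigl => -[x y].
  rewrite !inE /kpair /= xpair_eqE; case: eqP => [->|_]; last by rewrite andbF.
  by case: eqP => [->|_]; rewrite ?andbF // nreg.
rewrite -mulr_sumr -cnt exprSr -mulrA ler_wpM2l ?exprn_ge0 ?ltW //.
Qed.

End Regularity.

(* The parts need not have equal sizes: irregularity is measured by the number of vertex pairs
   lying in irregular pairs of parts. *)
Lemma regularity (R : archiRealFieldType) (eps : R) : 0 < eps ->
  exists K : nat, forall (T : finType) (e : rel T),
    exists (L : finType) (c : T -> L), (#|L| <= K)%N /\
      (irr_weight e eps c)%:R <= eps * #|{: T * T}|%:R.
Proof.
move=> e0.
have step (t : nat) : exists K : nat, forall (T : finType) (e : rel T),
    exists (L : finType) (c : T -> L), (#|L| <= K)%N /\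
      ((irr_weight e eps c)%:R <= eps * #|{: T * T}|%:R \/
       t%:R * (eps ^+ 5 * #|{: T * T}|%:R) <= energy (wedge R e) (kpair c)).
  elim: t => [|t [K IH]].
    exists 1%N => T e; exists unit, (fun _ => tt); split; first by rewrite card_unit.
    by right; rewrite mul0r sumr_ge0 // => p _; exact: sqr_ge0.
  exists (K * 4 ^ (K * K))%N => T e.
  have [L [c [LK H]]] := IH T e.
  have bound : (#|L| <= K * 4 ^ (K * K))%N.
    by apply: (leq_trans LK); rewrite leq_pmulr // expn_gt0.
  have [reg|irr] := lerP (irr_weight e eps c)%:R (eps * #|{: T * T}|%:R).
    by exists L, c; split => //; left.
  case: H => [reg|H]; first by rewrite leNgt irr in reg.
  have [c' inc] := energy_increment e0 irr.
  exists (L * {ffun L * L -> bool * bool})%type, c'; split.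
    rewrite card_prod card_ffun !card_prod card_bool leq_mul // leq_pexp2l //.
    by rewrite leq_mul.
  right; apply: le_trans inc; rewrite -natr1 mulrDl mul1r lerD2r //.
have e5 : 0 < eps ^+ 5 by exact: exprn_gt0.
(* The energy never exceeds the number of vertex pairs, so there is no room for more than [eps ^- 5]
   increments. *)
pose t := (Num.bound (eps ^- 5)).
have [K HK] := step t.+1.
exists K => T e; have [L [c [LK H]]] := HK T e.
exists L, c; split => //; case: H => // H.
have := le_trans H (energy_le (@wedge01 R T e) (kpair c)).
have tb : 1 < t.+1%:R * eps ^+ 5.
  rewrite -ltr_pdivrMr // mul1r; apply: (@lt_trans _ _ t%:R); last by rewrite ltr_nat.
  by apply: archi_boundP; rewrite invr_ge0 ltW.
rewrite mulrA; have [z|pos] := posnP #|{: T * T}|; last first.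
  have pos' : 0 < #|{: T * T}|%:R :> R by rewrite ltr0n.
  by move=> le; exfalso; move: le; apply/negP; rewrite -ltNge ltr_pMl.
move=> _; rewrite z mulr0 (_ : irr_weight _ _ _ = 0%N) //.
by apply/eqP; rewrite -leqn0 -z; exact: max_card.
Qed.

(** * Greedy embedding in regular pairs *)

Definition upd (V : eqType) (T : Type) (f : V -> T) (i : V) (a : T) : V -> T :=
  fun x => if x == i then a else f x.

(** The form of regularity that suits greedy choices: all but few images [a] shrink a given
    candidate set [Y] by a factor of at most [d]. *)
Definition lower_regular (R : realFieldType) (T : finType) (e : rel T) (d eps : R) (A B : {set T}) :=
  forall Y : {set T}, Y \subset B -> eps * #|B|%:R <= #|Y|%:R ->
    #|[set a in A | #|nbh e a :&: Y|%:R < d * #|Y|%:R]|%:R <= eps * #|A|%:R.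

Section Greedy.
Variables (R : realFieldType) (T V L : finType) (e : rel T) (H : rel V).
Variables (c : T -> L) (r : rel L) (phi : V -> L) (sb key : V -> nat).
Variables (Bf : {set V}) (d eps delta : R) (Delta ell : nat).

Hypotheses (e_sym : symmetric e) (H_sym : symmetric H) (H_irr : irreflexive H).
Hypotheses (d0 : 0 < d) (d1 : d <= 1) (eps0 : 0 <= eps).
Hypothesis reg : forall i j, r i j -> lower_regular e d eps (cls c i) (cls c j).
Hypothesis phi_hom : forall x y, H x y -> r (phi x) (phi y).
Hypothesis sb_near : forall x y, H x y -> (sb y <= (sb x).+1)%N.
Hypothesis degH : forall x, (#|nbh H x| <= Delta)%N.
Hypothesis cap : forall i,
  #|[set x | (x \notin Bf) && (phi x == i)]|%:R <= (1 - delta) * #|cls c i|%:R.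
Hypothesis sb_size : forall s, (#|[set x | sb x == s]| <= ell)%N.
Hypothesis key_sb : forall x y, (sb x < sb y)%N -> (key x < key y)%N.
Hypothesis eps_small : eps <= d ^+ Delta * delta.
Hypothesis room : forall x,
  (2 * ell)%:R + Delta%:R * eps * #|cls c (phi x)|%:R < d ^+ Delta * delta * #|cls c (phi x)|%:R.

(* The candidates of [y] avoid only the images of superblocks before [sb y - 1]; this keeps them
   fixed while the neighbours of [y] are embedded.  Images in the last two superblocks are few,
   and are avoided when [y] itself is embedded. *)
Definition fresh (D : {set V}) (f : V -> T) y :=
  cls c (phi y) :\: f @: [set x in D | ((sb x).+1 < sb y)%N].

Definition cand (D : {set V}) (f : V -> T) y := [set a in fresh D f y | [forall z in D, H y z ==> e a (f z)]].

(** By [pe_key], [D] is an initial segment of the non-buffers in the order of [key]. The invariant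
    [pe_cand] covers buffers too: they stay unembedded, but need large candidate sets at the end. *)
Record partial_emb (D : {set V}) (f : V -> T) : Prop := PartialEmb {
  pe_bf : forall x, x \in D -> x \notin Bf;
  pe_inj : {in D &, injective f};
  pe_phi : forall x, x \in D -> c (f x) = phi x;
  pe_edge : forall x y, x \in D -> y \in D -> H x y -> e (f x) (f y);
  pe_key : forall x y, x \in D -> y \notin D -> y \notin Bf -> (key x <= key y)%N;
  pe_cand : forall y, y \notin D ->
    d ^+ #|nbh H y :&: D| * #|fresh D f y|%:R <= #|cand D f y|%:R }.

Definition next (D : {set V}) i :=
  [/\ i \notin D, i \notin Bf & forall y, y \notin D -> y \notin Bf -> (key i <= key y)%N].

Definition pool (D : {set V}) (f : V -> T) i := [set a in cand D f i | (a \notin f @: D) &&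
  [forall y, (y \notin D) && H i y ==> (d * #|cand D f y|%:R <= #|nbh e a :&: cand D f y|%:R)]].

Lemma key_le_sb x y : (key x <= key y)%N -> (sb x <= sb y)%N.
Proof. by move=> kxy; rewrite leqNgt; apply/negP => /key_sb; rewrite ltnNge kxy. Qed.

Lemma fresh_upd (D : {set V}) (f : V -> T) i a y : i \notin D -> (sb y <= (sb i).+1)%N ->
  fresh (i |: D) (upd f i a) y = fresh D f y.
Proof.
move=> iD sy; rewrite /fresh; congr (_ :\: _).
have -> : [set x in i |: D | ((sb x).+1 < sb y)%N] = [set x in D | ((sb x).+1 < sb y)%N].
  apply/setP => x; rewrite !inE; case: eqP => [->|//] /=.
  by rewrite (negPf iD) ltnNge sy.
apply: eq_in_imset => x; rewrite inE => /andP[xD _]; rewrite /upd.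
by case: eqP xD iD => // -> ->.
Qed.

(** For the candidates of [y] there are three cases. If [y] is adjacent to [i], they shrink by a
    factor of at most [d] and [fresh] is unchanged. If not, and [y] is at most one superblock ahead,
    no candidate is lost. If [y] is further ahead, [fresh] may shrink, but no neighbour of [y] is
    embedded yet, so every fresh vertex is a candidate. *)
Lemma partial_emb_step (D : {set V}) (f : V -> T) i a : partial_emb D f -> next D i -> a \in pool D f i ->
  partial_emb (i |: D) (upd f i a).
Proof.
move=> [bfD injf phif edgef keyf candf] [iD iB imin].
rewrite inE => /and3P[aC aF /forallP ag].
have updD x : x \in D -> upd f i a x = f x.
  by rewrite /upd; case: eqP => // -> xD; rewrite xD in iD.
have updi : upd f i a i = a by rewrite /upd eqxx.
have [aP adj] : c a = phi i /\ forall z, z \in D -> H i z -> e a (f z).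
  move: aC; rewrite !inE => /andP[/andP[_ /eqP ->] /forall_inP h].
  by split=> // z zD iz; have := h z zD; rewrite iz.
have sbD x : x \in D -> (sb x <= sb i)%N by move=> xD; apply/key_le_sb/keyf.
split.
- by move=> x /setU1P[-> //|/bfD].
- move=> x y /setU1P[->|xD] /setU1P[->|yD] //; rewrite ?updi ?updD //.
  + by move=> ay; case/negP: aF; rewrite ay; apply: imset_f.
  + by move=> ay; case/negP: aF; rewrite -ay; apply: imset_f.
  + exact: injf.
- by move=> x /setU1P[->|xD]; rewrite ?updi ?updD // phif.
- move=> x y /setU1P[->|xD] /setU1P[->|yD]; rewrite ?updi ?updD //.
  + by rewrite H_irr.
  + exact: adj.
  + by rewrite H_sym e_sym; apply: adj.
  + exact: edgef.
- move=> x y /setU1P[->|xD]; rewrite !inE negb_or => /andP[_ yD] yB; first exact: imin.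
  exact: keyf.
move=> y; rewrite !inE negb_or => /andP[yi yD].
have [Hyi|nHyi] := boolP (H y i).
  have sy : (sb y <= (sb i).+1)%N by apply: sb_near; rewrite H_sym.
  rewrite fresh_upd //.
  have -> : cand (i |: D) (upd f i a) y = nbh e a :&: cand D f y.
    apply/setP => b; rewrite /cand fresh_upd // !inE.
    case: (_ && (c b == phi y)); rewrite /= ?andbF //.
    apply/forall_inP/andP => [h|[eab /forall_inP h] z].
      split; first by have := h i (setU11 _ _); rewrite Hyi updi e_sym.
      apply/forall_inP => z zD; have := h z; rewrite updD //; apply.
      by rewrite setU1r.
    case/setU1P => [->|zD]; first by rewrite updi e_sym eab implybT.
    by rewrite updD //; apply: h.
  have -> : nbh H y :&: (i |: D) = i |: (nbh H y :&: D).
    apply/setP => z; rewrite !inE andb_orr; case: eqP => [->|_] /=; last by rewrite andbF.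
    by rewrite Hyi.
  rewrite cardsU1 !inE (negPf iD) andbF add1n exprS -mulrA.
  apply: le_trans (ler_wpM2l (ltW d0) (candf _ yD)) _.
  by have /implyP := ag y; apply; rewrite yD H_sym.
have nb : nbh H y :&: (i |: D) = nbh H y :&: D.
  apply/setP => z; rewrite !inE andb_orr; case: eqP => [->|_] /=; last by rewrite andbF.
  by rewrite (negPf nHyi).
have [sy|sy] := leqP (sb y) (sb i).+1.
  rewrite nb fresh_upd //; apply: le_trans (candf _ yD) _.
  rewrite ler_nat; apply/subset_leq_card/subsetP => b; rewrite /cand fresh_upd // !inE.
  move=> /andP[-> /forall_inP h] /=; apply/forall_inP => z.
  case/setU1P => [->|zD]; first by rewrite (negPf nHyi).
  by rewrite updD //; apply: h.
have far z : z \in D -> H y z = false.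
  move=> zD; apply/negP => Hyz; move: sy.
  rewrite ltnNge => /negP; apply; apply: leq_trans (sb_near (_ : H z y)) _.
    by rewrite H_sym.
  by rewrite ltnS sbD.
have -> : nbh H y :&: (i |: D) = set0.
  by rewrite nb; apply/setP => z; rewrite !inE; apply/negP => /andP[+ zD]; rewrite far.
rewrite cards0 expr0 mul1r ler_nat; apply/subset_leq_card/subsetP => b bF.
rewrite inE bF; apply/forall_inP => z /setU1P[->|/far ->] //.
by rewrite (negPf nHyi).
Qed.

Lemma card_image_cls (D : {set V}) (f : V -> T) i (E : {set V}) : partial_emb D f -> E \subset D ->
  (#|f @: E :&: cls c i| <= #|[set x in E | phi x == i]|)%N.
Proof.
move=> pe ED; apply: leq_trans (leq_imset_card f _); apply/subset_leq_card/subsetP => b.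
rewrite !inE => /andP[/imsetP[x xE ->] /eqP cx]; apply: imset_f.
by rewrite inE xE -cx (pe_phi pe) ?eqxx // (subsetP ED).
Qed.

Lemma fresh_card (D : {set V}) (f : V -> T) y : partial_emb D f -> delta * #|cls c (phi y)|%:R <= #|fresh D f y|%:R.
Proof.
move=> pe; set E := [set x in D | ((sb x).+1 < sb y)%N].
have ED : E \subset D by apply/subsetP => x; rewrite inE => /andP[].
have h1 := card_image_cls (phi y) pe ED.
have h2 : (#|[set x in E | phi x == phi y]| <= #|[set x | (x \notin Bf) && (phi x == phi y)]|)%N.
  apply/subset_leq_card/subsetP => x; rewrite !inE => /andP[/andP[xD _] ->].
  by rewrite (pe_bf pe).
have : (#|cls c (phi y)| <= #|fresh D f y| + #|[set x | (x \notin Bf) && (phi x == phi y)]|)%N.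
  rewrite -(cardsID (f @: E)) addnC leq_add2l setIC.
  exact: leq_trans h1 h2.
rewrite -(ler_nat R) natrD; have := cap (phi y); lra.
Qed.

Lemma cand_card (D : {set V}) (f : V -> T) y : partial_emb D f -> y \notin D ->
  d ^+ Delta * delta * #|cls c (phi y)|%:R <= #|cand D f y|%:R.
Proof.
move=> pe yD; apply: le_trans (pe_cand pe yD).
rewrite -mulrA; apply: ler_pM; rewrite ?exprn_ge0 ?(ltW d0) //.
- apply: mulr_ge0 => //; have := le_trans eps0 eps_small.
  by rewrite pmulr_rge0 // exprn_gt0.
- apply: ler_wiXn2l; rewrite ?(ltW d0) //.
  by apply: leq_trans (degH y); apply/subset_leq_card/subsetIl.
- exact: fresh_card.
Qed.

(** Each unembedded neighbour of [i] spoils at most an [eps] fraction of the cluster. The set [Z] is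
    arbitrary because the potential argument needs many choices within a favourable part of the
    candidates. *)
Lemma pool_large (D : {set V}) (f : V -> T) i (Z : {set T}) : partial_emb D f -> next D i -> Z \subset cand D f i ->
  #|Z|%:R - #|f @: D :&: Z|%:R - Delta%:R * eps * #|cls c (phi i)|%:R <= #|Z :&: pool D f i|%:R.
Proof.
move=> pe [iD iB imin] ZC.
pose bad y := [set a in cls c (phi i) |
   #|nbh e a :&: cand D f y|%:R < d * #|cand D f y|%:R].
have badc y : y \in nbh H i :\: D -> #|bad y|%:R <= eps * #|cls c (phi i)|%:R.
  rewrite !inE => /andP[yD iy]; apply: (reg (phi_hom iy)).
    by apply/subsetP => a; rewrite !inE => /andP[/andP[]].
  by apply: le_trans (cand_card pe yD); apply: ler_wpM2r.
have cov : Z \subset (Z :&: pool D f i) :|: (f @: D :&: Z) :|: \bigcup_(y in nbh H i :\: D) bad y.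
  apply/subsetP => a aZ; rewrite !in_setU !in_setI aZ andbT.
  have aC := subsetP ZC _ aZ.
  case: (boolP (a \in f @: D)) => aD; rewrite ?orbT //= orbF.
  rewrite [in X in X || _]inE aC aD /=.
  case: (boolP [forall _, _]) => //= /forallPn[y]; rewrite negb_imply -ltNge => /andP[/andP[yD iy] lt].
  apply/bigcupP; exists y; first by rewrite !inE yD.
  by rewrite inE lt andbT; move: aC; rewrite !inE => /andP[/andP[]].
have := leq_trans (subset_leq_card cov) (leq_card_setU _ _).1.
have u1 := (leq_card_setU (Z :&: pool D f i) (f @: D :&: Z)).1.
have u2 : (#|\bigcup_(y in nbh H i :\: D) bad y| <= \sum_(y in nbh H i :\: D) #|bad y|)%N.
  elim/big_rec2: _ => [|y m B _ le]; first by rewrite cards0.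
  by apply: leq_trans (leq_card_setU _ _).1 _; rewrite leq_add2l.
have u3 : (\sum_(y in nbh H i :\: D) #|bad y|)%N%:R <= Delta%:R * eps * #|cls c (phi i)|%:R.
  rewrite natr_sum; apply: (le_trans (ler_sum _ badc)).
  rewrite sumr_const -[leLHS]mulr_natl -mulrA ler_wpM2r ?mulr_ge0 // ler_nat.
  by apply: leq_trans (degH i); apply/subset_leq_card/subsetDl.
move: u1 u2; rewrite -!(ler_nat R) !natrD => u1 u2 u0.
lra.
Qed.

(** Candidates avoid the images of all superblocks before the preceding one, and no later superblock
    has begun, so at most [2 * ell] candidates are occupied. *)
Lemma pool_gt0 (D : {set V}) (f : V -> T) i : partial_emb D f -> next D i -> (0 < #|pool D f i|)%N.
Proof.
move=> pe nx; have [iD iB imin] := nx.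
have h := pool_large pe nx (subxx _).
have c1 := cand_card pe iD.
have hit : (#|f @: D :&: cand D f i| <= 2 * ell)%N.
  have sub : f @: D :&: cand D f i \subset f @: [set x | (sb x == sb i) || ((sb x).+1 == sb i)].
    apply/subsetP => a; rewrite !inE => /andP[/imsetP[x xD ->] /andP[/andP[nim _] _]].
    apply: imset_f; rewrite inE.
    have : (sb x <= sb i)%N by apply/key_le_sb/(pe_key pe).
    rewrite leq_eqVlt => /orP[->//|]; rewrite leq_eqVlt => /orP[->|lt]; first by rewrite orbT.
    by case/negP: nim; apply: imset_f; rewrite inE xD.
  apply: leq_trans (subset_leq_card sub) _; apply: leq_trans (leq_imset_card _ _) _.
  have -> : [set x | (sb x == sb i) || ((sb x).+1 == sb i)]
     = [set x | sb x == sb i] :|: [set x | (sb x).+1 == sb i] by apply/setP => x; rewrite !inE.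
  apply: leq_trans (leq_card_setU _ _).1 _.
  rewrite mul2n -addnn leq_add //; case E: (sb i) => [|s].
    by rewrite (_ : [set _ | _] = set0) ?cards0 //; apply/setP => x; rewrite !inE.
  by under eq_finset => x do rewrite eqSS.
have := subset_leq_card (subsetIr (cand D f i) (pool D f i)).
move: hit; rewrite -(ltr_nat R) -!(ler_nat R) => hit h2.
have := room i; lra.
Qed.

(** The extra invariant [Q] is trivial in the ordinary phases and bounds the potential while
    swappers are embedded; [m] is the superblock at which the phase stops. *)
Lemma greedy_run (m : nat) (Q : {set V} -> (V -> T) -> Prop) :
  (forall D f i, partial_emb D f -> Q D f -> next D i -> (sb i < m)%N ->
     exists2 a, a \in pool D f i & Q (i |: D) (upd f i a)) ->
  forall D f, partial_emb D f -> Q D f ->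
  exists D' f', [/\ partial_emb D' f', Q D' f', D \subset D',
    forall x, x \in D -> f' x = f x &
    (forall x, x \notin Bf -> (sb x < m)%N -> x \in D') /\
    (forall x, x \in D' -> x \in D \/ (sb x < m)%N)].
Proof.
move=> stepQ D; move: {2}(#|~: D|.+1) (ltnSn #|~: D|) => k.
elim: k D => // k IH D; rewrite ltnS => Dk f pe QD.
case: (pickP (fun x => [&& x \notin D, x \notin Bf & (sb x < m)%N])) => [x0 hx0|none]; last first.
  exists D, f; split=> //; split=> [x xB xm|x xD]; last by left.
  by apply: contraFT (none x) => xD; rewrite xD xB xm.
case: (@arg_minnP _ x0 (fun x => (x \notin D) && (x \notin Bf)) key) => [|i /andP[iD iB] imin].
  by case/and3P: hx0 => -> ->.
have nx : next D i by split=> // y yD yB; apply: imin; rewrite yD.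
have sbi : (sb i < m)%N.
  case/and3P: hx0 => x0D x0B; apply: leq_ltn_trans; apply: key_le_sb; apply: imin.
  by rewrite x0D.
have [a ap QD'] := stepQ _ _ _ pe QD nx sbi.
have pe' := partial_emb_step pe nx ap.
have [|D' [f' [peD' QD'' sub ag [all lim]]]] := IH (i |: D) _ _ pe' QD'.
  apply: leq_trans Dk; apply: proper_card; rewrite properE; apply/andP; split.
    by apply/subsetP => x; rewrite !inE negb_or => /andP[].
  by apply/subsetPn; exists i; rewrite !inE ?iD ?eqxx.
exists D', f'; split=> //.
- by apply: subset_trans sub; exact: subsetUr.
- move=> x xD; rewrite ag ?setU1r // /upd; case: eqP => // xi.
  by rewrite -xi xD in iD.
split=> // x /lim[|]; last by right.
by case/setU1P => [->|]; [right | left].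
Qed.

Lemma partial_emb0 f : partial_emb set0 f.
Proof.
split=> [x|x|x|x y|x y|y _]; rewrite ?inE //.
rewrite setI0 cards0 expr0 mul1r ler_nat.
apply/subset_leq_card/subsetP => a aF; rewrite inE aF.
by apply/forall_inP => z; rewrite inE.
Qed.

(** * Derandomisation by a potential *)

Section Potential.
Variables (U : finType) (side : V -> U) (cl : U -> L) (bar : U -> U) (Sw : {set V}).
Variables (J : finType) (jx : J -> U) (jS : J -> {set T}) (jv : J -> T).
Variables (T2 : nat) (p zeta c0 : R).

Let P x := cls c (cl x).

Hypotheses (sw_bf : forall u, u \in Sw -> u \notin Bf)
  (sw_nbf : forall u z, u \in Sw -> H u z -> z \notin Bf)
  (sw_phi : forall u, u \in Sw -> phi u = cl (side u))
  (sw_nphi : forall u z, u \in Sw -> H u z -> phi z = cl (bar (side u)))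
  (sw_sb : forall u, u \in Sw -> (sb u < T2)%N)
  (sw_nsb : forall u z, u \in Sw -> H u z -> (sb z < T2)%N)
  (sw_disj : forall u u' z, u \in Sw -> u' \in Sw -> H u z -> H u' z -> u = u')
  (sw_ind : forall u u', u \in Sw -> u' \in Sw -> ~~ H u u')
  (sw_key : forall u z, u \in Sw -> H u z -> (key u < key z)%N)
  (sw_alone : forall u z z', u \in Sw -> H u z -> H z z' -> (key z' <= key z)%N -> z' = u).
Hypothesis usage : forall i,
  #|[set x | [&& x \notin Bf, (sb x < T2)%N & phi x == i]]|%:R <= zeta * #|cls c i|%:R.
Hypotheses (j_sub : forall j, jS j \subset P (jx j))
  (j_card : forall j, c0 * #|P (jx j)|%:R <= #|jS j|%:R)
  (j_nbh : forall j, d * #|P (bar (jx j))|%:R <= #|nbh e (jv j) :&: P (bar (jx j))|%:R)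
  (j_r : forall j, r (cl (jx j)) (cl (bar (jx j)))).
Hypotheses (p0 : 0 <= p) (p1 : p <= 1) (eps_d : eps <= d)
  (p_c0 : p + zeta + Delta.+1%:R * eps <= c0)
  (p_d : p + zeta + Delta%:R * eps <= d ^+ 2).

(* [u] is alive for the test [(S, v)] while the part of [u |: nbh H u] embedded so far fits:
   [f u] in [S], and the images of the neighbours of [u] adjacent to [v].  A step spent on [u] or
   its neighbours keeps [u] alive with probability at least [p], so that [potential] bounds the
   expectation of the sum over the tests of [2 ^- #{alive swappers at the end}]. *)
Definition alive (D : {set V}) (f : V -> T) (S : {set T}) (v : T) (u : V) :=
  ((u \in D) ==> (f u \in S) &&
     (d ^+ 2 * #|P (bar (side u))|%:R <= #|nbh e (f u) :&: (nbh e v :&: P (bar (side u)))|%:R))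
  && [forall z in D, H u z ==> e v (f z)].

Definition rem (D : {set V}) u := #|(u |: nbh H u) :\: D|.

(** The expectation of a variable equal to [1 / 2] if [u] survives its remaining steps, each with
    probability [p], and to [1] otherwise. *)
Definition factor (D : {set V}) (f : V -> T) (S : {set T}) (v : T) (u : V) : R :=
  1 - (alive D f S v u)%:R * (p ^+ rem D u / 2).

Definition potential (D : {set V}) (f : V -> T) : R :=
  \sum_j \prod_(u in Sw | side u == jx j) factor D f (jS j) (jv j) u.

Lemma factor_ge0 D f S v u : 0 <= factor D f S v u.
Proof.
rewrite /factor subr_ge0; case: alive; rewrite ?mul0r // mul1r.
have : p ^+ rem D u <= 1 by exact: exprn_ile1.
lra.
Qed.

Lemma factor_far (D : {set V}) f i a S v u : u \in Sw -> i \notin u |: nbh H u ->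
  factor (i |: D) (upd f i a) S v u = factor D f S v u.
Proof.
rewrite !inE negb_or => uS /andP[iu nui]; rewrite /factor; congr (1 - _%:R * (_ ^+ _ / 2)).
  rewrite /alive !inE eq_sym (negPf iu) /= /upd eq_sym (negPf iu); congr (_ && _).
  apply/forall_inP/forall_inP => h z.
    move=> zD; have := h z; rewrite setU1r // => /(_ isT).
    by case: eqP => // ->; rewrite (negPf nui).
  case/setU1P => [->|zD]; first by rewrite (negPf nui).
  by case: eqP => [->|_]; [rewrite (negPf nui) | apply: h].
apply: eq_card => z; rewrite !inE negb_or -andbA; case: (z =P i) => //= ->.
by rewrite (negPf iu) (negPf nui) andbF.
Qed.

Lemma rem_near (D : {set V}) i u : i \in u |: nbh H u -> i \notin D -> rem D u = (rem (i |: D) u).+1.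
Proof.
move=> iu iD; rewrite /rem (cardsD1 i) !inE iD /=; move: iu; rewrite !inE => ->.
by congr _.+1; apply: eq_card => z; rewrite !inE negb_or -!andbA; case: (z == i).
Qed.

Lemma used_card (D : {set V}) (f : V -> T) i : partial_emb D f -> next D i -> (sb i < T2)%N ->
  #|f @: D :&: cls c (phi i)|%:R <= zeta * #|cls c (phi i)|%:R.
Proof.
move=> pe [iD iB imin] sbi; apply: le_trans (usage _); rewrite ler_nat.
apply: leq_trans (card_image_cls (phi i) pe (subxx _)) _.
apply/subset_leq_card/subsetP => x; rewrite !inE => /andP[xD ->].
by rewrite (pe_bf pe) //= andbT; apply: leq_ltn_trans sbi; apply/key_le_sb/(pe_key pe).
Qed.

Lemma alive_count (D : {set V}) (f : V -> T) i j u : partial_emb D f -> next D i ->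
  (sb i < T2)%N -> u \in Sw -> side u = jx j -> i \in u |: nbh H u ->
  alive D f (jS j) (jv j) u ->
  p * #|pool D f i|%:R <=
  #|[set a in pool D f i | alive (i |: D) (upd f i a) (jS j) (jv j) u]|%:R.
Proof.
move=> pe nx sbi uS su iu al; have [iD iB imin] := nx.
have used := used_card pe nx sbi.
have poolP : #|pool D f i|%:R <= #|cls c (phi i)|%:R :> R.
  rewrite ler_nat; apply/subset_leq_card/subsetP => a.
  by rewrite !inE => /andP[/andP[/andP[_ ->]]].
set PP := cls c (phi i) in used poolP *.
suff [Z [ZC ZD Zal Zc]] : exists Z : {set T}, [/\ Z \subset cand D f i, [disjoint f @: D & Z],
    (forall a, a \in Z -> alive (i |: D) (upd f i a) (jS j) (jv j) u) &
    p * #|PP|%:R + Delta%:R * eps * #|PP|%:R <= #|Z|%:R].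
  have := pool_large pe nx ZC; rewrite (disjoint_setI0 ZD) cards0 -/PP => big.
  have sub : Z :&: pool D f i \subset
      [set a in pool D f i | alive (i |: D) (upd f i a) (jS j) (jv j) u].
    by apply/subsetP => a; rewrite in_setI => /andP[aZ ap]; rewrite in_set ap Zal.
  have := subset_leq_card sub; rewrite -(ler_nat R) => le.
  have := ler_wpM2l p0 poolP; lra.
case/setU1P: iu => [iu|].
  have PPE : PP = P (jx j) by rewrite /PP iu sw_phi // su.
  pose Y := nbh e (jv j) :&: P (bar (jx j)).
  pose bad := [set a in P (jx j) | #|nbh e a :&: Y|%:R < d * #|Y|%:R].
  have badc : #|bad|%:R <= eps * #|PP|%:R.
    rewrite PPE; apply: (reg (j_r j)); first exact: subsetIr.
    by apply: le_trans (j_nbh j); apply: ler_wpM2r.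
  exists ((jS j :\: bad) :\: f @: D); split.
  - apply/subsetP => b; rewrite !in_setD => /andP[bD /andP[_ bS]].
    have := subsetP (j_sub j) _ bS; rewrite -PPE /PP inE => bP.
    rewrite !inE bP andbT; apply/andP; split.
      apply: contra bD => /imsetP[x]; rewrite inE => /andP[xD _] ->; exact: imset_f.
    apply/forall_inP => z zD; apply/implyP => iz; exfalso.
    have := pe_key pe zD iD iB; rewrite leqNgt => /negP; apply.
    by rewrite iu; apply: sw_key => //; rewrite -iu.
  - by rewrite -setI_eq0; apply/eqP/setP => b; rewrite !inE; case: (_ \in f @: D).
  - move=> b; rewrite !in_setD => /andP[bD /andP[bbad bS]].
    rewrite /alive iu setU11 /upd eqxx bS /=; apply/andP; split.
      have bP := subsetP (j_sub j) _ bS.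
      move: bbad; rewrite inE bP /= -leNgt su -/Y; apply: le_trans.
      by rewrite expr2 -mulrA; apply: ler_wpM2l; [apply: ltW | exact: j_nbh].
    apply/forall_inP => z /setU1P[->|zD]; first by rewrite H_irr.
    case: eqP => [->|_]; first by rewrite H_irr.
    by case/andP: al => _ /forall_inP; apply.
  have c1 : (#|jS j| <= #|(jS j :\: bad) :\: f @: D| + #|bad| + #|f @: D :&: PP|)%N.
    have h1 := cardsID bad (jS j); have h2 := cardsID (f @: D) (jS j :\: bad).
    have h3 : (#|jS j :&: bad| <= #|bad|)%N by rewrite subset_leq_card // subsetIr.
    have h4 : (#|(jS j :\: bad) :&: f @: D| <= #|f @: D :&: PP|)%N.
      apply/subset_leq_card/subsetP => b; rewrite !in_setI in_setD => /andP[/andP[_ bS] ->] /=.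
      by rewrite PPE (subsetP (j_sub j)).
    by rewrite -h1 -h2 addnA [leqLHS]addnC -[leqRHS]addnA leq_add2l leq_add.
  move: c1; rewrite -(ler_nat R) !natrD => c1.
  have := j_card j; rewrite -PPE => c2.
  have := ler_wpM2r (ler0n R #|PP|) p_c0; rewrite -natr1; lra.
rewrite inE => Hui.
have PPE : PP = P (bar (jx j)) by rewrite /PP (sw_nphi uS Hui) su.
have uD : u \in D.
  by apply: contraLR (sw_key uS Hui) => uD; rewrite -leqNgt imin // sw_bf.
have ui : (u == i) = false by apply/eqP => ui; rewrite -ui uD in iD.
have [/implyP/(_ uD)/andP[fuS fud] /forall_inP alz] := andP al.
exists ((nbh e (f u) :&: (nbh e (jv j) :&: PP)) :\: f @: D); split.
- apply/subsetP => b; rewrite in_setD in_setI in_setI => /and4P[bD ub _ bP]; rewrite !inE; apply/andP; split.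
    apply/andP; split; last by move: bP; rewrite inE.
    apply: contra bD => /imsetP[x]; rewrite inE => /andP[xD _] ->; exact: imset_f.
  apply/forall_inP => z zD; apply/implyP => iz.
  rewrite (sw_alone uS Hui iz (pe_key pe zD iD iB)) e_sym.
  by rewrite inE in ub.
- by rewrite -setI_eq0; apply/eqP/setP => b; rewrite !inE; case: (_ \in f @: D).
- move=> b; rewrite in_setD in_setI in_setI => /and4P[bD _ bv _].
  rewrite /alive /upd ui setU1r // fuS fud /=.
  apply/forall_inP => z /setU1P[->|zD]; first by rewrite eqxx; rewrite inE in bv; rewrite bv implybT.
  case: eqP => [zi|_]; first by rewrite zi (negPf iD) in zD.
  exact: alz.
have c1 : (#|nbh e (f u) :&: (nbh e (jv j) :&: PP)| <=
   #|(nbh e (f u) :&: (nbh e (jv j) :&: PP)) :\: f @: D| + #|f @: D :&: PP|)%N.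
  rewrite -(cardsID (f @: D)) addnC leq_add2l.
  by apply/subset_leq_card/subsetP => b; rewrite !inE => /andP[/andP[_ /andP[_ ->]] ->].
move: c1; rewrite -(ler_nat R) natrD => c1.
move: fud; rewrite su -PPE => fud.
have := ler_wpM2r (ler0n R #|PP|) p_d; lra.
Qed.

(** Averaging over the pool. For each test at most one factor depends on the image of [i], since the
    closed neighbourhoods of swappers are disjoint, and its mean does not increase by
    [alive_count]. *)
Lemma potential_step (D : {set V}) (f : V -> T) i : partial_emb D f -> next D i ->
  (sb i < T2)%N ->
  exists2 a, a \in pool D f i & potential (i |: D) (upd f i a) <= potential D f.
Proof.
move=> pe nx sbi; have [iD iB imin] := nx.
case: (pickP (fun a => (a \in pool D f i) &&
    (potential (i |: D) (upd f i a) <= potential D f))) => [a /andP[]|no]; first by exists a.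
exfalso.
have : \sum_(a in pool D f i) potential (i |: D) (upd f i a)
    <= \sum_(a in pool D f i) potential D f.
  rewrite sumr_const /potential exchange_big /= -sumrMnl; apply: ler_sum => j _.
  case: (pickP (fun u => [&& u \in Sw, side u == jx j & i \in u |: nbh H u]))
    => [u /and3P[uS su iu]|none]; last first.
    rewrite (eq_bigr (fun=> \prod_(u in Sw | side u == jx j) factor D f (jS j) (jv j) u)).
      by rewrite sumr_const.
    move=> a _; apply: eq_bigr => u /andP[uS su]; apply: factor_far => //.
    by have := none u; rewrite uS su /= => ->.
  have usu : (u \in Sw) && (side u == jx j) by rewrite uS.
  pose rest := \prod_(u' in Sw | (side u' == jx j) && (u' != u)) factor D f (jS j) (jv j) u'.
  have restE : \prod_(u' in Sw | side u' == jx j) factor D f (jS j) (jv j) u'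
      = factor D f (jS j) (jv j) u * rest.
    by rewrite (bigD1 u usu) /rest; congr (_ * _); apply: eq_bigl => u'; rewrite andbA.
  have newE a : \prod_(u' in Sw | side u' == jx j) factor (i |: D) (upd f i a) (jS j) (jv j) u'
      = factor (i |: D) (upd f i a) (jS j) (jv j) u * rest.
    rewrite (bigD1 u usu) /rest; congr (_ * _); apply: eq_big => u'; first by rewrite andbA.
    move=> /andP[/andP[u'S _] u'u]; apply: factor_far => //.
    apply: contra u'u => /setU1P[iu'|]; case/setU1P: iu => [iu|]; rewrite ?inE.
    - by rewrite -iu' iu.
    - by move=> Hui; have := sw_ind uS u'S; rewrite -iu' Hui.
    - by move=> Hui; have := sw_ind u'S uS; rewrite -iu Hui.
    - by move=> Hui Hu'i; rewrite (sw_disj u'S uS Hu'i Hui).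
  rewrite restE; under eq_bigr do rewrite newE.
  rewrite -mulr_suml -mulrnAl; apply: ler_wpM2r.
    by apply: prodr_ge0 => u' _; exact: factor_ge0.
  rewrite /factor (rem_near iu iD).
  have [al|nal] := boolP (alive D f (jS j) (jv j) u); last first.
    rewrite mul0r subr0; have le1 a : 1 - (alive (i |: D) (upd f i a) (jS j) (jv j) u)%:R *
        (p ^+ rem (i |: D) u / 2) <= 1.
      by rewrite gerBl mulr_ge0 // divr_ge0 // exprn_ge0.
    by rewrite -sumr_const; apply: ler_sum => a _; exact: le1.
  have cnt := alive_count pe nx sbi uS (eqP su) iu al.
  rewrite sumrB sumr_const -mulr_suml.
  have -> : \sum_(a in pool D f i) (alive (i |: D) (upd f i a) (jS j) (jv j) u)%:R
     = #|[set a in pool D f i | alive (i |: D) (upd f i a) (jS j) (jv j) u]|%:R :> R.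
    rewrite -sum1_card natr_sum [LHS]big_mkcond [RHS]big_mkcond /=.
    by apply: eq_bigr => a _; rewrite inE; case: (a \in pool D f i); case: alive.
  have q0 : 0 <= p ^+ rem (i |: D) u / 2 by rewrite divr_ge0 // exprn_ge0.
  have := ler_wpM2r q0 cnt; set m := #|pool D f i|; set A := #|[set _ in _ | _]|%:R.
  rewrite mul1r exprS mulrnBl -(mulr_natl (p * _ / 2)) => le.
  rewrite lerD2l lerN2; move: le; set x := p ^+ _; lra.
apply/negP; rewrite -ltNge; apply: ltr_sum; last first.
  move=> a ap; have := no a; rewrite ap /= => /negbT; by rewrite -ltNge.
have := pool_gt0 pe nx => /card_gt0P[a ap].
by apply/hasP; exists a => //; rewrite mem_index_enum.
Qed.

Lemma potential_end (D : {set V}) (f : V -> T) j :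
  (forall u, u \in Sw -> u |: nbh H u \subset D) ->
  (1 / 2) ^+ #|[set u in Sw | [&& side u == jx j, f u \in jS j &
     [forall z, H u z ==> e (jv j) (f z)]]]| <= potential D f.
Proof.
move=> sub; rewrite /potential (bigD1 j) //= -[leLHS]addr0; apply: lerD; last first.
  by apply: sumr_ge0 => j' _; apply: prodr_ge0 => u _; exact: factor_ge0.
rewrite -prodr_const [leLHS]big_mkcond [leRHS]big_mkcond /=; apply: ler_prod => u _.
rewrite inE; have [uS|] := boolP (u \in Sw); last by rewrite ler01 lexx.
have [su|] := boolP (side u == jx j); last by rewrite ler01 lexx.
have uD : u \in D by apply: (subsetP (sub u uS)); exact: setU11.
rewrite /factor /= (_ : rem D u = 0%N); last by apply/eqP; rewrite cards_eq0 setD_eq0 sub.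
rewrite expr0; case: (boolP (alive _ _ _ _ _)) => [al|_]; last first.
  by rewrite mul0r; case: ifP => _; apply/andP; split; lra.
move: al; rewrite /alive uD /= => /andP[/andP[-> _] /forall_inP al].
have -> : [forall z, H u z ==> e (jv j) (f z)].
  apply/forallP => z; apply/implyP => uz; have := al z; rewrite uz; apply.
  by apply: (subsetP (sub u uS)); rewrite !inE uz orbT.
by rewrite /= mul1r; apply/andP; split; lra.
Qed.

Lemma potential_start (D : {set V}) (f : V -> T) (q0 : nat) :
  (forall u, u \in Sw -> [disjoint D & u |: nbh H u]) ->
  (forall j, (q0 <= #|[set u in Sw | side u == jx j]|)%N) ->
  potential D f <= #|J|%:R * (1 - p ^+ Delta.+1 / 2) ^+ q0.
Proof.
move=> dis many; rewrite -sum1_card natr_sum mulr_suml; apply: ler_sum => j _; rewrite mul1r.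
have pd : p ^+ Delta.+1 <= 1 by exact: exprn_ile1.
have pd0 : 0 <= p ^+ Delta.+1 by exact: exprn_ge0.
apply: (@le_trans _ _ (\prod_(u in Sw | side u == jx j) (1 - p ^+ Delta.+1 / 2))).
  apply: ler_prod => u /andP[uS _]; rewrite factor_ge0 /= /factor.
  have disD z : z \in D -> z \in u |: nbh H u -> False.
    by move=> zD zu; move/pred0P: (dis u uS) => /(_ z) /=; rewrite zD zu.
  have -> : alive D f (jS j) (jv j) u.
    rewrite /alive; apply/andP; split; first by apply/implyP => uD; case: (disD _ uD (setU11 _ _)).
    by apply/forall_inP => z zD; apply/implyP => uz; case: (disD _ zD); rewrite !inE uz orbT.
  have rl : (rem D u <= Delta.+1)%N.
    apply: leq_trans (subset_leq_card (subsetDl _ _)) _; rewrite cardsU1 -add1n leq_add //.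
    by case: (_ \notin _).
  rewrite mul1r; have := ler_wiXn2l p0 p1 rl; lra.
have -> : \prod_(u in Sw | side u == jx j) (1 - p ^+ Delta.+1 / 2)
        = \prod_(u in [set u in Sw | side u == jx j]) (1 - p ^+ Delta.+1 / 2).
  by apply: eq_bigl => u; rewrite inE.
by rewrite prodr_const; apply: ler_wiXn2l => //; lra.
Qed.

End Potential.

End Greedy.

(** * The reduced graph and its Ore condition *)

Section EdgeCounts.
Variables (R : realFieldType) (T : finType) (e : rel T).

Lemma edgesE (X Y : {set T}) : edges R e X Y = \sum_(x in X) #|nbh e x :&: Y|%:R.
Proof.
rewrite /edges (eq_bigl (fun p : T * T => (p.1 \in X) && (p.2 \in Y))); last first.
  by move=> p; rewrite inE.
rewrite -(pair_big (mem X) (mem Y) (fun x y => (e x y)%:R : R)) /=.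
apply: eq_bigr => x _; rewrite -sum1_card natr_sum big_mkcond [RHS]big_mkcond /=.
by apply: eq_bigr => y _; rewrite !inE andbC; case: (y \in Y); case: (e x y).
Qed.

Lemma edges_sym (X Y : {set T}) : symmetric e -> edges R e X Y = edges R e Y X.
Proof.
move=> es; have inj : injective (fun p : T * T => (p.2, p.1)) by move=> [a b] [a' b'] [-> ->].
rewrite /edges (reindex_inj inj) /=.
apply: eq_big => [p|p _]; first by rewrite !inE andbC.
by rewrite es.
Qed.

Lemma dens_sym (X Y : {set T}) : symmetric e -> dens R e X Y = dens R e Y X.
Proof. by move=> es; rewrite /dens edges_sym // [X in _ / X]mulrC. Qed.

Lemma regular_sym (eps : R) (X Y : {set T}) : symmetric e -> regular e eps X Y = regular e eps Y X.
Proof.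
move=> es.
suff imp A B : regular e eps A B -> regular e eps B A by apply/idP/idP; exact: imp.
apply: contra => /existsP[[Z1 Z2] /and5P[h1 h2 h3 h4 h5]]; apply/existsP; exists (Z2, Z1).
rewrite /irr_witness h1 h2 h3 h4 /= edges_sym // dens_sym // [#|Z2|%:R * _]mulrC; exact: h5.
Qed.

Lemma regular_dev (eps : R) (A B X Y : {set T}) : regular e eps A B ->
  X \subset A -> Y \subset B -> eps * #|A|%:R <= #|X|%:R -> eps * #|B|%:R <= #|Y|%:R ->
  `|edges R e X Y - dens R e A B * (#|X|%:R * #|Y|%:R)| <= eps * (#|X|%:R * #|Y|%:R).
Proof.
move=> /existsPn/(_ (X, Y)); rewrite /irr_witness /= => + XA YB cX cY.
by rewrite XA YB cX cY /= -leNgt.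
Qed.

Lemma regular_lower (d eps : R) (A B : {set T}) : 0 <= eps <= d ->
  regular e eps A B -> 2 * d <= dens R e A B -> lower_regular e d eps A B.
Proof.
move=> /andP[e0 ed] reg dn Y YB cY; set X := [set a in A | _]; rewrite leNgt; apply/negP => cX.
have XA : X \subset A by apply/subsetP => a; rewrite inE => /andP[].
have := regular_dev reg XA YB (ltW cX) cY; rewrite ler_norml => /andP[low _].
have [x0 x0X] : exists x0, x0 \in X.
  by apply/card_gt0P; rewrite -(ltr_nat R); apply: le_lt_trans cX; rewrite mulr_ge0.
have : edges R e X Y < \sum_(x in X) d * #|Y|%:R.
  rewrite edgesE; apply: ltr_sum => [|x]; last by rewrite inE => /andP[].
  by apply/hasP; exists x0; rewrite ?mem_index_enum.
rewrite sumr_const -[X in _ < X]mulr_natl => up.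
have xy : 0 <= #|X|%:R * #|Y|%:R :> R by rewrite mulr_ge0.
have := ler_wpM2r xy dn; have := ler_wpM2r xy ed; lra.
Qed.

Lemma regular_upper (d eps : R) (A B : {set T}) : 0 <= eps <= d -> eps <= 1 ->
  regular e eps A B -> dens R e A B < 2 * d ->
  #|[set a in A | 3 * d * #|B|%:R < #|nbh e a :&: B|%:R]|%:R <= eps * #|A|%:R.
Proof.
move=> /andP[e0 ed] e1 reg dn; set X := [set a in A | _]; rewrite leNgt; apply/negP => cX.
have XA : X \subset A by apply/subsetP => a; rewrite inE => /andP[].
have cB : eps * #|B|%:R <= #|B|%:R by rewrite ler_piMl.
have := regular_dev reg XA (subxx _) (ltW cX) cB; rewrite ler_norml => /andP[_ up].
have [x0 x0X] : exists x0, x0 \in X.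
  by apply/card_gt0P; rewrite -(ltr_nat R); apply: le_lt_trans cX; rewrite mulr_ge0.
have : \sum_(x in X) 3 * d * #|B|%:R < edges R e X B.
  rewrite edgesE; apply: ltr_sum => [|x]; last by rewrite inE => /andP[].
  by apply/hasP; exists x0; rewrite ?mem_index_enum.
rewrite sumr_const -[X in X < _]mulr_natl => low.
have xy : 0 <= #|X|%:R * #|B|%:R :> R by rewrite mulr_ge0.
have := ler_wpM2r xy (ltW dn); have := ler_wpM2r xy ed; lra.
Qed.

End EdgeCounts.

Section Reduced.
Variables (R : realFieldType) (T L : finType) (e : rel T) (c : T -> L).
Variables (gamma d eps theta lam : R).
Let n : R := #|T|%:R.
Let P i := cls c i.

Hypotheses (e_sym : symmetric e) (e_irr : irreflexive e).
Hypothesis ore : forall x y, x != y -> ~~ e x y ->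
  (1 + gamma) * n <= #|nbh e x|%:R + #|nbh e y|%:R.
Hypothesis irr_le : (irr_weight e eps c)%:R <= eps * (n * n).
Hypotheses (g0 : 0 < gamma) (g1 : gamma <= 1 / 2) (eps0 : 0 <= eps) (eps_d : eps <= d)
  (d_small : d <= gamma / 48) (th0 : 0 < theta) (th_small : theta <= gamma / 48)
  (lam0 : 0 <= lam) (lam_K : 2 * eps + #|L|%:R * lam <= theta ^+ 2) (lam_n : 8 <= lam * n).

Definition irregular i j := ~~ regular e eps (P i) (P j).
Definition big i := lam * n <= #|P i|%:R.
(** The ways in which neighbours of [x] in the cluster of [y] may escape the reduced graph: an
    irregular pair, a small cluster, or a sparse regular pair in which [x] has exceptionally large
    degree. *)
Definition bad_pair (x y : T) := [|| irregular (c x) (c y), ~~ big (c y) |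
  [&& ~~ irregular (c x) (c y), dens R e (P (c x)) (P (c y)) < 2 * d &
      3 * d * #|P (c y)|%:R < #|nbh e x :&: P (c y)|%:R]].
Definition exceptional : {set T} := [set x | theta * n < #|[set y | bad_pair x y]|%:R].
Definition good i := big i && (2 * #|P i :&: exceptional|%:R <= #|P i|%:R :> R).
Definition red i j := [&& ~~ irregular i j, 2 * d <= dens R e (P i) (P j), good i & good j].
Definition wdeg i : R := #|[set y | red i (c y)]|%:R.

Lemma vertices_gt0 : 0 < n.
Proof.
rewrite lt0r ler0n andbT; apply: contraTneq lam_n => ->.
by rewrite mulr0 -ltNge.
Qed.

Lemma th1 : theta <= 1. Proof. have := g1; have := th_small; lra. Qed.

Lemma sum_cls (p : pred L) : (#|[set x | p (c x)]| = \sum_(i | p i) #|P i|)%N.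
Proof.
rewrite -sum1_card (partition_big c p) /=; last by move=> x; rewrite inE.
apply: eq_bigr => i pi; rewrite sum1dep_card; apply: eq_card => x; rewrite !inE.
by case: eqP => [->|]; rewrite ?pi ?andbF.
Qed.

Lemma small_card (p : pred L) (b : R) : (forall i, p i -> #|P i|%:R <= b) -> 0 <= b ->
  #|[set x | p (c x)]|%:R <= #|L|%:R * b.
Proof.
move=> pb b0; rewrite sum_cls natr_sum; apply: (@le_trans _ _ (\sum_(i | p i) b)).
  exact: ler_sum.
by rewrite sumr_const -[leLHS]mulr_natl; apply: ler_wpM2r; rewrite ?ler_nat ?max_card.
Qed.

(** Irregular pairs contribute [eps], small clusters [#|L| * lam], and atypical vertices of sparse
    regular pairs another [eps]. The square in [theta ^+ 2] is spent by Markov's inequality in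
    [exceptional_card]. *)
Lemma bad_pair_card : #|[set p | bad_pair p.1 p.2]|%:R <= theta ^+ 2 * (n * n).
Proof.
have e1 : eps <= 1 by have := eps_d; have := d_small; have := g1; lra.
pose S1 := [set p : T * T | irregular (c p.1) (c p.2)].
pose S2 := [set p : T * T | ~~ big (c p.2)].
pose up i x := [&& ~~ irregular (c x) i, dens R e (P (c x)) (P i) < 2 * d &
      3 * d * #|P i|%:R < #|nbh e x :&: P i|%:R].
pose S3 := [set p : T * T | up (c p.2) p.1].
have sub : [set p | bad_pair p.1 p.2] \subset S1 :|: S2 :|: S3.
  by apply/subsetP => p; rewrite !inE /up => /or3P[] ->; rewrite ?orbT.
have h1 : #|S1|%:R <= eps * (n * n) by exact: irr_le.
have h2 : #|S2|%:R <= #|L|%:R * lam * (n * n).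
  have -> : S2 = setX setT [set y | ~~ big (c y)] by apply/setP => p; rewrite !inE.
  rewrite cardsX cardsT natrM (_ : _ * (n * n) = n * (#|L|%:R * (lam * n))); last by ring.
  apply: ler_wpM2l => //; apply: (small_card (p := fun i => ~~ big i)); last by rewrite mulr_ge0.
  by move=> i; rewrite -ltNge => /ltW.
have h3 : #|S3|%:R <= eps * (n * n).
  have col i : #|[set x | up i x]|%:R <= eps * n.
    rewrite (_ : [set x | up i x] = \bigcup_(j : L) [set x in P j | up i x]); last first.
      apply/setP => x; apply/idP/bigcupP => [h|[j _]]; last by rewrite !inE => /andP[].
      by exists (c x) => //; rewrite !inE eqxx /=; rewrite inE in h.
    apply: (@le_trans _ _ (\sum_(j : L) #|[set x in P j | up i x]|%:R)).
      rewrite -natr_sum ler_nat; elim/big_rec2: _ => [|j k B _ le]; first by rewrite cards0.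
      by apply: leq_trans (leq_card_setU _ _).1 _; rewrite leq_add2l.
    apply: (@le_trans _ _ (\sum_(j : L) eps * #|P j|%:R)); last first.
      rewrite -mulr_sumr ler_wpM2l // /n -natr_sum -(sum_cls predT) ler_nat; exact: max_card.
    apply: ler_sum => j _.
    case: (boolP (~~ irregular j i && (dens R e (P j) (P i) < 2 * d))) => [/andP[reg dn]|h].
      rewrite negbK in reg; apply: le_trans (regular_upper _ e1 reg dn); last by rewrite eps0.
      rewrite ler_nat; apply/subset_leq_card/subsetP => x; rewrite !inE => /andP[/eqP -> /and3P[_ _ ->]].
      by rewrite eqxx.
    rewrite (_ : [set x in P j | up i x] = set0) ?cards0 ?mulr_ge0 //.
    apply/setP => x; rewrite !inE; apply/negP => /andP[/eqP cx /and3P[u1 u2 _]].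
    by case/negP: h; rewrite -cx u1.
  have -> : #|S3|%:R = \sum_y #|[set x | up (c y) x]|%:R :> R.
    rewrite -natr_sum; congr (_%:R); rewrite -sum1_card (partition_big snd predT) //=.
    apply: eq_bigr => y _; rewrite sum1dep_card -(card_imset [set x | up (c y) x] (f := fun x => (x, y))).
      apply: eq_card => -[x y']; rewrite !inE /=; apply/andP/imsetP.
        by case=> h /eqP yy; exists x; rewrite ?inE -?yy.
      by case=> x'; rewrite inE => h [-> ->]; rewrite eqxx.
    by move=> x x' [].
  apply: (@le_trans _ _ (\sum_(y : T) eps * n)); first by apply: ler_sum => y _; exact: col.
  by rewrite sumr_const -[leLHS]mulr_natl mulrCA.
have := subset_leq_card sub; have u1 := (leq_card_setU (S1 :|: S2) S3).1.
have u2 := (leq_card_setU S1 S2).1; move: u1 u2; rewrite -!(ler_nat R) !natrD => u1 u2 u3.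
have nn : 0 <= n * n by rewrite mulr_ge0.
have := ler_wpM2r nn lam_K; lra.
Qed.

Lemma exceptional_card : #|exceptional|%:R <= theta * n.
Proof.
have pos : 0 < theta * n by rewrite mulr_gt0 // vertices_gt0.
rewrite -(ler_pM2r pos).
apply: (@le_trans _ _ #|[set p | bad_pair p.1 p.2]|%:R); last first.
  by apply: le_trans bad_pair_card _; rewrite expr2 mulrACA.
rewrite -[leRHS](_ : \sum_x #|[set y | bad_pair x y]|%:R = _); last first.
  rewrite -natr_sum; congr (_%:R); rewrite -[RHS]sum1_card (partition_big fst predT) //=.
  apply: eq_bigr => x _; rewrite sum1dep_card -(card_imset [set y | bad_pair x y] (f := fun y => (x, y))).
    apply: eq_card => -[x' y]; rewrite !inE /=; apply/imsetP/andP.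
      by case=> y'; rewrite inE => h [-> ->]; rewrite eqxx.
    by case=> h /eqP xx; exists y; rewrite ?inE -?xx.
  by move=> y y' [].
rewrite [leRHS](bigID (mem exceptional)) /= -[leLHS]addr0 lerD ?sumr_ge0 //.
rewrite mulr_natl -sumr_const; apply: ler_sum => x; by rewrite inE => /ltW.
Qed.

Lemma not_good_card : #|[set x | ~~ good (c x)]|%:R <= 3 * theta * n.
Proof.
pose S1 := [set x | ~~ big (c x)].
pose b i := #|P i|%:R < 2 * #|P i :&: exceptional|%:R :> R.
pose S2 := [set x | b (c x)].
have sub : [set x | ~~ good (c x)] \subset S1 :|: S2.
  apply/subsetP => x; rewrite !inE /good negb_and => /orP[->//|].
  by rewrite -ltNge /b => ->; rewrite orbT.
have h1 : #|S1|%:R <= #|L|%:R * (lam * n).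
  by apply: (small_card (p := fun i => ~~ big i)) => [i|]; rewrite ?mulr_ge0 // -ltNge => /ltW.
have h2 : #|S2|%:R <= 2 * (theta * n).
  apply: le_trans (ler_wpM2l _ exceptional_card) => //.
  rewrite sum_cls natr_sum (_ : #|exceptional| = \sum_(i : L) #|P i :&: exceptional|)%N.
    rewrite natr_sum mulr_sumr [leRHS](bigID b) /= -[leLHS]addr0 lerD //.
      by apply: ler_sum => i /ltW.
    by apply: sumr_ge0 => i _; rewrite mulr_ge0.
  rewrite -sum1_card (partition_big c predT) //=; apply: eq_bigr => i _.
  by rewrite sum1dep_card; apply: eq_card => x; rewrite !inE andbC.
have h3 : #|L|%:R * (lam * n) <= theta * n.
  rewrite mulrA ler_wpM2r //.
  have : theta ^+ 2 <= theta by rewrite expr2 ler_piMl ?(ltW th0) // th1.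
  have := lam_K; have := eps0; lra.
have := subset_leq_card sub; have u1 := (leq_card_setU S1 S2).1.
move: u1; rewrite -!(ler_nat R) natrD; lra.
Qed.

Lemma red_sym : symmetric red.
Proof. by move=> i j; rewrite /red /irregular regular_sym // dens_sym // [good i && _]andbC. Qed.

Lemma red_good i j : red i j -> good i && good j.
Proof. by case/and4P => _ _ -> ->. Qed.

Lemma red_lower i j : red i j -> lower_regular e d eps (P i) (P j).
Proof.
case/and4P; rewrite negbK => reg dn _ _; apply: regular_lower => //.
by rewrite eps0.
Qed.

Lemma good_big i : good i -> lam * n <= #|P i|%:R.
Proof. by case/andP. Qed.

Lemma good_typical i : good i -> #|P i|%:R <= 2 * #|P i :\: exceptional|%:R :> R.
Proof.
case/andP => _; have := cardsID exceptional (P i); move/(congr1 (fun m => m%:R : R)).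
by rewrite natrD; lra.
Qed.

Lemma P_gt8 i : good i -> 8 <= #|P i|%:R :> R.
Proof. by move/good_big; apply: le_trans. Qed.

Lemma typical_exists i : good i -> exists2 x, c x = i & x \notin exceptional.
Proof.
move=> gi; have : (0 < #|P i :\: exceptional|)%N.
  rewrite -(ltr_nat R); have := good_typical gi; have := P_gt8 gi; lra.
by case/card_gt0P => x; rewrite in_setD => /andP[xe]; rewrite inE => /eqP cx; exists x.
Qed.

Lemma irregular_card i : good i -> #|[set y | irregular i (c y)]|%:R <= theta * n.
Proof.
case/typical_exists => x cx; rewrite inE -leNgt; apply: le_trans.
by rewrite ler_nat; apply/subset_leq_card/subsetP => y; rewrite !inE /bad_pair cx => ->.
Qed.

(** Neighbours not counted by [wdeg] lie in clusters that are not good ([3 * theta]), form bad pairs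
    with [x] ([theta]), or lie in sparse pairs where [x] has normal degree ([3 * d]). *)
Lemma nbh_le_wdeg x : good (c x) -> x \notin exceptional ->
  #|nbh e x|%:R <= wdeg (c x) + (4 * theta + 3 * d) * n.
Proof.
move=> gx; rewrite inE -leNgt => bx.
pose low i := [&& ~~ irregular (c x) i, dens R e (P (c x)) (P i) < 2 * d &
      #|nbh e x :&: P i|%:R <= 3 * d * #|P i|%:R].
pose S := [set y | e x y && low (c y)].
have sub : nbh e x \subset [set y | red (c x) (c y)] :|: [set y | ~~ good (c y)] :|:
     [set y | bad_pair x y] :|: S.
  apply/subsetP => y; rewrite !inE => xy; rewrite /red gx /bad_pair /low xy.
  case: (good (c y)); rewrite ?orbT //= !andbT orbF.
  case: (irregular (c x) (c y)) => //=; case: (ltP (dens R e _ _)) => //=.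
  by case: (leP #|nbh e x :&: P (c y)|%:R) => //= _; rewrite ?orbT.
have hS : #|S|%:R <= 3 * d * n.
  apply: (@le_trans _ _ (\sum_(i | low i) #|nbh e x :&: P i|%:R)).
    rewrite -natr_sum ler_nat -sum1_card (partition_big c low) /=; last first.
      by move=> y; rewrite inE => /andP[].
    apply: leq_sum => i _; rewrite sum1dep_card; apply/subset_leq_card/subsetP => y.
    by rewrite !inE => /andP[/andP[-> _] ->].
  apply: (@le_trans _ _ (\sum_(i | low i) 3 * d * #|P i|%:R)).
    by apply: ler_sum => i /and3P[].
  rewrite -mulr_sumr ler_wpM2l //; last first.
    by rewrite -natr_sum -sum_cls ler_nat max_card.
  by rewrite mulr_ge0 // (le_trans eps0).
have := subset_leq_card sub.
have u1 := (leq_card_setU ([set y | red (c x) (c y)] :|: [set y | ~~ good (c y)] :|: [set y | bad_pair x y]) S).1.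
have u2 := (leq_card_setU ([set y | red (c x) (c y)] :|: [set y | ~~ good (c y)]) [set y | bad_pair x y]).1.
have u3 := (leq_card_setU [set y | red (c x) (c y)] [set y | ~~ good (c y)]).1.
move: u1 u2 u3; rewrite -!(ler_nat R) !natrD /wdeg => u1 u2 u3 u4.
have := not_good_card; lra.
Qed.

(** A non-neighbour of [x] has degree at most [n], so Ore's condition leaves [gamma * n] for [x]; a
    vertex without non-neighbours has degree [n - 1]. *)
Lemma min_degree x : gamma * n <= #|nbh e x|%:R.
Proof.
case: (pickP (fun y => (x != y) && ~~ e x y)) => [y /andP[xy nxy]|all].
  have := ore xy nxy; have : #|nbh e y|%:R <= n by rewrite ler_nat max_card.
  lra.
have : (#|T| <= #|nbh e x| + 1)%N.
  rewrite -(cardC (mem (nbh e x))) leq_add2l -(cards1 x); apply/subset_leq_card/subsetP => y.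
  by rewrite !inE; have := all y; rewrite eq_sym; case: eqP => //= _ /negbFE ->.
rewrite -(ler_nat R) natrD -/n; have n8 : 2 <= n.
  have : lam <= 1.
    have L0 : 1 <= #|L|%:R :> R.
      rewrite ler1n; apply/card_gt0P; exists (c x); by rewrite inE.
    have := ler_wpM2r lam0 L0; have := lam_K; have := eps0.
    have : theta ^+ 2 <= 1 by apply: exprn_ile1; [exact: ltW | exact: th1].
    lra.
  have := lam_n; have := vertices_gt0; nra.
have := ler_wpM2r (ltW vertices_gt0) g1; lra.
Qed.

Lemma wdeg_min i : good i -> gamma / 2 * n <= wdeg i.
Proof.
move=> gi; have [x cx xe] := typical_exists gi; rewrite -cx in gi *.
have := nbh_le_wdeg gi xe; have := min_degree x.
have h : 4 * theta + 3 * d <= gamma / 2 by have := th_small; have := d_small; have := g0; lra.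
have := ler_wpM2r (ltW vertices_gt0) h; lra.
Qed.

(** A regular non-edge has density below [2 * d]. If all typical vertices of the two clusters were
    adjacent, the density would be near [1 / 4] or more, up to the diagonal when [i = j]. So some
    typical [x] and [y] are distinct and non-adjacent, and their Ore condition transfers through
    [nbh_le_wdeg]. *)
Lemma wdeg_ore i j : good i -> good j -> ~~ red i j -> ~~ irregular i j ->
  (1 + gamma / 2) * n <= wdeg i + wdeg j.
Proof.
move=> gi gj nr reg.
have dn : dens R e (P i) (P j) < 2 * d.
  by rewrite ltNge; apply: contra nr => dn; rewrite /red reg dn gi.
case: (pickP (fun p : T * T => [&& p.1 \in P i :\: exceptional, p.2 \in P j :\: exceptional,
    p.1 != p.2 & ~~ e p.1 p.2])) => [[x y] /=|none].
  rewrite !in_setD ![_ \in P _]in_set => /and4P[/andP[xe /eqP cx] /andP[ye /eqP cy] xy nxy].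
  rewrite -cx -cy in gi gj *; have := ore xy nxy.
  have := nbh_le_wdeg gi xe; have := nbh_le_wdeg gj ye.
  have h : 2 * (4 * theta + 3 * d) <= gamma / 2.
    have := th_small; have := d_small; have := g0; lra.
  have := ler_wpM2r (ltW vertices_gt0) h; lra.
exfalso.
have pi := P_gt8 gi; have pj := P_gt8 gj.
have ti := good_typical gi; have tj := good_typical gj.
set a := #|P i|%:R in pi ti; set b := #|P j|%:R in pj tj.
have many : #|P i :\: exceptional|%:R * #|P j :\: exceptional|%:R - a <= edges R e (P i) (P j).
  have sub : setX (P i :\: exceptional) (P j :\: exceptional) \subset
     [set p in setX (P i) (P j) | e p.1 p.2] :|: [set (x, x) | x in P i].
    apply/subsetP => -[x y]; rewrite in_setX => /andP[xi yj].
    have := none (x, y); rewrite /= xi yj /= => h.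
    have xP : x \in P i by move: xi; rewrite inE => /andP[].
    have yP : y \in P j by move: yj; rewrite inE => /andP[].
    rewrite in_setU in_set in_setX xP yP /=; case: (boolP (e x y)) => //= nxy.
    move: h; rewrite nxy andbT => /negbFE/eqP <-; by apply: imset_f.
  have := subset_leq_card sub; rewrite cardsX.
  have := leq_trans (subset_leq_card sub) (leq_card_setU _ _).1; rewrite cardsX => h _.
  have := leq_imset_card (fun x => (x, x)) (mem (P i)) => h2.
  have := leq_trans h (leq_add (leqnn _) h2).
  rewrite -(ler_nat R) natrM natrD -/a -lerBlDr => h3; apply: le_trans h3 _.
  rewrite /edges -sum1_card natr_sum big_mkcond [leRHS]big_mkcond /=.
  by apply: ler_sum => p _; rewrite in_set; case: (p \in _) => //=; case: (e _ _).
have ab : 0 < a * b by rewrite mulr_gt0; lra.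
have few : edges R e (P i) (P j) <= 2 * d * (a * b).
  move: dn; rewrite /dens -/a -/b ltr_pdivrMr //; exact: ltW.
have : a * b <= 4 * (#|P i :\: exceptional|%:R * #|P j :\: exceptional|%:R).
  have a0 : 0 <= a by lra. have b0 : 0 <= b by lra.
  have := ler_pM a0 b0 ti tj; lra.
have d16 : d <= 1 / 96 by have := d_small; have := g1; lra.
have := ler_wpM2r (ltW ab) d16.
have : 8 * a <= a * b by rewrite mulrC ler_wpM2l //; lra.
lra.
Qed.

Lemma dense_clusters v :
  (gamma / 2) * n <= #|[set y | good (c y) && (d * #|P (c y)|%:R <= #|nbh e v :&: P (c y)|%:R)]|%:R.
Proof.
pose dn i := d * #|P i|%:R <= #|nbh e v :&: P i|%:R.
pose S := [set y | e v y && ~~ dn (c y)].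
have sub : nbh e v \subset [set y | good (c y) && dn (c y)] :|: [set y | ~~ good (c y)] :|: S.
  apply/subsetP => y; rewrite !inE => vy; rewrite vy; by case: (good _); case: (dn _).
have hS : #|S|%:R <= d * n.
  apply: (@le_trans _ _ (\sum_(i | ~~ dn i) #|nbh e v :&: P i|%:R)).
    rewrite -natr_sum ler_nat -sum1_card (partition_big c (fun i => ~~ dn i)) /=; last first.
      by move=> y; rewrite inE => /andP[].
    apply: leq_sum => i _; rewrite sum1dep_card; apply/subset_leq_card/subsetP => y.
    by rewrite !inE => /andP[/andP[-> _] ->].
  apply: (@le_trans _ _ (\sum_(i | ~~ dn i) d * #|P i|%:R)).
    by apply: ler_sum => i; rewrite -ltNge => /ltW.
  rewrite -mulr_sumr ler_wpM2l //; first by rewrite (le_trans eps0).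
  by rewrite -natr_sum -sum_cls ler_nat max_card.
have := subset_leq_card sub.
have u1 := (leq_card_setU ([set y | good (c y) && dn (c y)] :|: [set y | ~~ good (c y)]) S).1.
have u2 := (leq_card_setU [set y | good (c y) && dn (c y)] [set y | ~~ good (c y)]).1.
move: u1 u2; rewrite -!(ler_nat R) !natrD => u1 u2 u3.
have := not_good_card; have := min_degree v.
have h : 3 * theta + d <= gamma / 2 by have := th_small; have := d_small; have := g0; lra.
have := ler_wpM2r (ltW vertices_gt0) h; rewrite /dn in u1 u2 u3 *; lra.
Qed.

End Reduced.

(** * Absorbing the leftover vertices *)

Section Absorb.
Variables (R : realFieldType) (T V L U : finType) (e : rel T) (H : rel V).
Variables (c : T -> L) (r irr : rel L) (cl : U -> L) (bar : U -> U) (side : V -> U).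
Variables (Bf Sw : {set V}) (C : V -> {set T}) (f : V -> T) (d : R) (m0 del iota : nat).

Let P x := cls c (cl x).

Definition dense (v : T) (x : U) := d * #|P x|%:R <= #|nbh e v :&: P x|%:R.

Definition sees (v : T) (u : V) := [forall z, H u z ==> e v (f z)].

Definition udeg (x : U) := #|[set y | r (cl x) (cl y)]|.

Hypotheses (e_sym : symmetric e) (H_sym : symmetric H) (r_sym : symmetric r).
Hypotheses (f_inj : {in ~: Bf &, injective f})
  (f_edge : forall x y, x \notin Bf -> y \notin Bf -> H x y -> e (f x) (f y)).
Hypotheses (cardTV : #|T| = #|V|) (BfSw : [disjoint Bf & Sw])
  (ind : forall x y, x \in Bf :|: Sw -> y \in Bf :|: Sw -> ~~ H x y).
Hypothesis C_sees : forall b a, b \in Bf -> a \in C b -> sees a b.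
Hypothesis barK : involutive bar.
(** Swappers of this kind make goodness spread from side to side; those of [many_C] give the buffers
    of a violating set their many neighbours. *)
Hypothesis many_typ : forall x y v, r (cl x) (cl y) -> dense v (bar x) ->
  (m0 <= #|[set u in Sw | [&& side u == x, (f u \in P x) && dense (f u) y & sees v u]]|)%N.
Hypothesis many_C : forall b v, b \in Bf -> dense v (bar (side b)) ->
  (m0 <= #|[set u in Sw | [&& side u == side b, f u \in C b & sees v u]]|)%N.
Hypotheses (few_side : forall x, (#|[set b in Bf | side b == x]| <= m0)%N)
  (few : (#|Bf| <= del * m0)%N).
Hypotheses
  (ore : forall x y, ~~ r (cl x) (cl y) -> ~~ irr (cl x) (cl y) ->
     (#|U| + del <= udeg x + udeg y)%N)
  (udeg_min : forall x, (del + iota < udeg x)%N)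
  (irr_few : forall x, (#|[set y | irr (cl x) (cl y)]| <= iota)%N)
  (dense_many : forall v, (del <= #|[set x | dense v x]|)%N).

Let BS := Bf :|: Sw.
Let A0 := ~: (f @: ~: BS).
Let g x a := (a \in A0) && sees a x.

Lemma sw_nbf u : u \in Sw -> u \notin Bf.
Proof.
by move=> uS; apply/negP => uB; move/pred0P: BfSw => /(_ u) /=; rewrite uS uB.
Qed.

Lemma f_sw_A0 u : u \in Sw -> f u \in A0.
Proof.
move=> uS; rewrite inE; apply/negP => /imsetP[x]; rewrite !inE negb_or => /andP[xB xS] E.
have ux : u = x by apply: f_inj E; rewrite inE // sw_nbf.
by rewrite -ux uS in xS.
Qed.

Lemma f_sw_sees u : u \in Sw -> sees (f u) u.
Proof.
move=> uS; apply/forallP => z; apply/implyP => uz; apply: f_edge => //; first exact: sw_nbf.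
apply/negP => zB; have := ind (x := u) (y := z); rewrite !inE uS zB orbT => /(_ isT isT).
by rewrite uz.
Qed.

(* [Z] consists of the neighbours of the violating set [X] which are not images of swappers in
   [X].  A side is good if swappers outside [X] still provide typical images on it; goodness
   spreads along the steps [x -> y] with [r (cl x) (cl (bar y))]. *)
Section Violation.
Variable X : {set V}.
Hypotheses (XBS : X \subset BS) (viol : (#|nbhs g X| < #|X|)%N).

Let G := nbhs g X.
Let Z := G :\: f @: (X :&: Sw).
Let fS x := f @: [set u in Sw | side u == x].

Lemma im_sub_G : f @: (X :&: Sw) \subset G.
Proof.
apply/subsetP => a /imsetP[u]; rewrite inE => /andP[uX uS] ->.
by rewrite inE; apply/exists_inP; exists u => //; rewrite /g f_sw_A0 // f_sw_sees.
Qed.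

(** Each swapper of [X] has its own image as a neighbour, so these images compensate the swappers
    exactly, and the deficiency falls on the buffers. *)
Lemma card_Z : (#|Z| < #|X :&: Bf|)%N.
Proof.
have c1 : #|f @: (X :&: Sw)| = #|X :&: Sw|.
  apply: card_in_imset => x y; rewrite !inE => /andP[_ xS] /andP[_ yS].
  by apply: f_inj; rewrite !inE sw_nbf.
have c2 : #|X| = (#|X :&: Bf| + #|X :&: Sw|)%N.
  rewrite -{1}(setIidPl XBS) setIUr cardsU.
  by rewrite -setIIr (disjoint_setI0 BfSw) setI0 cards0 subn0.
have c3 := cardsID (f @: (X :&: Sw)) G; move: viol.
rewrite -/G -c3 (setIidPr im_sub_G) c1 c2 -/Z; lia.
Qed.

Lemma out_X a u : a \in A0 -> a \notin G -> sees a u -> u \notin X.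
Proof.
move=> aA aG au; apply/negP => uX; move: aG; rewrite inE => /negP; apply.
by apply/exists_inP; exists u => //; rewrite /g aA.
Qed.

Lemma sum_fS (Y : {set U}) : (\sum_(x in Y) #|Z :&: fS x| <= #|Z|)%N.
Proof.
have -> : (\sum_(x in Y) #|Z :&: fS x| = \sum_(x in Y) \sum_(a in Z) (a \in fS x))%N.
  apply: eq_bigr => x _; rewrite -sum1_card big_mkcond [RHS]big_mkcond /=.
  by apply: eq_bigr => a _; rewrite inE; case: (a \in Z); case: (a \in fS x).
rewrite exchange_big /= -sum1_card; apply: leq_sum => a _.
rewrite -big_mkcondr /= sum1_card; apply/card_le1_eqP => x y.
rewrite !unfold_in => /andP[_ /imsetP[u]]; rewrite !inE => /andP[uS /eqP <-] -> /andP[_ /imsetP[u']].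
rewrite !inE => /andP[uS' /eqP <-] E.
by have -> : u = u' by apply: f_inj E; rewrite inE sw_nbf.
Qed.

(** The sides heavily hit by [Z]. There are few, since the images on different sides are disjoint
    and [Z] is smaller than the set of buffers. *)
Let Del := [set x | (m0 <= #|Z :&: fS x|)%N].

Lemma m0_gt0 : (0 < m0)%N.
Proof.
rewrite lt0n; apply: contraTneq card_Z => z; rewrite -leqNgt.
by move: few; rewrite z muln0 leqn0 cards_eq0 => /eqP ->; rewrite setI0 cards0.
Qed.

Lemma card_Del : (#|Del| < del)%N.
Proof.
rewrite -(ltn_pmul2r m0_gt0); apply: leq_ltn_trans (leq_trans card_Z _); last first.
  by apply: leq_trans few; rewrite subset_leq_card // subsetIr.
rewrite -sum_nat_const; apply: leq_trans (sum_fS Del); apply: leq_sum => x.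
by rewrite inE.
Qed.

Definition good_side x := [forall y, r (cl x) (cl y) ==>
  (m0 <= #|[set u in Sw :\: X | [&& side u == x, f u \in P x & dense (f u) y]]|)%N].

(** A target outside [G] cannot receive any member of [X]. So all the swappers that could move to
    [a], which [many_typ] supplies in number, lie outside [X]. *)
Lemma good_of_dense a x : a \in A0 -> a \notin G -> dense a (bar x) -> good_side x.
Proof.
move=> aA aG ad; apply/forallP => y; apply/implyP => rxy.
apply: leq_trans (many_typ rxy ad) _; apply/subset_leq_card/subsetP => u.
rewrite 2!inE => /and4P[uS -> /andP[-> ->] au].
by rewrite inE uS andbT (out_X aA aG au).
Qed.

Lemma hit_Z u : u \in Sw -> u \notin X -> f u \in G -> f u \in Z.
Proof.
move=> uS uX uG; rewrite inE uG andbT; apply/negP => /imsetP[u'].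
rewrite inE => /andP[uX' uS'] E; move: uX'.
have <- : u = u' by apply: f_inj E; rewrite inE sw_nbf.
by rewrite (negPf uX).
Qed.

(** If the images of the typical swappers outside [X] were all in [G], they would all be in [Z], and
    [x] would be in [Del]. *)
Lemma dense_of_good x y : good_side x -> x \notin Del -> r (cl x) (cl y) ->
  exists a, [/\ a \in A0, a \notin G & dense a y].
Proof.
move=> /forallP/(_ y)/implyP gx xD rxy; move: (gx rxy) => {gx}.
set W := [set u in _ | _] => mW.
case: (pickP (fun u => (u \in W) && (f u \notin G))) => [u /andP[uW uG]|none].
  move: uW; rewrite !in_set => /and4P[/andP[_ uS] _ _ ud].
  by exists (f u); split => //; exact: f_sw_A0.
case/negP: xD; rewrite inE; apply: leq_trans mW _.
rewrite -(card_in_imset (f := f) (D := W)); last first.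
  move=> u u'; rewrite !inE => /andP[/andP[_ uS] _] /andP[/andP[_ uS'] _].
  by apply: f_inj; rewrite inE sw_nbf.
apply/subset_leq_card/subsetP => a /imsetP[u uW ->].
have := none u; rewrite uW /= => /negbFE uG.
have uW' := uW; rewrite in_set in_setD in uW'; case/and4P: uW' => /andP[uX uS] su _ _.
by rewrite in_setI hit_Z //=; apply: imset_f; rewrite inE uS.
Qed.

Lemma good_step x y : good_side x -> x \notin Del -> r (cl x) (cl (bar y)) -> good_side y.
Proof.
by move=> gx xD /(dense_of_good gx xD)[a [aA aG ad]]; exact: good_of_dense aA aG ad.
Qed.

Lemma left_over : exists2 a, a \in A0 & a \notin G.
Proof.
pose Lo := ~: (f @: ~: Bf).
have cL : #|Lo| = #|Bf|.
  have := cardsC (f @: ~: Bf); rewrite (card_in_imset f_inj) cardTV -(cardsC Bf); rewrite -/Lo; lia.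
have LA : Lo \subset A0.
  by rewrite setCS; apply: imsetS; rewrite setCS subsetUl.
case: (boolP (Lo \subset G)) => [LG|/subsetPn[a aL aG]]; last first.
  by exists a => //; exact: (subsetP LA).
have LZ : Lo \subset Z.
  apply/subsetP => a aL; rewrite inE (subsetP LG) // andbT.
  apply/negP => /imsetP[u]; rewrite inE => /andP[_ uS] E; move: aL; rewrite E inE => /negP; apply.
  by apply: imset_f; rewrite inE sw_nbf.
have := leq_ltn_trans (subset_leq_card LZ) card_Z.
by rewrite cL ltnNge subset_leq_card // subsetIr.
Qed.

Let Gd := [set x | good_side x].

Lemma bar_inj : injective bar. Proof. exact: can_inj barK. Qed.

(** A leftover vertex makes some side [x0] outside [Del] good, and then the partners of all
    neighbours of [x0] are good. For a bad [y], no neighbour of [bar y] is good and outside [Del],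
    so the degrees of [x0] and [bar y] sum to less than [#|U| + del]. By [ore] the pair is
    irregular, which leaves at most [iota] such [y]. *)
Lemma few_bad : (#|~: Gd| <= iota)%N.
Proof.
have [v vA vG] := left_over.
have [x0 x0d x0D] : exists2 x0, dense v (bar x0) & x0 \notin Del.
  case: (boolP ([set x | dense v x] \subset bar @: Del)) => [sub|/subsetPn[x]].
    have := leq_trans (dense_many v) (subset_leq_card sub).
    by rewrite card_imset; [rewrite leqNgt card_Del | exact: bar_inj].
  rewrite inE => xd xD; exists (bar x); first by rewrite barK.
  by apply: contra xD => xD; rewrite -(barK x) imset_f.
have gx0 := good_of_dense vA vG x0d.
have dx0 : (udeg x0 <= #|Gd|)%N.
  rewrite -(card_imset _ bar_inj); apply/subset_leq_card/subsetP => y; rewrite inE => ry.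
  rewrite -(barK y) imset_f // inE; apply: good_step gx0 x0D _.
  by rewrite barK.
rewrite -(card_imset _ bar_inj); apply: leq_trans (irr_few x0).
apply/subset_leq_card/subsetP => y' /imsetP[y]; rewrite !inE => yG ->{y'}.
apply/negPn/negP => nirr.
have nr : ~~ r (cl x0) (cl (bar y)) by apply: contra yG; exact: good_step.
have dy : (udeg (bar y) <= #|~: (Gd :\: Del)|)%N.
  apply/subset_leq_card/subsetP => z rz; rewrite in_set in rz.
  rewrite in_setC in_setD; apply: contra yG => /andP[zD zG]; rewrite in_set in zG.
  by apply: (good_step zG zD); rewrite r_sym.
have := ore nr nirr; have := cardsC (Gd :\: Del); have := card_Del.
have := cardsID Del Gd; have := subset_leq_card (subsetIr Gd Del); lia.
Qed.

(** For every buffer [b] in [X], the unit matched to its own has a neighbour which is good and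
    outside [Del]; through it [b] acquires [m0] neighbours in [Z] on its own side. A side holds at
    most [m0] buffers, so summing over sides makes [Z] too large. *)
Lemma violation_absurd : False.
Proof.
have key b : b \in X :&: Bf -> (m0 <= #|Z :&: fS (side b)|)%N.
  rewrite inE => /andP[bX bB]; set x := side b.
  have [y [yr yG yD]] : exists y, [/\ r (cl (bar x)) (cl y), good_side y & y \notin Del].
    case: (boolP ([set y | r (cl (bar x)) (cl y)] \subset Del :|: ~: Gd)).
      move/subset_leq_card => le; have := udeg_min (bar x).
      have := leq_trans le (leq_card_setU _ _).1; rewrite -/(udeg (bar x)).
      have := card_Del; have := few_bad; lia.
    move/subsetPn => [y]; rewrite in_set => yr.
    rewrite in_setU in_setC negb_or negbK [y \in Gd]in_set => /andP[yD yG].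
    by exists y.
  rewrite r_sym in yr; have [a [aA aG ad]] := dense_of_good yG yD yr.
  apply: leq_trans (many_C bB ad) _; rewrite -/x.
  rewrite -(card_in_imset (f := f)); last first.
    move=> u u'; rewrite !inE => /andP[uS _] /andP[uS' _].
    by apply: f_inj; rewrite inE sw_nbf.
  apply/subset_leq_card/subsetP => a' /imsetP[u]; rewrite in_set => /and4P[uS su uC au] ->.
  rewrite in_setI hit_Z ?(out_X aA aG au) //=; first by rewrite imset_f // inE uS.
  rewrite inE; apply/exists_inP; exists b => //.
  by rewrite /g f_sw_A0 //= C_sees.
have : (#|X :&: Bf| <= #|Z|)%N.
  apply: leq_trans (sum_fS (side @: (X :&: Bf))).
  apply: (@leq_trans (\sum_(x in side @: (X :&: Bf)) #|[set b in X :&: Bf | side b == x]|)).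
    rewrite -sum1_card (partition_big_imset side) /=; apply: leq_sum => x _.
    by rewrite sum1dep_card; apply/subset_leq_card/subsetP => b; rewrite !inE.
  apply: leq_sum => x /imsetP[b bX ->]; apply: leq_trans (key b bX).
  apply: leq_trans (few_side (side b)); apply/subset_leq_card/subsetP => b'.
  by rewrite !inE => /andP[/andP[_ ->]].
by rewrite leqNgt card_Z.
Qed.

End Violation.

Theorem absorb : exists h : V -> T, injective h /\ forall x y, H x y -> e (h x) (h y).
Proof.
have [|m [minj mg]] := @hall V T f g BS.
  by move=> X XBS; rewrite leqNgt; apply/negP => /(violation_absurd XBS).
have mA x : x \in BS -> m x \in A0 by move=> /mg /andP[].
have me x z : x \in BS -> H x z -> e (m x) (f z).
  by move=> /mg /andP[_ /forallP /(_ z) /implyP].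
have nbf x : x \notin BS -> x \notin Bf by rewrite inE negb_or => /andP[].
exists (fun x => if x \in BS then m x else f x); split.
  move=> x y; case: ifPn => xB; case: ifPn => yB.
  - exact: minj.
  - by move=> E; have := mA x xB; rewrite E inE imset_f // inE.
  - by move=> E; have := mA y yB; rewrite -E inE imset_f // inE.
  - by apply: f_inj; rewrite inE nbf.
move=> x y xy; case: ifPn => xB; case: ifPn => yB.
- by have := ind xB yB; rewrite xy.
- exact: me.
- by rewrite e_sym; apply: me => //; rewrite H_sym.
- by apply: f_edge => //; apply: nbf.
Qed.

End Absorb.

(** * Embedding along a plan *)

Section Embedding.
Variables (R : realFieldType) (n : nat) (T L : finType) (e : rel T) (H : rel 'I_n).
Variables (c : T -> L) (r irr : rel L) (Np' : nat).
Let U := ('I_Np'.+1 * bool)%type.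
Variables (cl : U -> L) (w Lb D0 A1 A2 A q Delta : nat).
Let ell := (Lb * w)%N.
Variables (phi : 'I_n -> L) (side : 'I_n -> U) (Bf Sw : {set 'I_n}) (key : 'I_n -> nat).
Variables (d eps delta zeta p c0 : R) (m0 del iota : nat).
Let sb := @sb n w Lb.
Let P i := cls c i.
Let T1 := (A1 * Np'.+1)%N.
Let T2 := ((A1 + 2 * A2) * Np'.+1)%N.
Let trn := (A * Np'.+1 * (D0 * w))%N.

Hypothesis plan : embedding_plan H r cl w Lb D0 A1 A2 A q phi side Bf Sw key.
Hypotheses (cardT : #|T| = n) (e_sym : symmetric e) (H_sym : symmetric H) (H_irr : irreflexive H)
  (degH : forall x, (#|nbh H x| <= Delta)%N) (r_sym : symmetric r)
  (r_reg : forall i j, r i j -> lower_regular e d eps (P i) (P j))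
  (cl_r : forall z, r (cl z) (cl (flip z))).
Hypotheses (d0 : 0 < d) (d1 : d <= 1) (eps0 : 0 <= eps) (eps_d : eps <= d)
  (delta1 : delta <= 1) (zeta0 : 0 <= zeta) (zeta1 : zeta <= 1)
  (eps_small : eps <= d ^+ Delta * delta) (p0 : 0 <= p) (p1 : p <= 1)
  (p_c0 : p + zeta + Delta.+1%:R * eps <= c0) (p_d : p + zeta + Delta%:R * eps <= d ^+ 2)
  (c0_d : c0 <= d ^+ Delta * (1 - zeta)) (c0_eps : c0 <= 1 - eps).
Hypothesis load_ok : forall l k, r l k ->
  (2 * trn + #|[set z | cl z == l]| * (A * ell + ell - A1 * q))%N%:R <= 2 * (1 - delta) * #|P l|%:R.
Hypothesis early_ok : forall l k, r l k ->
  (trn + #|[set z | cl z == l]| * ((A1 + 2 * A2) * ell))%N%:R <= zeta * #|P l|%:R.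
Hypothesis room : forall l k, r l k ->
  (2 * ell)%:R + Delta%:R * eps * #|P l|%:R < d ^+ Delta * delta * #|P l|%:R.
Hypothesis potential_small :
  (#|{: U}| * ((n + #|{: U}|) * n))%N%:R * (1 - p ^+ Delta.+1 / 2) ^+ (A2 * q) < (1 / 2) ^+ m0.
Hypotheses (few_side : (A1 * ell <= m0)%N) (few : (A1 * Np'.+1 * ell <= del * m0)%N)
  (ore : forall x y, ~~ r (cl x) (cl y) -> ~~ irr (cl x) (cl y) ->
     (#|{: U}| + del <= udeg r cl x + udeg r cl y)%N)
  (udeg_min : forall x, (del + iota < udeg r cl x)%N)
  (irr_few : forall x, (#|[set y | irr (cl x) (cl y)]| <= iota)%N)
  (dense_many : forall v, (del <= #|[set x | dense e c cl d v x]|)%N).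

Lemma cap i : #|[set x | (x \notin Bf) && (phi x == i)]|%:R <= (1 - delta) * #|P i|%:R.
Proof.
case: (pickP (fun x => phi x == i)) => [x /eqP <-|none]; last first.
  rewrite (_ : [set _ | _] = set0) ?cards0 ?mulr_ge0 ?subr_ge0 //.
  by apply/setP => x; rewrite !inE none andbF.
have [k rk] := pl_active plan x.
have := pl_load plan (phi x); rewrite -(ler_nat R) => h1; have h2 := load_ok rk.
have := le_trans h1 h2; rewrite natrM; lra.
Qed.

Lemma early i : #|[set x | [&& x \notin Bf, (sb x < T2)%N & phi x == i]]|%:R <= zeta * #|P i|%:R.
Proof.
case: (pickP (fun x => phi x == i)) => [x /eqP <-|none]; last first.
  rewrite (_ : [set _ | _] = set0) ?cards0 ?mulr_ge0 //.
  by apply/setP => x; rewrite !inE none !andbF.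
have [k rk] := pl_active plan x.
by apply: le_trans (early_ok rk); rewrite ler_nat; exact: (pl_early plan).
Qed.

Lemma room_phi x : (2 * ell)%:R + Delta%:R * eps * #|cls c (phi x)|%:R
  < d ^+ Delta * delta * #|cls c (phi x)|%:R.
Proof. by have [k rk] := pl_active plan x; exact: room rk. Qed.

Local Notation pemb := (partial_emb e H c phi sb key Bf d).

Lemma extend (m : nat) D f : pemb D f ->
  exists D' f', [/\ pemb D' f', D \subset D', forall x, x \in D -> f' x = f x,
    (forall x, x \notin Bf -> (sb x < m)%N -> x \in D') &
    (forall x, x \in D' -> x \in D \/ (sb x < m)%N)].
Proof.
move=> pe.
have [|D' [f' [pe' _ sub ag [h1 h2]]]] := greedy_run e_sym H_sym H_irr d0 (pl_near plan)
  (pl_key_sb plan) (m := m) (Q := fun _ _ => True) _ pe I.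
  move=> D1 f1 i pe1 _ nx _; have /card_gt0P[a ap] := pool_gt0 d0 d1 eps0 r_reg (pl_hom plan)
    degH cap (pl_size plan) (pl_key_sb plan) eps_small room_phi pe1 nx.
  by exists a.
by exists D', f'; split.
Qed.

Lemma nbh_notin_bs x z : x \in Bf :|: Sw -> H x z -> z \notin Bf :|: Sw.
Proof. by move=> xb xz; apply/negP => zb; have := pl_ind plan xb zb; rewrite xz. Qed.

Lemma not_bs_bf z : z \notin Bf :|: Sw -> z \notin Bf.
Proof. by rewrite inE negb_or => /andP[]. Qed.

Lemma sw_not_bf u : u \in Sw -> u \notin Bf.
Proof.
move=> us; apply/negP => ub; have := pl_disj plan.
by rewrite -setI_eq0 => /eqP/setP/(_ u); rewrite !inE us ub.
Qed.

Lemma T12 : (T1 <= T2)%N. Proof. by rewrite leq_mul2r leq_addr orbT. Qed.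

(** Buffers come from the earliest rounds so that their clusters are still almost empty when their
    candidate sets become final. *)
Lemma cand_buffer D f b : pemb D f -> (forall x, x \in D -> (sb x < T1)%N) -> b \in Bf ->
  c0 * #|P (phi b)|%:R <= #|cand e H c phi sb D f b|%:R.
Proof.
move=> pe early1 bB; have bD : b \notin D by apply: contraL bB; exact: pe_bf pe _.
apply: le_trans (pe_cand pe bD).
have fr : (1 - zeta) * #|P (phi b)|%:R <= #|fresh c phi sb D f b|%:R.
  set E := [set x in D | ((sb x).+1 < sb b)%N].
  have ED : E \subset D by apply/subsetP => x; rewrite inE => /andP[].
  have h1 := card_image_cls (phi b) pe ED.
  have h2 : (#|[set x in E | phi x == phi b]| <=
      #|[set x | [&& x \notin Bf, (sb x < T2)%N & phi x == phi b]]|)%N.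
    apply/subset_leq_card/subsetP => x; rewrite !inE => /andP[/andP[xD _] ->].
    by rewrite (pe_bf pe) //= andbT; apply: leq_trans (early1 _ xD) T12.
  have h3 := cardsID (f @: E) (P (phi b)); rewrite setIC in h3.
  have := early (phi b); move: (leq_trans h1 h2); rewrite -(ler_nat R).
  move/(congr1 (fun m => m%:R : R)): h3; rewrite natrD /fresh -/E -/(P (phi b)); lra.
have dpos : 0 <= d ^+ #|nbh H b :&: D| by rewrite exprn_ge0 // ltW.
apply: le_trans (ler_wpM2l dpos fr); rewrite mulrA ler_wpM2r //.
apply: le_trans c0_d _.
apply: ler_wpM2r; first by rewrite subr_ge0.
apply: ler_wiXn2l; rewrite ?(ltW d0) //.
by apply: leq_trans (degH b); apply/subset_leq_card/subsetIl.
Qed.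

Definition typical x y := [set a in P (cl x) | dense e c cl d a y].

Lemma typical_card x y : r (cl x) (cl y) -> c0 * #|P (cl x)|%:R <= #|typical x y|%:R.
Proof.
move=> rxy; have := r_reg rxy (subxx _); rewrite ler_piMl //; last by have := le_trans eps_d d1.
move=> /(_ isT) h; have := cardsID [set a | dense e c cl d a y] (P (cl x)).
move/(congr1 (fun m => m%:R : R)); rewrite natrD.
have -> : P (cl x) :&: [set a | dense e c cl d a y] = typical x y by apply/setP => a; rewrite !inE.
have -> : P (cl x) :\: [set a | dense e c cl d a y] =
   [set a in P (cl x) | #|nbh e a :&: P (cl y)|%:R < d * #|P (cl y)|%:R].
  by apply/setP => a; rewrite !inE andbC /dense -ltNge.
have := ler_wpM2r (ler0n R #|P (cl x)|) c0_eps; lra.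
Qed.

(** Three greedy phases. After the first, all neighbours of buffers are embedded and the candidates
    [C b] are fixed; these enter the tests of the second, which embeds the swappers and their
    neighbours under the potential; the third embeds the other non-buffers. *)
Theorem embedding : exists h : 'I_n -> T, injective h /\ forall x y, H x y -> e (h x) (h y).
Proof.
have [f0 _] : exists f0 : 'I_n -> T, True.
  by exists (fun x => enum_val (cast_ord (esym cardT) x)).
have pe0 := partial_emb0 e H c phi sb key Bf d f0.
have [D1 [f1 [pe1 _ _ all1 lim1]]] := extend T1 pe0.
have sb1 x : x \in D1 -> (sb x < T1)%N by case/lim1 => //; rewrite inE.
pose C b := cand e H c phi sb D1 f1 b.
(* A test consists of the side of the swappers, the origin of their target set (a buffer on this
   side, or a unit adjacent to it), and the vertex to which they should be able to move. *)
pose tests := (U * (('I_n + U) * T))%type.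
pose valid (j : tests) := dense e c cl d j.2.2 (flip j.1) &&
  match j.2.1 with inl b => (b \in Bf) && (side b == j.1) | inr y => r (cl j.1) (cl y) end.
pose J := {j : tests | valid j}.
pose jx (j : J) := (val j).1.
pose jv (j : J) := (val j).2.2.
pose jS (j : J) := match (val j).2.1 with inl b => C b | inr y => typical (jx j) y end.
have sw_bs u : u \in Sw -> u \in Bf :|: Sw by rewrite inE orbC => ->.
have bf_bs b : b \in Bf -> b \in Bf :|: Sw by rewrite inE => ->.
have sw_sb u : u \in Sw -> (sb u < T2)%N by case/(pl_sw_sb plan)/andP.
have step := potential_step (jx := jx) (jS := jS) (jv := jv) e_sym H_irr d0 d1 eps0 r_reg (pl_hom plan) degH cap
  (pl_size plan) (pl_key_sb plan) eps_small room_phi sw_not_bf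
  (fun u us => pl_phi plan (sw_bs u us)) (fun u z us => pl_nphi plan (sw_bs u us))
  (pl_sw_disj plan) (fun u u' us us' => pl_ind plan (sw_bs u us) (sw_bs u' us'))
  (pl_sw_key plan) (pl_sw_alone plan) early.
have j_sub j : jS j \subset P (cl (jx j)).
  rewrite /jS /jx; case: j => -[x [[b|y] v]] /= vj; last first.
    by apply/subsetP => a; rewrite inE => /andP[].
  case/and3P: vj => _ bB /eqP /= <-; rewrite -(pl_phi plan (bf_bs b bB)).
  by apply/subsetP => a; rewrite !inE => /andP[/andP[]].
have j_card j : c0 * #|P (cl (jx j))|%:R <= #|jS j|%:R.
  rewrite /jS /jx; case: j => -[x [[b|y] v]] /= vj; last first.
    by case/andP: vj => _; exact: typical_card.
  case/and3P: vj => _ bB /eqP /= <-; rewrite -(pl_phi plan (bf_bs b bB)).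
  exact: cand_buffer.
have j_nbh j : d * #|P (cl (flip (jx j)))|%:R <= #|nbh e (jv j) :&: P (cl (flip (jx j)))|%:R.
  by rewrite /jx /jv; case: j => -[x [s v]] /= /andP[].
have {}step := step p c0 j_sub j_card j_nbh (fun j => cl_r (jx j)) p0 p1 eps_d p_c0 p_d.
pose pot D f := potential e H c d side cl (@flip _) Sw jx jS jv p D f.
have start : pot D1 f1 <= #|{: J}|%:R * (1 - p ^+ Delta.+1 / 2) ^+ (A2 * q).
  apply: potential_start p0 p1 _ _ _ _ (fun j => pl_sw_side plan (jx j)) => // u us.
  rewrite -setI_eq0; apply/eqP/setP => z; rewrite in_set0 in_setI; apply/negP => /andP[/sb1 zD zu].
  have /andP[su _] := pl_sw_sb plan us; move: zD; rewrite ltnNge => /negP[].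
  case/setU1P: zu => [->|] //; rewrite inE => uz.
  by rewrite /sb (pl_nsb plan (sw_bs u us) uz).
have [|D2 [f2 [pe2 pot2 sub12 ag12 [all2 lim2]]]] := greedy_run e_sym H_sym H_irr d0 (pl_near plan)
  (pl_key_sb plan) (m := T2) (Q := fun D f => pot D f <= pot D1 f1) _ pe1 (lexx _).
  move=> D f i pe le nx si; have [a ap le'] := step _ _ _ pe nx si.
  by exists a => //; apply: le_trans le' le.
have swD2 u : u \in Sw -> u |: nbh H u \subset D2.
  move=> us; apply/subsetP => z /setU1P[->|].
    by apply: all2; [exact: sw_not_bf | exact: sw_sb].
  rewrite inE => uz; apply: all2; first exact: not_bs_bf (nbh_notin_bs (sw_bs u us) uz).
  by rewrite /sb (pl_nsb plan (sw_bs u us) uz); exact: sw_sb.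
have count j : (m0 <= #|[set u in Sw | [&& side u == jx j, f2 u \in jS j &
     [forall z, H u z ==> e (jv j) (f2 z)]]]|)%N.
  rewrite leqNgt; apply/negP => lt.
  have := potential_end e c d side cl (@flip _) jx jS jv p0 p1 f2 j swD2.
  have small : #|{: J}|%:R * (1 - p ^+ Delta.+1 / 2) ^+ (A2 * q) < (1 / 2) ^+ m0 :> R.
    apply: le_lt_trans potential_small; apply: ler_wpM2r.
      rewrite exprn_ge0 // subr_ge0.
      have : p ^+ Delta.+1 <= 1 by exact: exprn_ile1.
      lra.
    rewrite ler_nat card_sig; apply: leq_trans (max_card _) _.
    by rewrite !card_prod card_sum card_prod !card_ord cardT.
  move=> h; have := le_lt_trans (le_trans h (le_trans pot2 start)) small.
  apply/negP; rewrite -leNgt; apply: ler_wiXn2l => //; [lra | lra | exact: ltnW].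
(* Superblock numbers are at most [n], so the bound [n.+1] excludes nothing. *)
have [D3 [f3 [pe3 sub23 ag23 all3 _]]] := extend n.+1 pe2.
have D3E x : x \notin Bf -> x \in D3.
  by move=> xB; apply: all3 => //; rewrite ltnS /sb (leq_trans (leq_div _ _)) // ltnW.
have f32 x : x \in D2 -> f3 x = f2 x by exact: ag23.
have see32 v u : u \in Sw -> [forall z, H u z ==> e v (f2 z)] -> sees e H f3 v u.
  move=> us /forallP h; apply/forallP => z; apply/implyP => uz; have := h z; rewrite uz /=.
  by rewrite f32 // (subsetP (swD2 u us)) // !inE uz orbT.
have f3sw u : u \in Sw -> f3 u = f2 u.
  by move=> us; apply: f32; apply: (subsetP (swD2 u us)); exact: setU11.
apply: (absorb (c := c) (r := r) (irr := irr) (cl := cl) (bar := @flip _) (side := side) (Bf := Bf)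
  (Sw := Sw) (C := C) (f := f3) (d := d) (m0 := m0) (del := del) (iota := iota)) => //.
- by move=> x y; rewrite !inE => xB yB; apply: (pe_inj pe3); exact: D3E.
- by move=> x y xB yB; apply: (pe_edge pe3); exact: D3E.
- by rewrite cardT card_ord.
- exact: pl_disj plan.
- exact: pl_ind plan.
- move=> b a bB; rewrite inE => /andP[_ /forall_inP h]; apply/forallP => z; apply/implyP => bz.
  have zB := not_bs_bf (nbh_notin_bs (bf_bs b bB) bz).
  have zD1 : z \in D1.
    by apply: all1 => //; rewrite /sb (pl_nsb plan (bf_bs b bB) bz); exact: (pl_bf_sb plan).
  have := h z zD1; rewrite bz f32 ?(subsetP sub12) // ag12 //.
- by case=> k b; rewrite /flip /= negbK.
- move=> x y v rxy dv.
  have vj : valid (x, (inr y, v)) by rewrite /valid /= dv.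
  refine (leq_trans (count (exist (fun j : tests => valid j) (x, (inr y, v)) vj)) _); apply/subset_leq_card/subsetP => u.
  rewrite !in_set => /and4P[us su]; rewrite /jS /jx /jv /= => h1 h2.
  by rewrite us su /= see32 // f3sw // andbT; exact: h1.
- move=> b v bB dv.
  have vj : valid (side b, (inl b, v)) by rewrite /valid /= dv bB eqxx.
  refine (leq_trans (count (exist (fun j : tests => valid j) (side b, (inl b, v)) vj)) _); apply/subset_leq_card/subsetP => u.
  rewrite !in_set => /and4P[us su]; rewrite /jS /jx /jv /= => h1 h2.
  by rewrite us su /= see32 // f3sw // andbT.
- by move=> x; apply: leq_trans (pl_bf_side plan x) few_side.
- by apply: leq_trans (pl_bf_card plan) few.
Qed.

End Embedding.

(** * Choice of constants *)

(** From [w <= 4 * 2 ^ (w %/ 4)] one gets [w ^ 4 <= 256 * 2 ^ w], and one factor [w] outgrows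
    [256 * C]. *)
Lemma cube_lt_exp2 (C : nat) : exists w0, forall w, (w0 <= w)%N -> (C * w ^ 3 < 2 ^ w)%N.
Proof.
exists (256 * C).+1 => w Cw; set u := (w %/ 4)%N.
have wu : (w <= 4 * 2 ^ u)%N.
  apply: (@leq_trans (4 * u.+1)).
    by rewrite mulnC ltnW // ltn_ceil.
  by rewrite leq_mul2l ltn_expl ?orbT.
have h1 : (w ^ 4 <= 256 * 2 ^ w)%N.
  apply: (@leq_trans ((4 * 2 ^ u) ^ 4)); first by rewrite leq_exp2r.
  rewrite expnMn -expnM leq_mul2l leq_pexp2l ?orbT //; exact: leq_trunc_div.
have w3 : (0 < w ^ 3)%N by rewrite expn_gt0 (leq_ltn_trans _ Cw).
rewrite -(ltn_pmul2l (isT : 0 < 256)%N); apply: leq_trans h1.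
by rewrite mulnA [(w ^ 4)%N]expnS ltn_pmul2r.
Qed.

(** Bernoulli's inequality gives [(1 + x) ^+ k >= 4], and the product with [(1 - x) ^+ k] is at most
    [1]. *)
Lemma bernoulli_pow (F : realFieldType) (x : F) (k : nat) : 0 <= x <= 1 -> 3 <= k%:R * x ->
  (1 - x) ^+ k <= 1 / 4.
Proof.
move=> /andP[x0 x1] kx.
have lin : 1 + k%:R * x <= (1 + x) ^+ k.
  elim: k {kx} => [|k IH]; first by rewrite mul0r addr0 expr0.
  have h1 : 0 <= 1 + x by lra.
  have := ler_wpM2l h1 IH; rewrite -exprS -natr1.
  have : 0 <= k%:R * x * x by rewrite !mulr_ge0.
  lra.
have pr : (1 - x) ^+ k * (1 + x) ^+ k <= 1.
  by rewrite -exprMn; apply: exprn_ile1; nra.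
have y0 : 0 <= (1 - x) ^+ k by rewrite exprn_ge0 // subr_ge0.
have h4 : 4 <= (1 + x) ^+ k by lra.
have := ler_wpM2l y0 h4; lra.
Qed.

Section Final.
Variables (F : realFieldType) (n : nat) (H : rel 'I_n) (T L : finType) (e : rel T) (c : T -> L).
Variables (chi : 'I_n -> bool) (Delta g k S K Lq w : nat).
Variables (d eps theta lam sigma : F).
Let gam : F := g%:R^-1.
(** [z] serves both as survival probability and as the fraction of a cluster used in the early
    rounds. [Q] makes [q_room] fill half of a superblock. [A1 * q] is [8 * ell], which outweighs the
    [4 * ell] of spare rounds in [A] and the imbalance [ell] of the orientation. [m0] is such that
    sets of [m0] buffers number about a [1 / (8 * g)] fraction of the pairs, and [A2] is such that
    [A2 * q = k * m0]. *)
Let z := d ^+ Delta * d ^+ 2 / 8.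
Let Q := (4 * ((Delta * Delta).+1 * Delta.+1))%N.
Let A1 := (8 * Q)%N.
Let A2 := (k * Q * (8 * g) * A1)%N.
Let A := (2 * S + 4)%N.
Let D0 := (K * K)%N.
Let Lb := (Q * Lq)%N.
Let ell := (Lb * w)%N.
Let q := (Lq * w)%N.
Let s := (S * ell)%N.
Let m0 := (8 * g * A1 * ell)%N.
Let delta : F := (2 * S)%:R^-1.
Let N : F := n%:R.
Let y := d ^+ Delta.

Hypotheses (H_sym : symmetric H) (H_irr : irreflexive H)
  (degH : forall x, (#|nbh H x| <= Delta)%N)
  (chi_col : forall x y, H x y -> chi x != chi y)
  (chi_iso : forall x, (forall y, ~~ H x y) -> chi x = odd x)
  (width : forall x y, H x y -> (x <= y + w)%N).
Hypotheses (cardT : #|T| = n) (e_sym : symmetric e) (e_irr : irreflexive e)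
  (ore : forall x y, x != y -> ~~ e x y -> (1 + gam) * N <= #|nbh e x|%:R + #|nbh e y|%:R)
  (irr_le : (irr_weight e eps c)%:R <= eps * (N * N)) (LK : (#|L| <= K)%N).
Hypotheses (g2 : (2 <= g)%N) (dE : d = gam / 48)
  (k_big : 3 <= k%:R * (z ^+ Delta.+1 / 2)) (S2 : (2 <= S)%N)
  (S_big : 2 * (A1 + 2 * A2)%:R <= z * S%:R).
Hypotheses (th0 : 0 < theta) (thS : theta * (48 * S%:R) <= gam)
  (eps0 : 0 < eps) (eps_z : Delta.+1%:R * eps <= z / 4) (eps_th : 4 * eps <= theta ^+ 2)
  (eps_y : Delta.+1%:R * eps <= y * delta / 4)
  (lam0 : 0 < lam) (lam_K : 2 * (K%:R * lam) <= theta ^+ 2).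
Hypotheses (Lq_room : (2 * (D0 + 6) <= Lb)%N) (Lq_D0 : 2 * D0%:R <= delta * z * lam / 2 * Lb%:R)
  (w_gt0 : (0 < w)%N).
Hypotheses (sN : s%:R <= sigma * N) (sigma_K : sigma * (K%:R + 1) <= theta)
  (sigma_y : 4 * sigma < y * delta * lam)
  (N_lam : 8 <= lam * N) (cube : (2 * n ^ 3 < 2 ^ w)%N).

Lemma gam_gt0 : 0 < gam. Proof. by rewrite invr_gt0 ltr0n (leq_trans _ g2). Qed.

Lemma gam_le : gam <= 1 / 2.
Proof.
rewrite /gam [leRHS]div1r lef_pV2 ?posrE ?ltr0n ?ler_nat //.
exact: leq_trans g2.
Qed.

Lemma d_gt0 : 0 < d. Proof. by rewrite dE; have := gam_gt0; lra. Qed.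
Lemma d_le : d <= 1 / 96. Proof. by rewrite dE; have := gam_le; lra. Qed.
Lemma y_gt0 : 0 < y. Proof. by rewrite exprn_gt0 // d_gt0. Qed.
Lemma y_le : y <= 1.
Proof. by apply: exprn_ile1; [apply/ltW/d_gt0 | have := d_le; lra]. Qed.

Lemma z_gt0 : 0 < z.
Proof. by rewrite divr_gt0 // mulr_gt0 ?exprn_gt0 ?d_gt0. Qed.

Lemma d2_le : d ^+ 2 <= 1.
Proof. by apply: exprn_ile1; [apply/ltW/d_gt0 | have := d_le; lra]. Qed.

Lemma z_le_d2 : z <= d ^+ 2 / 8.
Proof.
apply: ler_wpM2r; first by lra.
by apply: ler_piMl y_le; rewrite exprn_ge0 // ltW // d_gt0.
Qed.

Lemma z_le_y : z <= y / 8.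
Proof.
apply: ler_wpM2r; first by lra.
by apply: ler_piMr d2_le; apply/ltW/y_gt0.
Qed.

Lemma z_le_d : z <= d.
Proof.
have := z_le_d2; have : d ^+ 2 <= d.
  by rewrite expr2 ler_piMl ?(ltW d_gt0) //; have := d_le; lra.
have := d_gt0; lra.
Qed.

Lemma eps_le_z : eps <= z / 4.
Proof.
apply: le_trans eps_z; rewrite -[leLHS]mul1r ler_wpM2r ?(ltW eps0) //.
by rewrite ler1n.
Qed.

Lemma S_gt0 : 0 < S%:R :> F. Proof. by rewrite ltr0n (leq_trans _ S2). Qed.

Lemma delta_gt0 : 0 < delta.
Proof. by rewrite invr_gt0 ltr0n muln_gt0 /= (leq_trans _ S2). Qed.

Lemma deltaS : delta * (2 * S%:R) = 1.
Proof. by rewrite /delta natrM mulVf // mulf_neq0 ?gt_eqF ?S_gt0. Qed.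

Lemma delta_le : delta <= 1.
Proof.
have := deltaS; have : 1 <= S%:R :> F by rewrite ler1n (leq_trans _ S2).
by have := delta_gt0; nra.
Qed.

Lemma th_gam : 48 * theta <= gam.
Proof.
apply: le_trans thS; rewrite mulrCA ler_wpM2l // ler_peMr ?(ltW th0) //.
by rewrite ler1n (leq_trans _ S2).
Qed.

Lemma n_gt0 : 0 < N.
Proof. by have := N_lam; have := lam0; rewrite /N; case: n => [|m] //; rewrite mulr0; lra. Qed.

Lemma lam_L : 2 * eps + #|L|%:R * lam <= theta ^+ 2.
Proof.
have : #|L|%:R * lam <= K%:R * lam by rewrite ler_wpM2r ?(ltW lam0) // ler_nat.
have := lam_K; have := eps_th; lra.
Qed.

Lemma s_gt0 : (0 < s)%N.
Proof.
have Lb0 : (0 < Lb)%N by apply: leq_trans Lq_room; rewrite muln_gt0 addn_gt0 orbT.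
by rewrite muln_gt0 muln_gt0 Lb0 w_gt0 (leq_trans _ S2).
Qed.

Let NT : #|T|%:R = N :> F. Proof. by rewrite cardT. Qed.
Let P i := cls c i.
Let r := red e c d eps theta lam.
Let gd := good e c d eps theta lam.
Let ir := irregular e c eps.
Let wd i := #|[set x | r i (c x)]|.

Let ore' : forall x y, x != y -> ~~ e x y ->
  (1 + gam) * #|T|%:R <= #|nbh e x|%:R + #|nbh e y|%:R.
Proof. by rewrite NT. Qed.
Let irr_le' : (irr_weight e eps c)%:R <= eps * (#|T|%:R * #|T|%:R).
Proof. by rewrite NT. Qed.
Let eps0' : 0 <= eps. Proof. exact: ltW. Qed.
Let eps_d : eps <= d.
Proof. by have := eps_le_z; have := z_le_d; have := z_gt0; lra. Qed.
Let d_small : d <= gam / 48. Proof. by rewrite dE. Qed.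
Let th_small : theta <= gam / 48. Proof. by have := th_gam; lra. Qed.
Let lam_n : 8 <= lam * #|T|%:R. Proof. by rewrite NT. Qed.

Lemma wd_min i : gd i -> gam / 2 * N <= (wd i)%:R.
Proof.
by rewrite -NT; apply: wdeg_min => //; [exact: gam_gt0 | exact: gam_le | exact: ltW | exact: lam_L].
Qed.

Lemma wd_ore i j : gd i -> gd j -> ~~ r i j -> ~~ ir i j ->
  (1 + gam / 2) * N <= (wd i)%:R + (wd j)%:R.
Proof.
rewrite -NT; apply: wdeg_ore => //; [exact: gam_gt0 | exact: gam_le | exact: ltW | exact: lam_L].
Qed.

Lemma N_theta : theta * N <= gam / 48 * N.
Proof. by rewrite ler_wpM2r // ltW // n_gt0. Qed.

Lemma gN_gt0 : 0 < gam * N. Proof. by rewrite mulr_gt0 ?gam_gt0 ?n_gt0. Qed.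

Lemma KsN : (K%:R + 1) * s%:R <= theta * N.
Proof.
apply: (@le_trans _ _ ((K%:R + 1) * (sigma * N))).
  by rewrite ler_wpM2l // addr_ge0.
by rewrite mulrA [_ * sigma]mulrC ler_wpM2r // ltW // n_gt0.
Qed.

Let Irr := (\max_(i | gd i) #|[set x | ir i (c x)]|)%N.

Lemma irr_le_Irr i : gd i -> (#|[set x | ir i (c x)]| <= Irr)%N.
Proof. by move=> gi; apply: (@leq_bigmax_cond _ gd (fun i => #|[set x | ir i (c x)]|)). Qed.

Lemma Irr_le : Irr%:R <= theta * N.
Proof.
rewrite /Irr; elim/big_ind: _ => [|a b ha hb|i gi].
- by rewrite mulr_ge0 ?(ltW th0).
- by rewrite /maxn; case: ifP.
- by rewrite -NT; exact: irregular_card gi.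
Qed.

Lemma r_good i j : r i j -> gd i /\ gd j. Proof. by move/red_good/andP. Qed.

Lemma arcs (a b : L * L) : r a.1 a.2 -> r b.1 b.2 ->
  exists t : nat -> L * L, [/\ t 0%N = a, t D0 = b & forall j, (j < D0)%N -> arc_step r (t j) (t j.+1)].
Proof.
apply: (@arc_path T L c r ir D0); first exact: red_sym.
- move=> i j i' j' /r_good[gi _] /r_good[gj _] nr ni; rewrite -(ltr_nat F) natrD NT.
  have := wd_ore gi gj nr ni; have := gN_gt0; rewrite /wd; lra.
- move=> i i' j j' /r_good[gi _] /r_good[gj _].
  apply: leq_ltn_trans (irr_le_Irr gi) _; rewrite -(ltr_nat F).
  have := wd_min gj; have := Irr_le; have := N_theta; have := gN_gt0; rewrite /wd; lra.
by rewrite card_prod leq_mul.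
Qed.

Lemma unit_structure : exists (Np' : nat) (cl : 'I_Np'.+1 * bool -> L),
  [/\ forall x, r (cl x) (cl (flip x)),
      forall p : pred L, (s * #|[set x | p (cl x)]| <= #|[set x | p (c x)]|)%N,
      forall p : pred L, (forall i, p i -> gd i) ->
        #|[set x | p (c x)]|%:R <= s%:R * #|[set x | p (cl x)]|%:R + 2 * theta * N &
      N - 5 * theta * N <= s%:R * #|{: 'I_Np'.+1 * bool}|%:R].
Proof.
have LsK : (#|L| * s)%N%:R <= K%:R * s%:R :> F by rewrite natrM ler_wpM2r // ler_nat.
have [||||Np [cl [cl_r _ ule uge]]] := @units_exist T L c r ir gd s Irr _ _ s_gt0.
- exact: red_sym.
- by move=> i j /r_good[].
- move=> i j gi gj nr ni; rewrite -(ltr_nat F) !natrD natrM NT.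
  have := wd_ore gi gj nr ni; rewrite /wd; have := KsN; have := N_theta; have := gN_gt0.
  have : 0 <= s%:R :> F by []. lra.
- exact: irr_le_Irr.
have uge' (p : pred L) : (forall i, p i -> gd i) ->
        #|[set x | p (c x)]|%:R <= s%:R * #|[set x | p (cl x)]|%:R + 2 * theta * N.
  move=> pg; have := uge p pg; rewrite -(ler_nat F) !natrD natrM => h.
  have := KsN; have := Irr_le; lra.
have all : N - 5 * theta * N <= s%:R * #|{: 'I_Np * bool}|%:R.
  have h1 := uge' gd (fun i gi => gi).
  have h2 := @not_good_card F T L e c gam d eps theta lam irr_le' gam_le eps0' eps_d d_small th0
    th_small (ltW lam0) lam_L lam_n.
  have h3 : N = #|[set x | gd (c x)]|%:R + #|[set x | ~~ gd (c x)]|%:R.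
    rewrite -NT -(cardsC [set x | gd (c x)]) natrD; congr (_ + _%:R).
    by apply: eq_card => x; rewrite !inE.
  have h4 : s%:R * #|[set x | gd (cl x)]|%:R <= s%:R * #|{: 'I_Np * bool}|%:R :> F.
    by rewrite ler_wpM2l // ler_nat max_card.
  rewrite NT in h2; move: h1 h2 h3 h4; rewrite -/gd; lra.
move: cl cl_r ule {uge} uge' all; case: Np => [|Np'] cl cl_r ule uge' all.
  exfalso; move: all; rewrite card_prod card_ord mul0n mulr0.
  have := N_theta; have := n_gt0; have := gam_le; have := gN_gt0; nra.
by exists Np', cl.
Qed.

Section Units.
Variables (Np' : nat) (cl : 'I_Np'.+1 * bool -> L).
Let NU := #|{: 'I_Np'.+1 * bool}|.
Hypotheses (cl_r : forall x, r (cl x) (cl (flip x)))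
  (units_le : forall p : pred L, (s * #|[set x | p (cl x)]| <= #|[set x | p (c x)]|)%N)
  (units_ge : forall p : pred L, (forall i, p i -> gd i) ->
        #|[set x | p (c x)]|%:R <= s%:R * #|[set x | p (cl x)]|%:R + 2 * theta * N)
  (units_all : N - 5 * theta * N <= s%:R * NU%:R).

Lemma NU_E : NU = (2 * Np'.+1)%N.
Proof. by rewrite /NU card_prod card_ord card_bool mulnC. Qed.

Lemma sNU_le : (s * NU <= n)%N.
Proof.
apply: (@leq_trans (s * #|[set x | predT (cl x)]|)).
  by rewrite leq_mul2l; apply/orP; right; apply/subset_leq_card/subsetP => x _; rewrite inE.
by apply: leq_trans (units_le predT) _; rewrite -cardT max_card.
Qed.

Lemma sNU_leF : s%:R * NU%:R <= N. Proof. by rewrite -natrM ler_nat sNU_le. Qed.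

Lemma sE : s%:R = S%:R * ell%:R :> F. Proof. by rewrite natrM. Qed.

Lemma round_size : 2 * s%:R * Np'.+1%:R = s%:R * NU%:R :> F.
Proof. by rewrite NU_E natrM; ring. Qed.

Lemma AF : (A * Np'.+1 * ell)%N%:R = (2 * S%:R + 4) * Np'.+1%:R * ell%:R :> F.
Proof. by rewrite (natrM _ (A * Np'.+1)) (natrM _ A) natrD (natrM _ 2). Qed.

(** [2 * S] rounds would fill all units; the four extra rounds take the at most [5 * theta * n]
    vertices outside the units, because [theta] is small compared with [1 / S]. *)
Lemma n_le : (n <= A * Np'.+1 * ell)%N.
Proof.
rewrite -(ler_nat F) AF; have h := round_size; rewrite sE in h.
have := units_all; rewrite sE -h -/N.
pose a : F := Np'.+1%:R * ell%:R.
have -> : 2 * (S%:R * ell%:R) * Np'.+1%:R = 2 * S%:R * a by rewrite /a; ring.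
have -> : (2 * S%:R + 4) * Np'.+1%:R * ell%:R = 2 * S%:R * a + 4 * a by rewrite /a; ring.
have small : 5 * theta * N <= 4 * a -> N - 5 * theta * N <= 2 * S%:R * a -> N <= 2 * S%:R * a + 4 * a by lra.
move=> all; apply: small => //.
have S0 := S_gt0; rewrite -(ler_pM2l S0).
have := ler_wpM2r (ltW n_gt0) thS; have := N_theta; have := gam_le.
have := ler_wpM2r (ltW n_gt0) gam_le; have := n_gt0; lra.
Qed.

Lemma A12_S : (A1 + 2 * A2 <= S)%N.
Proof.
rewrite -(ler_nat F); have := S_big; have := z_le_y; have := y_le; have := z_gt0.
have S0 := S_gt0; have : z * S%:R <= S%:R.
  by rewrite ler_piMl ?ler0n //; have := z_le_y; have := y_le; lra.
have : 0 <= (A1 + 2 * A2)%:R :> F by []. lra.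
Qed.

Lemma n_ge : ((A1 + 2 * A2) * Np'.+1 * ell <= n)%N.
Proof.
apply: leq_trans sNU_le; rewrite NU_E.
apply: (@leq_trans (S * Np'.+1 * ell)); first by rewrite !leq_mul2r A12_S !orbT.
rewrite /s -mulnA [(Np'.+1 * ell)%N]mulnC mulnA leq_mul2l; apply/orP; right.
by rewrite leq_pmull.
Qed.

Lemma D0_Lb : (D0 < Lb)%N.
Proof. by apply: leq_trans Lq_room; rewrite mul2n -addnn -addnA -addn1 leq_add2l. Qed.

Lemma ellE : (Q * q = ell)%N. Proof. by rewrite /q mulnA. Qed.

Lemma q_room : (2 * ((Delta * Delta).+1 * Delta.+1 * q) + (D0 + 6) * w <= Lb * w)%N.
Proof.
have E : (2 * (2 * ((Delta * Delta).+1 * Delta.+1 * q)) = Lb * w)%N.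
  by rewrite -/ell -ellE /Q mulnA -[in RHS]mulnA.
have := leq_mul Lq_room (leqnn w); rewrite -mulnA => le.
by rewrite -(leq_pmul2l (isT : 0 < 2)%N) mulnDr E [leqRHS]mul2n -addnn leq_add2l.
Qed.

Let trn := (A * Np'.+1 * (D0 * w))%N.

Lemma trn_le : trn%:R <= delta * z * lam / 2 * N.
Proof.
have Lb0 : 0 < Lb%:R :> F by rewrite ltr0n (leq_ltn_trans _ D0_Lb).
rewrite -(ler_pM2r Lb0).
have -> : trn%:R * Lb%:R = (A * Np'.+1 * ell)%N%:R * D0%:R :> F.
  by rewrite -!natrM; congr (_%:R); rewrite /trn /ell; ring.
have h1 : (A * Np'.+1 * ell)%N%:R <= 2 * N.
  rewrite AF; have h := round_size; rewrite sE in h.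
  have := sNU_leF; rewrite sE -h => h2.
  have S2' : 2 <= S%:R :> F by rewrite ler_nat.
  have a0 : 0 <= Np'.+1%:R * ell%:R :> F by rewrite mulr_ge0.
  have := ler_wpM2r a0 S2'; lra.
apply: le_trans (ler_wpM2r (ler0n _ D0) h1) _.
have := ler_wpM2l (ltW n_gt0) Lq_D0; lra.
Qed.

Lemma P_big l k' : r l k' -> lam * N <= #|P l|%:R.
Proof. by case/r_good => gl _; rewrite -NT; exact: good_big gl. Qed.

Lemma units_P l : #|[set x | cl x == l]|%:R * s%:R <= #|P l|%:R :> F.
Proof.
rewrite -natrM ler_nat mulnC; apply: leq_trans (units_le (pred1 l)) _.
by apply/subset_leq_card/subsetP => x; rewrite !inE.
Qed.

Lemma trn_P l k' : r l k' -> trn%:R <= delta * z / 2 * #|P l|%:R.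
Proof.
move=> rl; apply: le_trans trn_le _.
have dz : 0 <= delta * z / 2 by rewrite divr_ge0 // mulr_ge0 ?(ltW z_gt0) ?(ltW delta_gt0).
have := ler_wpM2l dz (P_big rl); lra.
Qed.

Lemma z_le1 : z <= 1. Proof. by have := z_le_y; have := y_le; lra. Qed.

(** After the buffers are removed, a pair of units carries at most [2 * S - 3] superblocks in place
    of [2 * S]. With [delta = 1 / (2 * S)] this leaves a slack of more than [2 * delta], part of
    which pays for the vertices in transit. *)
Lemma load_ok l k' : r l k' ->
  (2 * trn + #|[set x | cl x == l]| * (A * ell + ell - A1 * q))%N%:R <= 2 * (1 - delta) * #|P l|%:R.
Proof.
move=> rl; have h1 := trn_P rl; have h2 := units_P l.
have -> : (A * ell + ell - A1 * q = (2 * S - 3) * ell)%N.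
  rewrite /A1 -mulnA ellE /A -mulSnr -mulnBl; congr (_ * _)%N.
  by rewrite -addnS -[8%N]/(3 + 5)%N subnDr.
rewrite natrD (natrM _ 2 trn) (natrM _ #|_|) (natrM _ (2 * S - 3)) natrB; last first.
  by apply: leq_trans (leq_mul (leqnn 2) S2).
rewrite (natrM _ 2 S); set u := #|_|%:R in h2 *.
have u0 : 0 <= u by [].
have h3 : u * ((2 * S%:R - 3) * ell%:R) <= 2 * (1 - 2 * delta) * (u * s%:R).
  rewrite sE; have -> : 2 * (1 - 2 * delta) * (u * (S%:R * ell%:R))
     = u * ((2 * S%:R - 2 * (delta * (2 * S%:R))) * ell%:R) by ring.
  rewrite deltaS ler_wpM2l // ler_wpM2r //; lra.
have d4 : 0 <= 2 * (1 - 2 * delta).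
  have := deltaS; have S2' : 2 <= S%:R :> F by rewrite ler_nat.
  have := ler_wpM2l (ltW delta_gt0) S2'; lra.
have h4 := ler_wpM2l d4 h2.
have P0 : 0 <= delta * #|P l|%:R by rewrite mulr_ge0 // ltW // delta_gt0.
have := ler_piMr P0 z_le1; lra.
Qed.

Lemma early_ok l k' : r l k' ->
  (trn + #|[set x | cl x == l]| * ((A1 + 2 * A2) * ell))%N%:R <= z * #|P l|%:R.
Proof.
move=> rl; have h1 := trn_P rl; have h2 := units_P l.
rewrite natrD (natrM _ #|_|) (natrM _ (A1 + 2 * A2)); set u := #|_|%:R in h2 *.
have h3 : u * ((A1 + 2 * A2)%:R * ell%:R) <= z / 2 * (u * s%:R).
  rewrite sE; have -> : z / 2 * (u * (S%:R * ell%:R)) = u * ((z * S%:R / 2) * ell%:R) by ring.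
  rewrite ler_wpM2l // ler_wpM2r //; have := S_big; lra.
have z2 : 0 <= z / 2 by rewrite divr_ge0 // ltW // z_gt0.
have h4 := ler_wpM2l z2 h2.
have P0 : 0 <= z * #|P l|%:R by rewrite mulr_ge0 // ltW // z_gt0.
have := ler_piMr P0 delta_le; lra.
Qed.

Lemma room l k' : r l k' ->
  (2 * ell)%:R + Delta%:R * eps * #|P l|%:R < y * delta * #|P l|%:R.
Proof.
move=> rl; have h1 := P_big rl.
have yd : 0 < y * delta by rewrite mulr_gt0 ?y_gt0 ?delta_gt0.
have h2 := ler_wpM2l (ltW yd) h1.
have h3 : 4 * s%:R < y * delta * (lam * N).
  have h' : 4 * sigma * N < y * delta * lam * N by rewrite ltr_pM2r ?n_gt0.
  rewrite mulrA; apply: le_lt_trans h'; rewrite -mulrA.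
  by apply: ler_wpM2l sN.
have h4 : ell%:R <= s%:R :> F by rewrite ler_nat leq_pmull // (leq_trans _ S2).
have h5 : Delta%:R * eps <= y * delta / 4.
  by apply: le_trans eps_y; rewrite ler_wpM2r ?(ltW eps0) // ler_nat.
have := ler_wpM2r (ler0n F #|P l|) h5.
have : 0 <= y * delta * #|P l|%:R by rewrite mulr_ge0 // ltW.
rewrite (natrM _ 2); lra.
Qed.

Lemma A2q : (A2 * q = k * m0)%N.
Proof.
rewrite /A2 /m0 -ellE; move: (8 * g)%N A1 Q q => a b x t; ring.
Qed.

Lemma g_gt0 : (0 < g)%N. Proof. exact: leq_trans g2. Qed.

Lemma A1ell_m0 : (A1 * ell <= m0)%N.
Proof. by rewrite /m0 -mulnA leq_pmull // muln_gt0 g_gt0. Qed.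

Lemma w_m0 : (w <= m0)%N.
Proof.
apply: leq_trans A1ell_m0; rewrite /ell mulnA leq_pmull // muln_gt0.
by rewrite (leq_ltn_trans _ D0_Lb).
Qed.

(** There are at most [2 * n ^ 3] tests, fewer than [2 ^ w] and so than [2 ^ m0], while by the
    choice of [k] each starts with a product of at most [4 ^ - m0]. *)
Lemma potential_small : (NU * ((n + NU) * n))%N%:R * (1 - z ^+ Delta.+1 / 2) ^+ (A2 * q)
  < (1 / 2) ^+ m0 :> F.
Proof.
have zp : 0 <= z ^+ Delta.+1 <= 1.
  rewrite exprn_ge0 ?(ltW z_gt0) //=; apply: exprn_ile1; [exact/ltW/z_gt0 | exact: z_le1].
have h1 : (1 - z ^+ Delta.+1 / 2) ^+ (A2 * q) <= (1 / 4) ^+ m0.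
  rewrite A2q exprM; apply: lerXn2r; rewrite ?nnegrE ?exprn_ge0 //; try lra.
  by apply: bernoulli_pow => //; lra.
have NUn : (NU <= n)%N by apply: leq_trans sNU_le; rewrite leq_pmull // s_gt0.
have h2 : (NU * ((n + NU) * n) < 2 ^ m0)%N.
  apply: leq_trans (_ : 2 ^ w <= _)%N; last by rewrite leq_pexp2l // w_m0.
  apply: leq_ltn_trans cube; apply: (@leq_trans (n * ((n + n) * n))).
    by rewrite leq_mul // leq_mul // leq_add2l.
  by apply: eq_leq; ring.
apply: le_lt_trans (ler_wpM2l _ h1) _; first by [].
have -> : (1 / 2) ^+ m0 = 2 ^+ m0 * (1 / 4) ^+ m0 :> F.
  by rewrite -exprMn; congr (_ ^+ _); lra.
rewrite ltr_pM2r; last by apply: exprn_gt0; lra.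
by rewrite -natrX ltr_nat.
Qed.

(** Just large enough for [few_del]. The corresponding [s * del] vertices, about [gam / 16 * N], fit
    into the slack [gam / 2 * N] of the reduced Ore condition. *)
Let del := (Np'.+1 %/ (8 * g)).+1.
Let iota := (Irr %/ s)%N.

Lemma few_del : (A1 * Np'.+1 * ell <= del * m0)%N.
Proof.
have h : (Np'.+1 <= del * (8 * g))%N by rewrite ltnW // ltn_ceil // muln_gt0 g_gt0.
apply: leq_trans (leq_mul (leq_mul (leqnn A1) h) (leqnn ell)) _.
by rewrite /m0; apply: eq_leq; ring.
Qed.

Lemma s_del : s%:R * del%:R <= gam / 16 * N + theta * N.
Proof.
have g0 : 0 < g%:R :> F by rewrite ltr0n g_gt0.
have gg : gam * g%:R = 1 by rewrite mulVf // gt_eqF.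
have h : (del.-1 * (8 * g) <= Np'.+1)%N by exact: leq_trunc_div.
move: h; rewrite -(ler_nat F) (natrM _ del.-1) (natrM _ 8 g) => h.
have dE' : del%:R = del.-1%:R + 1 :> F by rewrite natr1.
have h2 := sNU_leF; rewrite -round_size in h2.
have h3 := ler_wpM2l (ler0n F s) h.
have h4 : s%:R <= theta * N.
  have := KsN; have : 0 <= K%:R * s%:R :> F by rewrite mulr_ge0.
  lra.
have h5 : 16 * (s%:R * del.-1%:R) * g%:R <= N by lra.
have := ler_wpM2l (ltW gam_gt0) h5.
have -> : gam * (16 * (s%:R * del.-1%:R) * g%:R) = 16 * (s%:R * del.-1%:R) * (gam * g%:R) by ring.
rewrite gg dE'; lra.
Qed.

Lemma s_iota : s%:R * iota%:R <= theta * N.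
Proof.
by apply: le_trans Irr_le; rewrite -natrM ler_nat mulnC leq_trunc_div.
Qed.

Lemma s_gt0F : 0 < s%:R :> F. Proof. by rewrite ltr0n s_gt0. Qed.

Lemma s_udeg x : (wd (cl x))%:R <= s%:R * (udeg r cl x)%:R + 2 * theta * N.
Proof. by apply: (units_ge (p := r (cl x))) => i /r_good[]. Qed.

Lemma cl_good x : gd (cl x). Proof. by have [] := r_good (cl_r x). Qed.

Lemma unit_ore x x' : ~~ r (cl x) (cl x') -> ~~ ir (cl x) (cl x') ->
  (NU + del <= udeg r cl x + udeg r cl x')%N.
Proof.
move=> nr ni; rewrite -(ler_nat F) !natrD -(ler_pM2l s_gt0F) !mulrDr.
have := wd_ore (cl_good x) (cl_good x') nr ni.
have := s_udeg x; have := s_udeg x'; have := s_del; have := sNU_leF.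
have := N_theta; have := gN_gt0; lra.
Qed.

Lemma unit_udeg_min x : (del + iota < udeg r cl x)%N.
Proof.
rewrite -(ltr_nat F) natrD -(ltr_pM2l s_gt0F) mulrDr.
have := wd_min (cl_good x); have := s_udeg x; have := s_del; have := s_iota.
have := N_theta; have := gN_gt0; lra.
Qed.

Lemma unit_irr_few x : (#|[set x' | ir (cl x) (cl x')]| <= iota)%N.
Proof.
rewrite leq_divRL ?s_gt0 // mulnC; apply: leq_trans (units_le (ir (cl x))) _.
exact/irr_le_Irr/cl_good.
Qed.

Lemma unit_dense_many v : (del <= #|[set x | dense e c cl d v x]|)%N.
Proof.
pose p i := gd i && (d * #|P i|%:R <= #|nbh e v :&: P i|%:R).
have h1 : gam / 2 * N <= #|[set x | p (c x)]|%:R.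
  have := @dense_clusters F T L e c gam d eps theta lam ore' irr_le' gam_gt0 gam_le eps0' eps_d d_small th0
    th_small (ltW lam0) lam_L lam_n v; by rewrite NT.
have h2 : #|[set x | p (c x)]|%:R <= s%:R * #|[set x | p (cl x)]|%:R + 2 * theta * N.
  by apply: units_ge => i /andP[].
apply: (@leq_trans #|[set x | p (cl x)]|); last first.
  by apply/subset_leq_card/subsetP => x; rewrite !inE => /andP[].
rewrite -(ler_nat F) -(ler_pM2l s_gt0F).
have := s_del; have := N_theta; have := gN_gt0; lra.
Qed.

Lemma final_units : exists h : 'I_n -> T, injective h /\ forall x x', H x x' -> e (h x) (h x').
Proof.
have [phi [side [Bf [Sw [key plan]]]]] := embedding_plan_exists (A := A) (A1 := A1) (A2 := A2)
  H_sym degH chi_col chi_iso width (red_sym c d eps theta lam e_sym) cl_r arcs w_gt0 D0_Lb q_room n_le n_ge.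
have ez := eps_le_z; have zy := z_le_y; have zd := z_le_d2; have z0 := z_gt0.
have d2 := d2_le; have y0 := y_gt0; have y1 := y_le; have dl := delta_le; have dl0 := delta_gt0.
have e1 : Delta%:R * eps <= z / 4.
  by apply: le_trans eps_z; rewrite ler_wpM2r ?(ltW eps0) // ler_nat.
refine (embedding (zeta := z) (p := z) (c0 := y / 2) (delta := delta) (m0 := m0) (irr := ir)
  (del := del) (iota := iota) plan cardT e_sym H_sym H_irr degH (red_sym c d eps theta lam e_sym)
  (red_lower eps0' eps_d) cl_r _ _ _ _ _ _ _ _ _ _ _ _ _ _ _ _ _ _ _ _ _ _ _ _).
- exact: d_gt0.
- by have := d_le; lra.
- exact: eps0'.
- exact: eps_d.
- exact: dl.
- exact: ltW.
- exact: z_le1.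
- apply: (@le_trans _ _ (Delta.+1%:R * eps)).
    by rewrite -[leLHS]mul1r ler_wpM2r ?(ltW eps0) // ler1n.
  apply: le_trans eps_y _; rewrite -/y; have : 0 <= y * delta by rewrite mulr_ge0 // ltW.
  lra.
- exact: ltW.
- exact: z_le1.
- have := eps_z; lra.
- lra.
- rewrite -/y mulrBr mulr1; have : y * z <= y / 8.
    by rewrite ler_wpM2l ?(ltW y0) //; lra.
  lra.
- lra.
- exact: load_ok.
- exact: early_ok.
- exact: room.
- exact: potential_small.
- exact: A1ell_m0.
- exact: few_del.
- exact: unit_ore.
- exact: unit_udeg_min.
- exact: unit_irr_few.
- exact: unit_dense_many.
Qed.

End Units.

Theorem final_embedding : exists h : 'I_n -> T, injective h /\ forall x x', H x x' -> e (h x) (h x').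
Proof. by have [Np' [cl [h1 h2 h3 h4]]] := unit_structure; exact: (final_units h1 h2 h3 h4). Qed.

End Final.

(** * The theorem *)

Lemma nat_above (F : archiRealFieldType) (x : F) : exists m : nat, x <= m%:R.
Proof.
have [x0|x0] := lerP 0 x; first by exists (Num.bound x); apply/ltW/archi_boundP.
by exists 0%N; apply: ltW.
Qed.

Lemma bandwidth_embedding (F : archiRealFieldType) (Delta g : nat) : (2 <= g)%N ->
  exists M n0 : nat, (0 < M)%N /\
  forall (n : nat) (H e : rel 'I_n) (chi : 'I_n -> bool), (n0 <= n)%N ->
    symmetric H -> irreflexive H -> (forall x, (#|nbh H x| <= Delta)%N) ->
    (forall x y, H x y -> chi x != chi y) ->
    (forall x y, H x y -> (x <= y + n %/ M)%N) ->
    symmetric e -> irreflexive e ->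
    (forall x y, x != y -> ~~ e x y ->
       (1 + g%:R^-1) * n%:R <= #|nbh e x|%:R + #|nbh e y|%:R :> F) ->
    exists h : 'I_n -> 'I_n, injective h /\ forall x y, H x y -> e (h x) (h y).
Proof.
move=> g2; pose gam : F := g%:R^-1; pose d := gam / 48.
have gam0 : 0 < gam by rewrite invr_gt0 ltr0n (leq_trans _ g2).
have gam1 : gam <= 1 by rewrite invf_le1 ?ltr0n ?ler1n (leq_trans _ g2).
have d0 : 0 < d by rewrite /d; lra.
have d1 : d <= 1 by rewrite /d; lra.
pose y := d ^+ Delta; pose z := d ^+ Delta * d ^+ 2 / 8.
have y0 : 0 < y by exact: exprn_gt0.
have y1 : y <= 1 by apply: exprn_ile1 => //; apply: ltW.
have z0 : 0 < z by apply: divr_gt0; rewrite ?ltr0n // mulr_gt0 // exprn_gt0.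
have zy : z <= y.
  have : y * d ^+ 2 <= y by rewrite ler_piMr ?(ltW y0) // exprn_ile1 // ltW.
  rewrite /z -/y; lra.
have p0 : 0 < z ^+ Delta.+1 / 2 by rewrite divr_gt0 // exprn_gt0.
have [k kP] := nat_above (3 / (z ^+ Delta.+1 / 2)).
have k_big : 3 <= k%:R * (z ^+ Delta.+1 / 2) by rewrite -ler_pdivrMr.
pose Q := (4 * ((Delta * Delta).+1 * Delta.+1))%N.
pose A1 := (8 * Q)%N; pose A2 := (k * Q * (8 * g) * A1)%N.
have [S0 S0P] := nat_above (2 * (A1 + 2 * A2)%:R / z).
pose S := (S0 + 2)%N.
have S2 : (2 <= S)%N by rewrite leq_addl.
have S_big : 2 * (A1 + 2 * A2)%:R <= z * S%:R.
  have := ler_wpM2l (ltW z0) S0P; rewrite mulrCA divff ?gt_eqF // mulr1 /S natrD => h.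
  have : 0 <= z * 2 by rewrite mulr_ge0 // ltW.
  lra.
have SF : 0 < S%:R :> F by rewrite ltr0n (leq_trans _ S2).
have S1 : 1 <= S%:R :> F by rewrite ler1n (leq_trans _ S2).
pose delta : F := (2 * S)%:R^-1.
have dl0 : 0 < delta by rewrite invr_gt0 ltr0n muln_gt0 (leq_trans _ S2).
have dl1 : delta <= 1.
  by rewrite invf_le1 ?ltr0n ?ler1n muln_gt0 (leq_trans _ S2).
pose theta := gam / (48 * S%:R).
have S48 : 0 < 48 * S%:R :> F by lra.
have th0 : 0 < theta by apply: divr_gt0.
have thS : theta * (48 * S%:R) <= gam by rewrite /theta divfK // gt_eqF.
have th1 : theta <= 1.
  by rewrite ler_pdivrMr // mul1r; apply: le_trans gam1 _; lra.
have t20 : 0 < theta ^+ 2 by exact: exprn_gt0.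
have t21 : theta ^+ 2 <= 1 by apply: exprn_ile1 => //; exact: ltW.
have D1 : 1 <= Delta.+1%:R :> F by rewrite ler1n.
have D0' : 0 < Delta.+1%:R :> F by [].
(* All factors are at most [1], so the product meets the three bounds [eps_z], [eps_y] and [eps_th]
   at once. *)
pose eps := theta ^+ 2 * z * delta / (4 * Delta.+1%:R).
have D4 : 0 < 4 * Delta.+1%:R :> F by lra.
have eps0 : 0 < eps by apply: divr_gt0 => //; apply: mulr_gt0 => //; apply: mulr_gt0.
have zd : 0 < z * delta by rewrite mulr_gt0.
have epsE : Delta.+1%:R * eps = theta ^+ 2 * (z * delta) / 4.
  rewrite /eps; move: (Delta.+1%:R) D0' => D D0'; field; by rewrite gt_eqF.
have tzd : theta ^+ 2 * (z * delta) <= z * delta by rewrite ler_piMl // ltW.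
have eps_z : Delta.+1%:R * eps <= z / 4.
  rewrite epsE; have : z * delta <= z by rewrite ler_piMr // ltW.
  lra.
have eps_y : Delta.+1%:R * eps <= y * delta / 4.
  rewrite epsE; have : z * delta <= y * delta by rewrite ler_wpM2r // ltW.
  lra.
have z1 : z <= 1 by apply: le_trans zy y1.
have eps_th : 4 * eps <= theta ^+ 2.
  have h1 : eps <= Delta.+1%:R * eps by rewrite ler_peMl // ltW.
  have h2 : z * delta <= 1 by rewrite mulr_ile1 // ltW.
  have : theta ^+ 2 * (z * delta) <= theta ^+ 2 by rewrite ler_piMr // ltW.
  lra.
have [K regK] := regularity eps0.
have K1 : 0 < K%:R + 1 :> F by rewrite ltr_wpDl.
pose lam := theta ^+ 2 / (2 * (K%:R + 1)).
have K2 : 0 < 2 * (K%:R + 1) :> F by rewrite mulr_gt0.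
have lam0 : 0 < lam by apply: divr_gt0.
have lam_K : 2 * (K%:R * lam) <= theta ^+ 2.
  have : lam * (2 * (K%:R + 1)) = theta ^+ 2 by rewrite /lam divfK // gt_eqF.
  lra.
pose D0 := (K * K)%N.
have dzl : 0 < delta * z * lam / 2 by apply: divr_gt0 => //; apply: mulr_gt0 => //; apply: mulr_gt0.
have [L0 L0P] := nat_above (2 * D0%:R / (delta * z * lam / 2)).
pose Lq := (2 * (D0 + 6) + L0)%N; pose Lb := (Q * Lq)%N.
have LqLb : (Lq <= Lb)%N by rewrite leq_pmull.
have Lq_room : (2 * (D0 + 6) <= Lb)%N by apply: leq_trans LqLb; rewrite leq_addr.
have Lq_D0 : 2 * D0%:R <= delta * z * lam / 2 * Lb%:R.
  have h : L0%:R <= Lb%:R :> F by rewrite ler_nat; apply: leq_trans LqLb; rewrite leq_addl.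
  have := ler_wpM2l (ltW dzl) (le_trans L0P h).
  by rewrite mulrCA divff ?mulr1 // gt_eqF.
have ydl : 0 < y * delta * lam by apply: mulr_gt0 => //; apply: mulr_gt0.
pose sigma := theta * (y * delta * lam) / (8 * (K%:R + 1)).
have K8 : 0 < 8 * (K%:R + 1) :> F by lra.
have sg0 : 0 < sigma by apply: divr_gt0 => //; apply: mulr_gt0.
have sgE : 8 * (sigma * (K%:R + 1)) = theta * (y * delta * lam).
  by rewrite mulrCA /sigma divfK // gt_eqF.
have lam1 : lam <= 1.
  rewrite ler_pdivrMr // mul1r; apply: le_trans t21 _.
  have : 0 <= K%:R :> F by []. lra.
have ydl1 : y * delta * lam <= 1.
  have h : y * delta <= 1 by apply: mulr_ile1 => //; apply: ltW.
  by apply: mulr_ile1 => //; [apply: mulr_ge0; exact: ltW | exact: ltW].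
have sigma_K : sigma * (K%:R + 1) <= theta.
  have : theta * (y * delta * lam) <= theta by rewrite ler_piMr // ltW.
  lra.
have sigma_y : 4 * sigma < y * delta * lam.
  have h1 : theta * (y * delta * lam) <= y * delta * lam by rewrite ler_piMl // ltW.
  have : sigma <= sigma * (K%:R + 1).
    rewrite ler_peMr ?(ltW sg0) //; have : 0 <= K%:R :> F by []. lra.
  lra.
(* The factor [2] covers the rounding in [w], for which only [w * M <= 2 * n] holds. *)
have [M0 M0P] := nat_above (2 * (S%:R * Lb%:R) / sigma).
pose M := M0.+1.
have MP : 2 * (S%:R * Lb%:R) <= sigma * M%:R.
  have h : M0%:R <= M%:R :> F by rewrite ler_nat.
  have := ler_wpM2l (ltW sg0) (le_trans M0P h).
  by rewrite mulrCA divff ?mulr1 // gt_eqF.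
have [w0 w0P] := cube_lt_exp2 (2 * M ^ 3).
have [n1 n1P] := nat_above (8 / lam).
exists M, (M * w0.+1 + n1)%N; split=> // n H e chi0 nn H_sym H_irr degH chi0_col width e_sym e_irr ore.
have [chi [chi_col chi_iso]] := bipartite_recolor H_sym chi0_col.
(* The successor keeps blocks nonempty and gives [n <= M * w], by which [n ^ 3] is compared with
   [2 ^ w]. *)
pose w := (n %/ M).+1.
have Mn : (M * w0.+1 <= n)%N by apply: leq_trans nn; rewrite leq_addr.
have [L [c [LK irr]]] := regK 'I_n e.
have wM : (w * M <= 2 * n)%N.
  rewrite mul2n -addnn /w mulSn; apply: leq_add; last exact: leq_trunc_div.
  by apply: leq_trans Mn; rewrite leq_pmulr.
apply: (@final_embedding F n H 'I_n L e c chi Delta g k S K Lq w d eps theta lam sigma) => //.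
- by move=> x x' /width h; apply: leq_trans h _; rewrite leq_add2l.
- by rewrite card_ord.
- by move: irr; rewrite card_prod card_ord natrM.
- rewrite (natrM _ S) (natrM _ (Q * Lq)).
  have h1 : w%:R * M%:R <= 2 * n%:R :> F by rewrite -!natrM ler_nat.
  have h2 : 0 <= w%:R :> F by [].
  have := ler_wpM2r h2 MP; have := ler_wpM2l (ltW sg0) h1; rewrite /Lb; lra.
- rewrite mulrC -ler_pdivrMr //; apply: le_trans n1P _.
  by rewrite ler_nat; apply: leq_trans nn; rewrite leq_addl.
have ww : (w0 <= w)%N.
  by rewrite ltnW // ltnS leq_divRL // mulnC; apply: leq_trans Mn; rewrite leq_mul2l leqnSn orbT.
apply: leq_ltn_trans (w0P w ww); rewrite -mulnA leq_mul2l /= -expnMn leq_exp2r //.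
by rewrite mulnC ltnW // ltn_ceil.
Qed.

(** For a rational constant the degree condition is a statement about natural numbers; this carries
    it from [R] to [rat]. *)
Lemma ore_nat (K : realFieldType) (g n m : nat) : (0 < g)%N ->
  ((1 + g%:R^-1) * n%:R <= m%:R :> K) = (g.+1 * n <= g * m)%N.
Proof.
move=> g0; have gK : 0 < g%:R :> K by rewrite ltr0n.
rewrite -(ler_pM2l gK) -(ler_nat K) !natrM -natr1; congr (_ <= _).
by rewrite mulrA mulrDr mulr1 divff ?gt_eqF.
Qed.

Unset Implicit Arguments.

Theorem theorem1p5 (R : realFieldType) (Delta : nat) (gamma : R) :
  0 < gamma ->
  exists (beta : R) (n0 : nat), 0 < beta /\
    forall (n : nat) (eH eG : rel 'I_n),
      (n0 <= n)%N ->
      simple_graph eH -> bipartite eH -> maxdeg_le eH Delta ->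
      bandwidth_le eH (beta * n%:R) ->
      simple_graph eG ->
      (forall x y : 'I_n, x != y -> ~~ eG x y ->
         (1 + gamma) * n%:R <= (deg eG x + deg eG y)%:R) ->
      contains_copy eG eH.
Proof.
(* R need not be archimedean: if gamma is infinitesimal, then beta := gamma leaves H without
   edges; otherwise everything can be computed in rat. *)
move=> gamma0; have [[m m1]|infinitesimal] := classic (exists m : nat, 1 <= m%:R * gamma); last first.
  exists gamma, 0%N; split=> // n eH eG _ [eH_irr _] _ _ [s sP] _ _.
  exists id; split=> // x y xy; have := sP x y xy.
  have small : gamma * n%:R < 1.
    by rewrite ltNge mulrC; apply/negP => le; apply: infinitesimal; exists n.
  move/le_lt_trans/(_ small); rewrite -[1]/(1%:~R) ltr_int => close.
  have /val_inj/perm_inj xy' : s x = s y :> nat by move: close; clear; lia.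
  by rewrite xy' eH_irr in xy.
(* The offset ensures [2 <= g], as [bandwidth_embedding] demands. *)
pose g := m.+2; have g0 : 0 < g%:R :> R by [].
have gP : g%:R^-1 <= gamma.
  rewrite -div1r ler_pdivrMr // mulrC; apply: le_trans m1 _.
  by rewrite ler_wpM2r ?(ltW gamma0) // ler_nat /g -addn2 leq_addr.
have [M [n0 [M0 embed]]] := @bandwidth_embedding rat Delta g isT.
exists M%:R^-1, n0; split; first by rewrite invr_gt0 ltr0n.
move=> n eH eG nn [eH_irr eH_sym] [chi chiP] degH [s sP] [eG_irr eG_sym] ore.
(* H is relabelled so that its bandwidth labelling becomes the identity. *)
pose t := (s^-1)%g; pose H x y := eH (t x) (t y).
have MR : 0 < M%:R :> R by rewrite ltr0n.
have [||||||||h [hinj hP]] := embed n H eG (fun x => chi (t x)) nn.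
- by move=> x y; rewrite /H eH_sym.
- by move=> x; rewrite /H eH_irr.
- move=> x; apply: leq_trans (degH (t x)); rewrite -(card_imset _ (@perm_inj _ t)).
  apply/subset_leq_card/subsetP => y /imsetP[z]; rewrite !inE => hz ->; exact: hz.
- by move=> x y /chiP.
- move=> x y xy; have := sP _ _ xy; rewrite !permKV.
  rewrite mulrC ler_pdivlMr // -[M%:R]/(M%:Z%:~R) -[n%:R]/(n%:Z%:~R) -intrM ler_int => close.
  rewrite -leq_subLR leq_divRL //; move: close; clear; nia.
- exact: eG_sym.
- exact: eG_irr.
- move=> x y xy nxy; have := ore x y xy nxy.
  rewrite -natrD ore_nat // => le; rewrite -(ore_nat R) //; apply: le_trans le.
  by rewrite ler_wpM2r // lerD2l.
exists (h \o s); split=> [|x y xy]; first by apply: inj_comp => //; exact: perm_inj.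
by apply: hP; rewrite /H /t !permK.
Qed.
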